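(* For all $k\ge 0$ and all partitions $\lambda$, $a_{\lambda,k}\ge a'_{\lambda,k}$. Furthermore, equality holds when either $k=2$ or $\ell(\lambda)\le k+2$.
   Context: A $k$-family is a finite collection of distinct $k$-subsets of $\mathbb{P}=\{1,2,\dots\}$, with degree sequence $d(K)=(d_1,d_2,\dots)$, $d_i=|\{S\in K:i\in S\}|$; it is shifted if down-closed in the componentwise order on $k$-sets ($\{x_1<\dots<x_k\}\le\{y_1<\dots<y_k\}$ iff $x_i\le y_i$ for all $i$). The plethysm coefficients $a_{\lambda,k}$ are the Schur coefficients in $\sum_{m\ge0}e_m[e_k]=\prod_{S\in\binom{\mathbb{P}}{k}}(1+\prod_{i\in S}x_i)=\sum_\lambda a_{\lambda,k}s_\lambda$, and $a'_{\lambda,k}$ is the number of shifted $k$-families $K$ with $d(K)=\lambda$ (the Schur coefficients of $\sum_{K\text{ shifted}}s_{d(K)}$). $\ell(\lambda)$ is the number of parts of $\lambda$. *)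

(* Defs.v *)
From mathcomp Require Import all_boot all_order all_algebra.
From mathcomp Require Import finmap mpoly.
From mathcomp Require Import boolp classical_sets.

Set Implicit Arguments.
Unset Strict Implicit.
Unset Printing Implicit Defensive.

Import GRing.Theory.
Local Open Scope fset_scope.
Local Open Scope ring_scope.

(** The positive integers are represented by [nat], with i standing for i + 1;
    in n variables, ['X_i] with [i : 'I_n] likewise stands for x_{i+1}. *)

(** ** Partitions *)

Definition is_partition (lam : seq nat) : bool :=
  sorted geq lam && (0%N \notin lam).

(** The parts of a partition of d are at most d, and so is their number: the
    bounded sequences of type [d.-bseq 'I_d.+1] cover all the partitions of d,
    each exactly once. *)
Definition parts d (t : d.-bseq 'I_d.+1) : seq nat := [seq val i | i <- t].

Definition partition_of d (t : d.-bseq 'I_d.+1) : bool :=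
  is_partition (parts t) && (sumn (parts t) == d).

(** ** Schur polynomials *)

Definition cell (lam : seq nat) : finType :=
  {c : 'I_(size lam) * 'I_(head 0%N lam) | (c.2 < nth 0%N lam c.1)%N}.

Definition cell_row lam (c : cell lam) : nat := (val c).1.
Definition cell_col lam (c : cell lam) : nat := (val c).2.

Definition semistandard lam n (T : {ffun cell lam -> 'I_n}) : bool :=
  [forall c, forall c',
     ((cell_row c == cell_row c') && (cell_col c < cell_col c')%N
        ==> (T c <= T c')%N)
  && ((cell_col c == cell_col c') && (cell_row c < cell_row c')%N
        ==> (T c < T c')%N)].

Definition schur lam n : {mpoly int[n]} :=
  \sum_(T : {ffun cell lam -> 'I_n} | semistandard T) \prod_(c : cell lam) 'X_(T c).

(** ** Schur coefficients *)

(** A symmetric function in infinitely many variables is given by its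
    truncations [f n] to the first n variables (all other variables set to 0).
    As f need not be of bounded degree, the equality f = \sum_lam a_lam s_lam
    is stated in each degree d, where the sum is finite. *)
Definition schur_expansion (f : forall n, {mpoly int[n]}) (a : seq nat -> int) :
    Prop :=
  forall n d : nat,
    pihomog mdeg d (f n) =
    \sum_(t : d.-bseq 'I_d.+1 | partition_of t) a (parts t) *: schur (parts t) n.

(** The Schur functions form a Z-basis of the symmetric functions, so that for
    f symmetric the predicate [schur_expansion f] determines the values at
    partitions; the values at other sequences are irrelevant. *)
Definition schur_coef (f : forall n, {mpoly int[n]}) : seq nat -> int :=
  xget (fun=> 0) [set a | schur_expansion f a]%classic.

(** ** Plethysm coefficients *)

(** \sum_m e_m[e_k], as the product of 1 + \prod_(i in S) x_i over all k-subsets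
    S; a factor with S not contained in the first n indices truncates to 1. *)
Definition plethysm_series (k n : nat) : {mpoly int[n]} :=
  \prod_(S : {set 'I_n} | #|S| == k) (1 + \prod_(i in S) 'X_i).

Definition plethysm_coef (k : nat) (lam : seq nat) : int :=
  schur_coef (plethysm_series k) lam.

(** ** Shifted families *)

Definition kfamily (k : nat) (K : {fset {fset nat}}) : Prop :=
  forall S, S \in K -> #|` S| = k.

Definition componentwise_le (S T : {fset nat}) : bool :=
  all2 leq (sort leq S) (sort leq T).

Definition shifted (k : nat) (K : {fset {fset nat}}) : Prop :=
  kfamily k K /\
  forall S T, T \in K -> #|` S| = k -> componentwise_le S T -> S \in K.

Definition degree (K : {fset {fset nat}}) (i : nat) : nat :=
  #|` [fset S in K | i \in S]|.

Definition has_degree_sequence (K : {fset {fset nat}}) (lam : seq nat) : Prop :=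
  forall i, degree K i = nth 0%N lam i.

(** All members of a family with degree sequence lam are subsets of
    {0, ..., size lam - 1}, so the restriction to that ground set, which makes
    the collection finite, loses nothing: see [in_shifted_families]. *)
Definition shifted_families (k : nat) (lam : seq nat) :
    {fset {fset {fset nat}}} :=
  [fset K in fpowerset (fpowerset [fset i in iota 0 (size lam)])
     | `[< shifted k K /\ has_degree_sequence K lam >]].

Lemma in_shifted_families k lam K :
  K \in shifted_families k lam <-> shifted k K /\ has_degree_sequence K lam.
Proof.
rewrite !inE; split=> [/andP[_ /asboolP]//|KP].
apply/andP; split; last exact/asboolP.
case: KP => _ Kdeg.
rewrite fpowersetE; apply/fsubsetP => S SK.
rewrite fpowersetE; apply/fsubsetP => i iS.
rewrite !inE mem_iota /= add0n ltnNge; apply/negP => ile.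
have := Kdeg i; rewrite nth_default // => /eqP.
rewrite cardfs_eq0 => /eqP/fsetP/(_ S).
by rewrite !inE SK iS.
Qed.

Definition num_shifted (k : nat) (lam : seq nat) : nat :=
  #|` shifted_families k lam|.

(* Main.v *)
(** The k-families on n points form a basis of the exterior algebra of the k-th
    exterior power of Q^n, a representation of gl_n with character the plethysm
    series f in n variables, so that a_lam is the coefficient of x^(lam+delta)
    in a_delta f, where a_delta is the Vandermonde determinant.  In this basis
    E_ij and E_ji are transposed integer matrices, and a shifted family of
    degree sequence lam is a highest weight vector of weight lam.

    The inequality is thus a bound on the number of independent highest weight
    vectors, which the Casimir operator C provides.  Freudenthal's formula says
    that, for every P commuting with gl_n, the product of a_delta with the
    character weighted by the traces of P is mapped by the Laplacian
    sum_i (x_i d/dx_i)^2 to the same product for C P (with C suitably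
    normalized).  Hence the coefficient of x^(lam+delta) does not change when f
    is replaced by the character of the eigenspace of C for |lam+delta|^2.  On
    the weight space of mu, C - |mu+delta|^2 is 2 sum_(i<j) E_ij^T E_ij >= 0, so
    that this eigenspace has no weight lam + delta - s delta with s <> 1, and
    its part of weight lam contains the shifted families.

    For k = 2, a_delta prod_(i<j) (1 + x_i x_j) is, up to monomials, the
    Vandermonde determinant of the x_i - 1/x_i.  Therefore a_lam is 0, 1 or -1,
    and if it is not 0 then the |lam_i - i| are 0, ..., n - 1 in some order, in
    which case the pairs i < j with j <= lam_i form a shifted family of degree
    sequence lam.  For l(lam) <= k + 2, complementing the k-subsets of a
    (k+2)-set reduces to k = 2. *)

From HB Require Import structures.
Require Import Defs.
From mathcomp Require Import all_boot all_order all_algebra.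
From mathcomp Require Import fingroup perm finmap mpoly fraction zify ring.

Set Implicit Arguments.
Unset Strict Implicit.
Unset Printing Implicit Defensive.

Import Order.TTheory GRing.Theory Num.Theory.
Local Open Scope ring_scope.

(** * Fermionic second quantization *)

(** Over the integers the projection onto the eigenspace exists only up to a factor c > 0, as a
    symmetric matrix [pi] with pi^2 = c pi. Since [pi] is a polynomial in the Casimir operator, c
    a_lam is an alternating sum of diagonal entries of [pi]; these are nonnegative, those for s <> 1
    vanish, and each shifted family contributes exactly c, which replaces a count of independent
    vectors. The formula for a_lam needs work of its own: Schur polynomials are sums over tableaux
    and [schur_coef] is a choice among expansions, so it rests on the bialternant identity, proved
    by removing one variable at a time, and on the existence of an expansion with coefficients
    independent of n. In the equality cases with k > 0 the coefficient is 0 or 1, so that it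
    suffices to exhibit one shifted family when it is not 0. The case k = 0 stands apart: the empty
    family and the family of the empty set have the same degrees, and the size of a family cannot be
    read off from its degree sequence. *)

Lemma comm_bilinear_car (A : pzRingType) (I : eqType) (c c' : I -> A)
    (cc : forall s t, c s * c t = - (c t * c s))
    (c'c' : forall s t, c' s * c' t = - (c' t * c' s))
    (cc' : forall s t, c s * c' t = (s == t)%:R - c' t * c s) s t u v :
  c' s * c t * (c' u * c v) - c' u * c v * (c' s * c t) =
  (t == u)%:R * (c' s * c v) - (v == s)%:R * (c' u * c t).
Proof.
(* Normal ordering: the quartic term that remains is unchanged when the two bilinears trade places,
   as this costs two signs, and it cancels in the commutator. *)
have E a b d e : c' a * c b * (c' d * c e) =
    (b == d)%:R * (c' a * c e) - c' a * c' d * (c b * c e).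
  rewrite mulrA -(mulrA (c' a)) cc' mulrBr mulrBl !mulrA; congr (_ - _).
  by case: eqP; rewrite ?(mulr0, mul0r, mulr1, mul1r).
rewrite !E [c' u * c' s]c'c' [c v * c t]cc mulrNN.
by rewrite opprB addrA addrNK.
Qed.

Section SecondQuantization.
Variables (A : pzRingType) (I : finType) (c c' : I -> A).

(** For creation operators [c'] and annihilation operators [c], this is the extension of the matrix
    [m] to the exterior algebra as a derivation; by [quant_comm] it respects Lie brackets. *)
Definition quant (m : I -> I -> int) : A :=
  \sum_s \sum_t (c' s * c t) *~ m s t.

Lemma quantB m p : quant (fun s t => m s t - p s t) = quant m - quant p.
Proof.
rewrite /quant -sumrB; apply: eq_bigr => s _; rewrite -sumrB.
by apply: eq_bigr => t _; rewrite mulrzBr.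
Qed.

Lemma eq_quant m p : m =2 p -> quant m = quant p.
Proof. by move=> e; apply: eq_bigr => s _; apply: eq_bigr => t _; rewrite e. Qed.

Lemma quantM m p : quant m * quant p =
  \sum_s \sum_t \sum_u \sum_v
     (c' s * c t * (c' u * c v)) *~ (m s t * p u v).
Proof.
rewrite /quant mulr_suml; apply: eq_bigr => s _.
rewrite mulr_suml; apply: eq_bigr => t _.
rewrite mulr_sumr; apply: eq_bigr => u _.
rewrite mulr_sumr; apply: eq_bigr => v _.
by rewrite mulrzAl mulrzAr mulrzA_C.
Qed.

Hypothesis cc : forall s t, c s * c t = - (c t * c s).
Hypothesis c'c' : forall s t, c' s * c' t = - (c' t * c' s).
Hypothesis cc' : forall s t, c s * c' t = (s == t)%:R - c' t * c s.

Lemma quant_comm m p :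
  quant m * quant p - quant p * quant m =
  quant (fun s v => \sum_t (m s t * p t v - p s t * m t v)).
Proof.
have -> : quant p * quant m = \sum_s \sum_t \sum_u \sum_v
     (c' u * c v * (c' s * c t)) *~ (m s t * p u v).
  rewrite quantM pair_bigA /= [RHS]pair_bigA /=.
  under eq_bigr do rewrite pair_bigA /=.
  under [RHS]eq_bigr do rewrite pair_bigA /=.
  rewrite exchange_big /=; apply: eq_bigr => i _; apply: eq_bigr => j _.
  by rewrite mulrC.
rewrite quantM -sumrB.
under eq_bigr => s _.
  rewrite -sumrB; under eq_bigr => t _.
    rewrite -sumrB; under eq_bigr => u _.
      rewrite -sumrB; under eq_bigr => v _.
        rewrite -mulrzBl comm_bilinear_car // mulrzBl.
        rewrite -!mulrzAl.
        over.
      rewrite sumrB; over.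
    rewrite sumrB; over.
  rewrite sumrB; over.
rewrite sumrB (eq_quant (p := fun s v => \sum_t (m s t * p t v) - \sum_t (p s t * m t v))); last first.
  by move=> s v; rewrite sumrB.
rewrite quantB; congr (_ - _).
  apply: eq_bigr => s _; rewrite exchange_big /=.
  under eq_bigr do rewrite exchange_big /=.
  rewrite exchange_big /=; apply: eq_bigr => v _.
  rewrite mulrz_sumr exchange_big /=.
  apply: eq_bigr => t _; rewrite (bigD1 t) //= eqxx big1 ?addr0.
    by rewrite mulrzAl mul1r.
  by move=> u /negPf ut; rewrite eq_sym ut mul0rz mul0r.
rewrite exchange_big /= [RHS]exchange_big /=; apply: eq_bigr => t _.
rewrite exchange_big /=; apply: eq_bigr => u _.
rewrite mulrz_sumr; apply: eq_bigr => s _.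
rewrite (bigD1 s) //= eqxx big1 ?addr0; first by rewrite mulrzAl mul1r mulrC.
by move=> v /negPf vs; rewrite vs mul0rz mul0r.
Qed.

End SecondQuantization.

Section KernelMatrix.
Variable T : finType.

Definition kmx (f : T -> T -> int) : 'M[int]_#|T| :=
  \matrix_(i, j) f (enum_val i) (enum_val j).

Lemma kmxE f x y : kmx f (enum_rank x) (enum_rank y) = f x y.
Proof. by rewrite mxE !enum_rankK. Qed.

Lemma kmxP (A B : 'M[int]_#|T|) :
  (forall x y, A (enum_rank x) (enum_rank y) = B (enum_rank x) (enum_rank y)) ->
  A = B.
Proof.
by move=> e; apply/matrixP => i j; rewrite -(enum_valK i) -(enum_valK j) e.
Qed.

Lemma kmx_mul (A B : 'M[int]_#|T|) x y :
  (A * B) (enum_rank x) (enum_rank y) =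
  \sum_z A (enum_rank x) (enum_rank z) * B (enum_rank z) (enum_rank y).
Proof.
rewrite [LHS]mxE (reindex (@enum_rank T)) //=.
by exists enum_val => i _; rewrite ?enum_valK ?enum_rankK.
Qed.

Lemma kmx_1 x y : (1 : 'M[int]_#|T|) (enum_rank x) (enum_rank y) = (x == y)%:R.
Proof. by rewrite mxE (inj_eq enum_rank_inj). Qed.

End KernelMatrix.

(** * Creation and annihilation operators on an exterior algebra *)

Section Fock.
Variable I : finType.
Implicit Types (s t : I) (K L : {set I}).

(** The exponent of the sign incurred by moving s to its place in the wedge product of the elements
    of K, ordered by [enum_rank]. *)
Definition below s K : nat := #|[set t in K | (enum_rank t < enum_rank s)%N]|.

Lemma below_setU1 s t K : t \notin K ->
  below s (t |: K) = ((enum_rank t < enum_rank s)%N + below s K)%N.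
Proof.
move=> tK; rewrite /below.
case: (boolP (enum_rank t < enum_rank s)%N) => ts /=.
  transitivity #|t |: [set u in K | (enum_rank u < enum_rank s)%N]|.
    by apply: eq_card => u; rewrite !inE; case: eqP => // ->; rewrite ts.
  by rewrite cardsU1 inE (negPf tK).
rewrite add0n; apply: eq_card => u; rewrite !inE.
by case: eqP => // ->; rewrite (negPf ts) !andbF.
Qed.

(** Columns are the sources: the basis vector of L goes to that of L without s. Defining [create] as
    the transpose makes E_ij and E_ji adjoint from the start. *)
Definition annihil s : 'M[int]_#|{set I}| :=
  kmx (fun K L => if (s \notin K) && (L == s |: K) then (-1) ^+ below s K else 0).
Definition create s : 'M[int]_#|{set I}| := (annihil s)^T.

Lemma annihilE s K L : annihil s (enum_rank K) (enum_rank L) =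
  if (s \notin K) && (L == s |: K) then (-1) ^+ below s K else 0.
Proof. exact: kmxE. Qed.

Lemma createE s K L : create s (enum_rank K) (enum_rank L) =
  annihil s (enum_rank L) (enum_rank K).
Proof. by rewrite mxE. Qed.

Lemma below_rank_swap s t : s != t ->
  ((enum_rank t < enum_rank s) + (enum_rank s < enum_rank t) = 1)%N.
Proof.
move=> st; have := st; rewrite -(inj_eq (@enum_rank_inj I)) -val_eqE /=.
by case: ltngtP.
Qed.

Lemma signr_swap (a b c : nat) : (a + b = 1)%N ->
  (-1) ^+ (a + c) = - (-1) ^+ (b + c) :> int.
Proof.
by case: a b => [|[|a]] [|[|b]] // _; rewrite !exprD ?expr0 ?expr1 ?mul1r ?mulN1r ?opprK.
Qed.

Lemma annihil_anticomm s t : annihil s * annihil t = - (annihil t * annihil s).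
Proof.
have E a b K L : (annihil a * annihil b) (enum_rank K) (enum_rank L) =
    if [&& a \notin K, b \notin K, a != b & L == a |: (b |: K)] then
      (-1) ^+ ((enum_rank a < enum_rank b)%N + (below a K + below b K)) else 0.
  rewrite kmx_mul (bigD1 (a |: K)) //= [X in _ + X]big1 ?addr0; last first.
    by move=> M /negPf aM; rewrite annihilE aM andbF mul0r.
  rewrite !annihilE eqxx andbT !inE negb_or setUCA (eq_sym b a).
  case: ifP => aK /=; last by rewrite mul0r.
  case: ifP => [/andP[/andP[ab bK] e]|].
    by rewrite bK ab e /= below_setU1 // -exprD addnCA.
  by rewrite mulr0 => e; case: ifP => // /and3P[h1 h2 h3]; rewrite h1 h2 h3 in e.
apply: kmxP => K L; rewrite [RHS]mxE !E setUCA (eq_sym t s) [(below t K + _)%N]addnC.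
case: (altP (s =P t)) => [->|st]; first by rewrite !andbF oppr0.
rewrite /= [in RHS]andbCA.
case: ifP => // _.
by apply: signr_swap; rewrite addnC below_rank_swap.
Qed.

Lemma create_anticomm s t : create s * create t = - (create t * create s).
Proof.
rewrite /create -[_ * _]trmx_mul -[X in - X]trmx_mul -[RHS]raddfN.
by congr (_^T); exact: annihil_anticomm.
Qed.

(** For s = t exactly one of the two products acts on a given set, with the square of a sign; for s
    <> t both make the same move with opposite signs, because exactly one of s and t precedes the
    other. *)
Lemma annihil_create s t :
  annihil s * create t = (s == t)%:R - create t * annihil s.
Proof.
apply/eqP; rewrite -subr_eq opprK; apply/eqP/kmxP => K L.
rewrite [LHS]mxE !kmx_mul.
have -> : ((s == t)%:R : 'M[int]_#|{set I}|) (enum_rank K) (enum_rank L) =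
    ((s == t) && (K == L))%:R.
  by case: eqP => _; rewrite ?kmx_1 // mxE.
rewrite (bigD1 (s |: K)) //= [X in (_ + X) + _]big1 ?addr0; last first.
  by move=> M /negPf aM; rewrite annihilE aM andbF mul0r.
rewrite [X in _ + X](bigD1 (K :\ t)) //= [X in _ + (_ + X)]big1 ?addr0; last first.
  move=> M aM; rewrite createE annihilE.
  case: ifP => [/andP[tM /eqP e]|]; last by rewrite mul0r.
  by move: aM; rewrite e setU1K ?eqxx.
rewrite !createE !annihilE eqxx andbT !inE eqxx /=.
case: (altP (s =P t)) => [<-|st] /=.
  case: (boolP (s \in K)) => /= sK.
    rewrite mul0r add0r setD1K // eqxx (eq_sym L).
    by case: eqP => _; rewrite ?mulr0 // -exprD addnn -signr_odd odd_double.
  rewrite [K == s |: _](_ : _ = false); last first.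
    by apply: contraNF sK => /eqP->; rewrite !inE eqxx.
  rewrite mul0r addr0 (_ : (s \notin L) && _ = (K == L)).
    case: eqP => [<-|_]; rewrite ?mulr0 //.
    by rewrite -exprD addnn -signr_odd odd_double.
  case: (boolP (s \in L)) => /= sL.
    by case: eqP => // e; move: sK; rewrite e sL.
  case: (altP (K =P L)) => [->|KL]; first by rewrite eqxx.
  case: eqP => // e; case/eqP: KL; apply/setP => u; have /setP/(_ u) := e.
  rewrite !inE; case: (altP (u =P s)) => // -> _.
  by rewrite (negPf sK) (negPf sL).
have ts : t != s by rewrite eq_sym.
case: (boolP (s \in K)) => /= sK.
  by rewrite mul0r add0r mulr0.
case: (boolP (t \in K)) => /= tK; last first.
  rewrite [s |: K == _](_ : _ = false) ?andbF ?mulr0 ?add0r.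
    rewrite [K == _](_ : _ = false) ?mul0r //.
    by apply: contraNF tK => /eqP->; rewrite !inE eqxx.
  apply: contraNF tK => /eqP/setP/(_ t); rewrite !inE eqxx /= (negPf ts) /=.
  by move=> ->.
rewrite setD1K // eqxx /=.
set M := K :\ t.
have tM : t \notin M by rewrite !inE eqxx.
have sM : s \notin M by rewrite !inE (negPf sK) andbF.
have KE : K = t |: M by rewrite setD1K.
have -> : (t \notin L) && (s |: K == t |: L) = (L == s |: M).
  apply/andP/eqP => [[tL /eqP e]|->].
    apply/setP => u; have /setP/(_ u) := e; rewrite !inE.
    case: (altP (u =P t)) => [->|] //=; first by rewrite (negPf tL) (negPf ts).
  rewrite !inE negb_or ts eqxx /=; split=> //.
  by rewrite KE setUCA.
case: (altP (L =P s |: M)) => [->|]; last by rewrite !mulr0 addr0.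
rewrite below_setU1 // {1}KE below_setU1 // -!exprD.
rewrite -addnA addnCA [(_ + (_ + _))%N]addnC -addnA.
rewrite [X in _ + X](_ : _ = (-1) ^+ (0 + (below t M + below s M))) //.
set a := (enum_rank t < _)%N; set b := (enum_rank s < _)%N.
have := below_rank_swap st; rewrite -/a -/b.
rewrite [(_ + (_ + _))%N](_ : _ = (a + b) + (below t M + below s M))%N; last lia.
by move=> ->; rewrite exprD expr1 mulN1r addNr.
Qed.

End Fock.

(** * The action of gl_n on families *)

Section Hopping.
Variable I : finType.
Implicit Types (s t : I) (K L : {set I}).

(** Used at two levels: with ['I_n] as index type, where the sets of size k span the k-th exterior
    power, and with [kset], where the sets are k-families. *)
Definition hop s t : 'M[int]_#|{set I}| := create s * annihil t.

Lemma hopE s t K L : hop s t (enum_rank K) (enum_rank L) =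
  if (s \in K) && (K :\ s == L :\ t) && (t \in L)
  then (-1) ^+ (below s (K :\ s) + below t (K :\ s)) else 0.
Proof.
rewrite kmx_mul (bigD1 (K :\ s)) //= [X in _ + X]big1 ?addr0; last first.
  move=> M aM; rewrite createE annihilE.
  case: ifP => [/andP[tM /eqP e]|]; last by rewrite mul0r.
  by move: aM; rewrite e setU1K ?eqxx.
rewrite createE !annihilE !inE eqxx /=.
case: (boolP (s \in K)) => sK /=; last first.
  rewrite (_ : K == _ = false) ?mul0r //.
  by apply: contraNF sK => /eqP->; rewrite !inE eqxx.
rewrite setD1K // eqxx.
rewrite (_ : _ && _ = (K :\ s == L :\ t) && (t \in L)).
  by case: ifP => _; rewrite ?mulr0 // exprD.
apply/andP/andP => [[tM /eqP->]|[/eqP e tL]].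
  by rewrite setU11 setU1K // !inE.
have := setD11 t L; rewrite -e !inE => tM; rewrite tM; split=> //.
by rewrite e setD1K.
Qed.

Lemma hop_neq0 s t K L : hop s t (enum_rank K) (enum_rank L) != 0 ->
  [/\ s \in K, t \in L & K = s |: (L :\ t)].
Proof.
rewrite hopE; case: ifP => [/andP[/andP[sK /eqP e] tL] _|]; last by rewrite eqxx.
by rewrite -e setD1K.
Qed.

Lemma hopss s K L :
  hop s s (enum_rank K) (enum_rank L) = ((K == L) && (s \in K))%:R.
Proof.
rewrite hopE.
case: (boolP (s \in K)) => sK /=; last by rewrite andbF.
rewrite andbT; case: (altP (K =P L)) => [<-|KL].
  by rewrite eqxx sK addnn -signr_odd odd_double.
case: ifP => // /andP[/eqP e sL].
by case/eqP: KL; rewrite -(setD1K sK) e setD1K.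
Qed.

Lemma hop_card s t K L :
  hop s t (enum_rank K) (enum_rank L) != 0 -> #|K| = #|L|.
Proof.
rewrite hopE; case: ifP => [/andP[/andP[sK /eqP e] tL] _|]; last by rewrite eqxx.
by rewrite (cardsD1 s K) (cardsD1 t L) sK tL e.
Qed.

Lemma hop_tr s t K L : hop s t (enum_rank K) (enum_rank L) =
  hop t s (enum_rank L) (enum_rank K).
Proof.
rewrite !hopE andbAC eq_sym.
case: (altP (L :\ t =P K :\ s)) => [->|_]; last by rewrite !andbF.
by rewrite !andbT andbC addnC.
Qed.

Lemma hop_comm s t u v :
  hop s t * hop u v - hop u v * hop s t =
  (t == u)%:R * hop s v - (v == s)%:R * hop u t.
Proof.
apply: comm_bilinear_car.
- exact: annihil_anticomm.
- exact: create_anticomm.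
- exact: annihil_create.
Qed.

End Hopping.

Section FamilyRepresentation.
Variables (n k : nat).

Definition kset := {S : {set 'I_n} | #|S| == k}.

Definition hopk (i j : 'I_n) (S T : kset) : int :=
  hop i j (enum_rank (val S)) (enum_rank (val T)).

Definition gl (i j : 'I_n) : 'M[int]_#|{set kset}| :=
  quant (@annihil kset) (@create kset) (hopk i j).

Definition fdeg (K : {set kset}) (i : 'I_n) : nat := #|[set S in K | i \in val S]|.

Lemma hopk_comm i j p q (S U : kset) :
  \sum_T (hopk i j S T * hopk p q T U - hopk p q S T * hopk i j T U) =
  (j == p)%:R * hopk i q S U - (q == i)%:R * hopk p j S U.
Proof.
(* [hop] preserves cardinality, so the k-sets form an invariant block: intermediate sets of other
   sizes contribute 0. *)
have sub a b c d : \sum_T hopk a b S T * hopk c d T U =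
    (hop a b * hop c d) (enum_rank (val S)) (enum_rank (val U)).
  rewrite kmx_mul [RHS](bigID (fun T : {set 'I_n} => #|T| == k)) /=.
  rewrite [X in _ + X]big1 ?addr0; last first.
    move=> T Tk; have [|/hop_card e] := eqVneq (hop a b (enum_rank (val S)) (enum_rank T)) 0.
      by move->; rewrite mul0r.
    by case/eqP: Tk; rewrite -e; apply/eqP/(valP S).
  rewrite [RHS](reindex_omap (val : kset -> _) insub) /=.
    by apply: eq_bigl => T; rewrite (valP T) valK eqxx.
  by move=> T Tk; rewrite insubT.
rewrite sumrB !sub.
have /matrixP/(_ (enum_rank (val S)) (enum_rank (val U))) := hop_comm i j p q.
rewrite /hopk.
set x := hop i j; set y := hop p q; rewrite [LHS]mxE [X in _ + X = _]mxE => ->.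
rewrite [LHS]mxE [X in _ + X = _]mxE.
by do 2!case: eqP => _; rewrite ?mul1r ?mul0r // ?mxE.
Qed.

Lemma gl_comm i j p q :
  gl i j * gl p q - gl p q * gl i j = gl i q *+ (j == p) - gl p j *+ (q == i).
Proof.
rewrite /gl quant_comm; first last.
- exact: annihil_create.
- exact: create_anticomm.
- exact: annihil_anticomm.
rewrite (@eq_quant _ _ _ _ _ (fun S U => (j == p)%:R * hopk i q S U - (q == i)%:R * hopk p j S U)).
  rewrite quantB; congr (_ - _).
    by case: eqP => _; [apply: eq_quant => S U; rewrite mul1r|
       rewrite mulr0n; rewrite /quant big1 // => S _; rewrite big1 // => T _; rewrite mul0r].
  by case: eqP => _; [apply: eq_quant => S U; rewrite mul1r|
     rewrite mulr0n; rewrite /quant big1 // => S _; rewrite big1 // => T _; rewrite mul0r].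
by move=> S U; apply: hopk_comm.
Qed.

Lemma gl_entry i j K L : gl i j (enum_rank K) (enum_rank L) =
  \sum_S \sum_T hop S T (enum_rank K) (enum_rank L) * hopk i j S T.
Proof.
rewrite /gl /quant summxE; apply: eq_bigr => S _.
rewrite summxE; apply: eq_bigr => T _.
by rewrite -scaler_int mxE intz mulrC.
Qed.

Lemma gl_tr i j : (gl i j)^T = gl j i.
Proof.
apply: kmxP => K L; rewrite mxE !gl_entry exchange_big /=.
apply: eq_bigr => S _; apply: eq_bigr => T _.
by rewrite hop_tr; congr (_ * _); apply: hop_tr.
Qed.

Lemma gl_diag i K L :
  gl i i (enum_rank K) (enum_rank L) = (fdeg K i)%:R *+ (K == L).
Proof.
rewrite gl_entry.
under eq_bigr => S _.
  rewrite (bigD1 S) //= big1 ?addr0; last first.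
    move=> T TS; rewrite /hopk hopss.
    by rewrite (inj_eq val_inj) eq_sym (negPf TS) mulr0.
  rewrite /hopk !hopss eqxx /= -natrM mulnb.
  over.
rewrite -natr_sum -mulrnA; congr (_%:R).
case: eqP => /= [_|_]; last by rewrite muln0 big1.
rewrite muln1 /fdeg -sum1dep_card [RHS]big_mkcond /=.
by apply: eq_bigr => S _; case: (_ && _).
Qed.

(** Each term of E_ij applied to K exchanges some T in K for T - j + i. The closure of K makes this
    a set that K already contains, so that the wedge product acquires a repeated factor; the proof
    detects it as a loss of cardinality. *)
Lemma gl_raise0 (i j : 'I_n) (K L : {set kset}) : i != j ->
  (forall S T : kset, T \in K -> j \in val T -> i \notin val T ->
     val S = i |: (val T :\ j) -> S \in K) ->
  gl i j (enum_rank L) (enum_rank K) = 0.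
Proof.
move=> ij Kc; rewrite gl_entry big1 // => S _; rewrite big1 // => T _.
have [->|h] := eqVneq (hopk i j S T) 0; first by rewrite mulr0.
have [->|h'] := eqVneq (hop S T (enum_rank L) (enum_rank K)) 0; first by rewrite mul0r.
have [iS jT e] := hop_neq0 h; have [SL TK e'] := hop_neq0 h'.
have iT : i \notin val T.
  apply/negP => iT; have := hop_card h; rewrite e.
  rewrite (_ : _ |: _ = val T :\ j).
    by rewrite (cardsD1 j (val T)) jT => /eqP; rewrite -{1}[#|_|]add0n eqn_add2r.
  by apply/setP => x; rewrite !inE; case: eqP => // ->; rewrite ij iT.
have SK := Kc S T TK jT iT e.
have := hop_card h'; rewrite e' (_ : S |: _ = K :\ T).
  by rewrite (cardsD1 T K) TK => /eqP; rewrite -{1}[#|_|]add0n eqn_add2r.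
apply/setP => x; rewrite !inE; case: eqP => // ->; rewrite SK andbT.
apply/esym/eqP => ST; case/negP: iT; by rewrite -ST.
Qed.

End FamilyRepresentation.

(** * Euler operators and the Vandermonde determinant *)

Section Euler.
Variable n : nat.
Implicit Types (f g : {mpoly int[n]}) (m : 'X_{1..n}).

Definition euler (i : 'I_n) f : {mpoly int[n]} := 'X_i * f^`M(i).

Fact euler_is_additive i : zmod_morphism (euler i).
Proof. by move=> f g; rewrite /euler mderivB mulrBr. Qed.
HB.instance Definition _ i :=
  GRing.isZmodMorphism.Build _ _ (euler i) (euler_is_additive i).

Lemma eulerZ i c f : euler i (c *: f) = c *: euler i f.
Proof. by rewrite /euler mderivZ scalerAr. Qed.

Lemma eulerM i f g : euler i (f * g) = euler i f * g + f * euler i g.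
Proof. by rewrite /euler mderivM; ring. Qed.

Lemma eulerX i m : euler i 'X_[m] = (m i)%:R *: 'X_[m].
Proof.
rewrite /euler mderivX -scalerAr; case: (posnP (m i)) => [->|mi].
  by rewrite !scale0r.
rewrite -mpolyXD addmC submK //; apply/mnm_lepP => j; rewrite mnm1E.
by case: eqP => // <-.
Qed.

Lemma eulerU i j : euler i 'X_j = 'X_i *+ (i == j).
Proof.
by rewrite eulerX mnm1E (eq_sym j); case: eqP => [->|_]; rewrite ?scale1r ?scale0r.
Qed.

Lemma mcoeff_euler i f m : (euler i f)@_m = (m i)%:R * f@_m.
Proof.
rewrite [in LHS](mpolyE f) raddf_sum /= raddf_sum /=.
rewrite [in RHS](mpolyE f) raddf_sum /= mulr_sumr.
apply: eq_bigr => u _; rewrite eulerZ eulerX !mcoeffZ !mcoeffX.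
by case: (altP (u =P m)) => [->|]; rewrite ?mulr0 // !mulr1 mulrC.
Qed.

Definition laplace f := \sum_i euler i (euler i f).

Lemma mcoeff_laplace f m : (laplace f)@_m = (\sum_i (m i)%:R ^+ 2) * f@_m.
Proof.
rewrite raddf_sum /= mulr_suml; apply: eq_bigr => i _.
by rewrite !mcoeff_euler mulrA -expr2.
Qed.

Lemma laplaceM f g : laplace (f * g) =
  laplace f * g + 2%:R * (\sum_i euler i f * euler i g) + f * laplace g.
Proof.
rewrite /laplace !mulr_suml !mulr_sumr -!big_split /=.
by apply: eq_bigr => i _; rewrite eulerM raddfD /= !eulerM; ring.
Qed.

Definition ltpair (p : 'I_n * 'I_n) := (p.1 < p.2)%N.

Lemma big_ltpair (V : Type) (idx : V) (op : Monoid.com_law idx) (F : 'I_n -> 'I_n -> V) :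
  \big[op/idx]_i \big[op/idx]_j F i j =
  op (\big[op/idx]_i F i i) (\big[op/idx]_(p | ltpair p) op (F p.1 p.2) (F p.2 p.1)).
Proof.
rewrite big_split /=.
rewrite [X in op _ (op _ X)](reindex (fun p : 'I_n * 'I_n => (p.2, p.1))) /=; last first.
  by exists (fun p : 'I_n * 'I_n => (p.2, p.1)) => -[].
rewrite pair_bigA /= (bigID (fun p => p.1 == p.2)) /=; congr (op _ _).
  rewrite -(pair_big_dep xpredT (fun i j => i == j) F) /=.
  by apply: eq_bigr => i _; rewrite (big_pred1 i) // => j; rewrite eq_sym.
rewrite (bigID (fun p => ltpair p)) /=; congr (op _ _); apply: eq_bigl => -[i j];
  rewrite /ltpair /= -val_eqE /=; by case: ltngtP.
Qed.

Lemma sum_ltpair (V : zmodType) (F : 'I_n -> 'I_n -> V) :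
  \sum_i \sum_j F i j =
  \sum_i F i i + \sum_(p | ltpair p) (F p.1 p.2 + F p.2 p.1).
Proof. exact: big_ltpair. Qed.

Lemma sum_ltpair1 (V : zmodType) (F : 'I_n -> V) :
  \sum_(p | ltpair p) F p.1 = \sum_i F i *+ (n - i.+1).
Proof.
rewrite -(pair_big_dep xpredT (fun i j : 'I_n => i < j)%N (fun i _ => F i)) /=.
apply: eq_bigr => i _; rewrite sumr_const; congr (_ *+ _).
have := cardC [pred j : 'I_n | j < i.+1]%N; rewrite card_ord => e.
have e1 : #|[pred j : 'I_n | j < i.+1]%N| = i.+1.
  by rewrite -sum1_card -(big_ord_widen n (fun=> 1%N)) ?ltn_ord // sum1_card card_ord.
have e2 : #|[predC [pred j : 'I_n | j < i.+1]%N]| = #|(fun j : 'I_n => i < j)%N|.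
  by apply: eq_card => j; rewrite !inE ltnS -ltnNge.
by move: e; rewrite e1 e2 => /(congr1 (subn^~ i.+1)); rewrite addKn.
Qed.

Lemma sum_ltpair2 (V : zmodType) (F : 'I_n -> V) :
  \sum_(p | ltpair p) F p.2 = \sum_i F i *+ i.
Proof.
have := sum_ltpair (fun i _ => F i); rewrite big_split /= sum_ltpair1 => e.
apply: (addrI (\sum_i F i + \sum_i F i *+ (n - i.+1))).
rewrite -addrA -e -!big_split /=; apply: eq_bigr => i _.
rewrite sumr_const card_ord -mulrS -mulrnDr; congr (_ *+ _).
by rewrite addSnnS subnK.
Qed.

Definition vdm : {mpoly int[n]} := \prod_(p | ltpair p) ('X_p.2 - 'X_p.1).
(** The quotient of [vdm] by one of its factors, which permits division by x_j - x_i without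
    fractions. *)
Definition covdm (p : 'I_n * 'I_n) : {mpoly int[n]} :=
  \prod_(q | ltpair q && (q != p)) ('X_q.2 - 'X_q.1).

Lemma vdmE p : ltpair p -> vdm = ('X_p.2 - 'X_p.1) * covdm p.
Proof. by move=> hp; rewrite /vdm (bigD1 p). Qed.

Lemma euler_prod (I : eqType) (r : seq I) (F : I -> {mpoly int[n]}) i : uniq r ->
  euler i (\prod_(x <- r) F x) =
  \sum_(x <- r) (\prod_(y <- r | y != x) F y) * euler i (F x).
Proof.
elim: r => [|x r IH] /=.
  by rewrite !big_nil /euler -mpolyC1 mderivC mulr0.
case/andP => xr ur; rewrite !big_cons eulerM IH // eqxx /=.
congr (_ + _).
  rewrite mulrC; congr (_ * _); rewrite [RHS]big_seq_cond.
  rewrite big_seq; apply: eq_bigl => y; case: (boolP (y \in r)) => //= yr.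
  by apply/esym; apply: contraNneq xr => <-.
rewrite mulr_sumr [LHS]big_seq [RHS]big_seq; apply: eq_bigr => y yr.
rewrite big_cons (_ : x != y) ?mulrA //.
by apply: contraNneq xr => ->.
Qed.

Lemma euler_vdm i :
  euler i vdm = \sum_(p | ltpair p) covdm p * ('X_i *+ (i == p.2) - 'X_i *+ (i == p.1)).
Proof.
rewrite /vdm -big_filter euler_prod ?filter_uniq ?index_enum_uniq //.
rewrite big_filter; apply: eq_bigr => p _.
by rewrite big_filter_cond raddfB /= !eulerU.
Qed.

Lemma vdm_detE : vdm = \det (Vandermonde n (\row_i 'X_i)).
Proof.
rewrite det_Vandermonde.
rewrite (pair_big_dep xpredT (fun i j : 'I_n => i < j)%N
  (fun i j => (\row_i 'X_i) 0 j - (\row_i 'X_i) 0 i)) /=.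
by apply: eq_bigr => p _; rewrite !mxE.
Qed.

Lemma vdm_sum : vdm = \sum_(s : 'S_n) (-1) ^+ s *: 'X_[[multinom nat_of_ord (s i) | i < n]].
Proof.
rewrite vdm_detE -det_tr; apply: eq_bigr => s _.
rewrite mpolyXE_id -mul_mpolyC rmorphXn rmorphN rmorph1; congr (_ * _).
by apply: eq_bigr => i _; rewrite !mxE mnmE.
Qed.

(** Every monomial of the determinant has the exponents 0, ..., n - 1 in some order, hence the same
    eigenvalue. *)
Lemma laplace_vdm : laplace vdm = (\sum_(i < n) i%:R ^+ 2) *: vdm.
Proof.
apply/mpolyP => m; rewrite mcoeff_laplace mcoeffZ.
rewrite vdm_sum raddf_sum /= !mulr_sumr; apply: eq_bigr => s _.
rewrite mcoeffZ mcoeffX; case: eqP => [<-|_]; last by rewrite !mulr0.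
congr (_ * _); rewrite [RHS](reindex_inj (@perm_inj _ s)) /=.
by apply: eq_bigr => i _; rewrite mnmE.
Qed.

End Euler.

(** * The Casimir operator *)

Section Character.
Variables (n N : nat) (d : 'I_N -> 'X_{1..n}).
Implicit Types P Q : 'M[int]_N.

Definition wtr P : {mpoly int[n]} := \sum_K P K K *: 'X_[d K].

Fact wtr_is_additive : zmod_morphism wtr.
Proof.
move=> P Q; rewrite /wtr -sumrB; apply: eq_bigr => K _.
by rewrite !mxE scalerBl.
Qed.
HB.instance Definition _ := GRing.isZmodMorphism.Build _ _ wtr wtr_is_additive.

Variable E : 'I_n -> 'I_n -> 'M[int]_N.
Hypothesis E_comm : forall i j p q,
  E i j * E p q - E p q * E i j = E i q *+ (j == p) - E p j *+ (q == i).
Hypothesis E_tr : forall i j, (E i j)^T = E j i.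
Hypothesis E_diag : forall i K L, E i i K L = (d K i)%:R *+ (K == L).

Lemma mul_diagl i P K L : (E i i * P) K L = (d K i)%:R * P K L.
Proof.
rewrite [LHS]mxE (bigD1 K) //= E_diag eqxx big1 ?addr0 // => M /negPf MK.
by rewrite E_diag eq_sym MK mul0r.
Qed.

Lemma mul_diagr i P K L : (P * E i i) K L = P K L * (d L i)%:R.
Proof.
rewrite [LHS]mxE (bigD1 L) //= E_diag eqxx big1 ?addr0 // => M /negPf MK.
by rewrite E_diag MK mulr0.
Qed.

(** The entries of [E_pp, E_ij] can be computed from the diagonal matrices or from the relations; a
    nonzero entry cancels and leaves an equation between the two weights. *)
Lemma E_weight i j K L : E i j K L != 0 ->
  (d K + U_(j) = d L + U_(i))%MM.
Proof.
move=> E0; apply/mnmP => p; rewrite !mnmDE !mnm1E.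
have := E_comm p p i j => /matrixP/(_ K L).
rewrite [LHS]mxE mul_diagl [X in _ + X]mxE mul_diagr [RHS]mxE [X in _ = _ + X]mxE.
have -> : (E p j *+ (p == i)) K L = E i j K L *+ (i == p).
  by rewrite eq_sym; case: eqP => [->|_]; rewrite ?mulr1n // mulr0n mxE.
have -> : (E i p *+ (j == p)) K L = E i j K L *+ (j == p).
  by case: eqP => [->|_]; rewrite ?mulr1n // mulr0n mxE.
have key (x a b u v : int) :
    a * x - x * b = x * u - x * v -> x != 0 -> a + v = b + u.
  move=> /eqP; rewrite -subr_eq0.
  rewrite (_ : _ - _ = x * (a + v - (b + u))); last by ring.
  by rewrite mulf_eq0 => /orP[/eqP->|]; rewrite ?eqxx // subr_eq0 => /eqP.
rewrite -[_ *+ (j == p)]mulr_natr -[_ *+ (i == p)]mulr_natr => /key /(_ E0); rewrite -!natrD => /eqP.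
by rewrite eqr_nat => /eqP.
Qed.

Lemma euler_wtr i P : euler i (wtr P) = wtr (E i i * P).
Proof.
rewrite /wtr raddf_sum /=; apply: eq_bigr => K _.
by rewrite eulerZ eulerX mul_diagl scalerA mulrC.
Qed.

Definition central P := forall i j, P * E i j = E i j * P.

(** Cyclicity of the trace: E_ij maps the weight space of mu - e_i + e_j to that of mu, and the
    factors x_j and x_i compensate the shift of weight. *)
Lemma wtr_swap i j P : central P ->
  'X_j * wtr (E i j * E j i * P) = 'X_i * wtr (E j i * E i j * P).
Proof.
move=> cP.
rewrite -mulrA -[E j i * E i j * P]mulrA -(cP i j) (mulrA (E j i)).
rewrite /wtr !mulr_sumr.
under eq_bigr => K _ do rewrite -scalerAr -mpolyXD mxE scaler_suml.
under [RHS]eq_bigr => K _ do rewrite -scalerAr -mpolyXD mxE scaler_suml.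
rewrite exchange_big /=; apply: eq_bigr => K _; apply: eq_bigr => L _.
have [->|/E_weight e] := eqVneq (E i j L K) 0; first by rewrite mul0r mulr0 !scale0r.
by rewrite mulrC addmC e addmC.
Qed.

(** Since [E_ij, E_ji] = E_ii - E_jj, [wtr_swap] becomes a linear equation for the series of E_ij
    E_ji P. This is Freudenthal's sum along a root string, as a generating function. *)
Lemma wtr_root i j P : central P -> i != j ->
  ('X_i - 'X_j) * wtr (E i j * E j i * P) =
  'X_i * (euler i (wtr P) - euler j (wtr P)).
Proof.
move=> cP ij; rewrite mulrBl wtr_swap // -mulrBr !euler_wtr -!raddfB /=.
by rewrite -!mulrBl E_comm !eqxx.
Qed.

Definition casimir : 'M[int]_N := \sum_i \sum_j E i j * E j i.
Definition edeg : 'M[int]_N := \sum_i E i i.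

Lemma central_casimir : central casimir.
Proof.
move=> p q; apply/eqP; rewrite -subr_eq0; apply/eqP.
rewrite /casimir mulr_suml mulr_sumr -sumrB.
have e i j : E i j * E j i * E p q - E p q * (E i j * E j i) =
   (E i j * E j q *+ (i == p) - E i j * E p i *+ (q == j)) +
   (E i q * E j i *+ (j == p) - E p j * E j i *+ (q == i)).
  rewrite -[E i q * _ *+ _]mulrnAl -[E p j * _ *+ _]mulrnAl.
  rewrite -!mulrnAr -mulrBr -mulrBl -!E_comm.
  by rewrite mulrBr mulrBl !mulrA addrA subrK.
under eq_bigr => i _.
  rewrite mulr_suml mulr_sumr -sumrB.
  under eq_bigr => j _ do rewrite e.
  rewrite big_split /= !sumrB; over.
rewrite big_split /= !sumrB.
have dl (F : 'I_n -> 'M[int]_N) a : \sum_i F i *+ (i == a) = F a.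
  by rewrite (bigD1 a) //= eqxx big1 ?addr0 // => i /negPf ->; rewrite mulr0n.
have dr (F : 'I_n -> 'M[int]_N) a : \sum_i F i *+ (a == i) = F a.
  by rewrite -[RHS](dl F); apply: eq_bigr => i _; rewrite eq_sym.
rewrite exchange_big /=.
under eq_bigr do rewrite dl.
under [X in _ - X + _]eq_bigr do rewrite dr.
under [X in _ + (X - _)]eq_bigr do rewrite dl.
rewrite [X in _ + (_ - X)]exchange_big /=.
under [X in _ + (_ - X)]eq_bigr do rewrite dr.
by rewrite addrC addrA subrK subrr.
Qed.

Lemma central_edeg : central edeg.
Proof.
move=> p q; apply/eqP; rewrite -subr_eq0; apply/eqP.
rewrite /edeg mulr_suml mulr_sumr -sumrB.
under eq_bigr do rewrite E_comm.
rewrite sumrB (bigD1 p) //= eqxx big1 ?addr0; last first.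
  by move=> i /negPf->; rewrite mulr0n.
rewrite (bigD1 q) //= eqxx big1 ?addr0 ?subrr //.
by move=> i /negPf; rewrite eq_sym => ->; rewrite mulr0n.
Qed.

Definition normdelta : nat := \sum_(i < n) i ^ 2.

(* Acts on a highest weight vector of weight [mu] by [|mu + delta|^2]. *)
Definition scasimir : 'M[int]_N := casimir + (edeg *+ n - edeg) + normdelta%:R.

Lemma central_scasimir : central scasimir.
Proof.
move=> p q; rewrite /scasimir !(mulrDl, mulrDr) mulNr mulrN !mulrnAl !mulrnAr.
by rewrite central_casimir central_edeg mul1r mulr1.
Qed.

(* Freudenthal's multiplicity formula, read as an eigenvalue equation for the
   product of the character with the Weyl denominator. *)
Lemma laplace_vdm_wtr P : central P ->
  laplace (vdm n * wtr P) = vdm n * wtr (scasimir * P).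
Proof.
move=> cP; set g := wtr P.
rewrite /scasimir !mulrDl mulNr !raddfD raddfN /= !mulrnAl mul1r !raddfMn /= -/g.
rewrite laplaceM laplace_vdm.
have eH : wtr (edeg * P) = \sum_i euler i g.
  by rewrite /edeg mulr_suml raddf_sum; apply: eq_bigr => i _; rewrite euler_wtr.
have eL : \sum_i wtr (E i i * E i i * P) = laplace g.
  by apply: eq_bigr => i _; rewrite !euler_wtr mulrA.
(* A pair contributes E_ij E_ji and E_ji E_ij; [wtr_root] determines each of them after
   multiplication by the factor of [vdm] that belongs to the pair. *)
have eC : vdm n * wtr (casimir * P) = vdm n * laplace g +
    \sum_(p | ltpair p) covdm p * (('X_p.1 + 'X_p.2) * (euler p.2 g - euler p.1 g)).
  rewrite /casimir mulr_suml raddf_sum /=.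
  under eq_bigr do rewrite mulr_suml raddf_sum.
  rewrite (sum_ltpair (fun i j => wtr (E i j * E j i * P))) mulrDr eL.
  congr (_ + _); rewrite mulr_sumr; apply: eq_bigr => p hp.
  have p12 : p.1 != p.2 by rewrite -val_eqE /= ltn_eqF.
  have r1 := wtr_root cP p12; rewrite -/g in r1.
  rewrite eq_sym in p12; have r2 := wtr_root cP p12; rewrite -/g in r2.
  move: (wtr (E p.1 p.2 * _ * _)) (wtr (E p.2 p.1 * _ * _)) r1 r2 => t1 t2 r1 r2.
  rewrite (vdmE hp) [_ * covdm p]mulrC -mulrA mulrDr r2; congr (_ * _).
  by rewrite -[X in X * t1]opprB mulNr r1; ring.
(* 2 (x_j b - x_i a) = (x_i + x_j) (b - a) + (x_j - x_i) (a + b): the first term is the root part of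
   the Casimir operator; the second restores the factor of [vdm] and, summed over all pairs, gives n
   - 1 times the sum of the Euler operators. *)
have eP : 2%:R * (\sum_i euler i (vdm n) * euler i g) =
    \sum_(p | ltpair p) covdm p * (('X_p.1 + 'X_p.2) * (euler p.2 g - euler p.1 g)) +
    vdm n * (\sum_(p | ltpair p) (euler p.1 g + euler p.2 g)).
  have -> : \sum_i euler i (vdm n) * euler i g =
     \sum_(p | ltpair p) covdm p * ('X_p.2 * euler p.2 g - 'X_p.1 * euler p.1 g).
    under eq_bigr do rewrite euler_vdm mulr_suml.
    rewrite exchange_big /=; apply: eq_bigr => p _.
    under eq_bigr do rewrite -mulrA mulrBl.
    rewrite -mulr_sumr sumrB; congr (_ * (_ - _)).
      rewrite (bigD1 p.2) //= eqxx big1 ?addr0 // => i /negPf->.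
      by rewrite mulr0n mul0r.
    rewrite (bigD1 p.1) //= eqxx big1 ?addr0 // => i /negPf->.
    by rewrite mulr0n mul0r.
  rewrite !mulr_sumr -big_split /=; apply: eq_bigr => p hp.
  by rewrite (vdmE hp); ring.
have eS : \sum_(p | ltpair p) (euler p.1 g + euler p.2 g) =
    (\sum_i euler i g) *+ n - \sum_i euler i g.
  apply/eqP; rewrite eq_sym subr_eq addrC; apply/eqP.
  rewrite -(sum_ltpair (fun i _ => euler i g)) -sumrMnl.
  by apply: eq_bigr => i _; rewrite sumr_const card_ord.
have eD : \sum_(i < n) i%:R ^+ 2 = normdelta%:R :> int.
  by rewrite natr_sum; apply: eq_bigr => i _; rewrite natrX.
rewrite eP eS !mulrDr eC eH eD scaler_nat mulrnAl -mulrnAr.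
move: (vdm n * (_ *+ n)) (_ * (g *+ _)) => a b.
by rewrite [RHS]addrC -!addrA; congr (_ + _); rewrite [RHS]addrC !addrA.
Qed.

End Character.

(** With B = A^(m+1) C, the product B^T B contains A^(m+2) C and is 0; its diagonal entries are sums
    of squares, so that B = 0. Thus a symmetric matrix has no nilpotent part at the eigenvalue 0. *)
Lemma sym_nilp (N : nat) (A C : 'M[int]_N) m : A^T = A ->
  A ^+ m * C = 0 -> A * C = 0.
Proof.
move=> At; elim: m => [|[|m] IH]; first by rewrite expr0 mul1r => ->; rewrite mulr0.
  by rewrite expr1.
move=> AC; apply: IH; apply/matrixP => i j; rewrite [RHS]mxE.
set B := A ^+ m.+1 * C.
have BB : B^T * B = 0.
  have -> : B^T * B = (A ^+ m * C)^T * (A ^+ m.+2 * C).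
    rewrite /B exprS -(mulrA A) [(A * _)^T]trmx_mul At.
    by rewrite [_ *m A](_ : _ = (A ^+ m * C)^T * A) // -mulrA !exprS !mulrA.
  by rewrite AC mulr0.
have /matrixP/(_ j j) := BB; rewrite [LHS]mxE [RHS]mxE => /eqP.
rewrite psumr_eq0; last by move=> k _; rewrite mxE -expr2 sqr_ge0.
move/allP/(_ i); rewrite mem_index_enum mxE -expr2 sqrf_eq0 => /(_ isT)/eqP.
by [].
Qed.

(* The projection onto the kernel of a symmetric matrix, up to a scalar, as a
   polynomial in that matrix. *)
Lemma sym_kernel_projection (N : nat) (A : 'M[int]_N) : A^T = A ->
  exists (c : int) (R : 'M[int]_N), [/\ 0 < c,
    A * (c%:M - A * R) = 0, (c%:M - A * R)^T = c%:M - A * R &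
    forall B, A * B = B * A -> R * B = B * R].
Proof.
case: N A => [|N] A At.
  by exists 1, 0; split=> // [||B _]; rewrite [LHS]flatmx0 [RHS]flatmx0.
have pA0 : char_poly A != 0 by exact/monic_neq0/char_poly_monic.
(* The characteristic polynomial is q X^m with q(0) <> 0. By Cayley-Hamilton A^m q(A) = 0, and
   [sym_nilp] replaces m by 1. *)
have [m [q q0 eq]] := multiplicity_XsubC (char_poly A) 0.
rewrite pA0 /= in q0.
have q00 : q.[0] != 0 by exact: q0.
have := Cayley_Hamilton A; rewrite eq rmorphM rmorphXn /= subr0 horner_mx_X => CH.
have comm p B : A * B = B * A -> horner_mx A p * B = B * horner_mx A p.
  move=> AB; elim/poly_ind: p => [|p c IH]; first by rewrite rmorph0 mul0r mulr0.
  rewrite rmorphD rmorphM /= horner_mx_X horner_mx_C mulrDl mulrDr.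
  rewrite -mulrA AB mulrA IH mulrA; congr (_ + _).
  by rewrite [LHS]mul_scalar_mx [RHS]mul_mx_scalar.
have tr p : (horner_mx A p)^T = horner_mx A p.
  elim/poly_ind: p => [|p c IH]; first by rewrite rmorph0 trmx0.
  rewrite rmorphD rmorphM /= horner_mx_X horner_mx_C [LHS]raddfD /= tr_scalar_mx.
  by congr (_ + _); rewrite [LHS]trmx_mul At IH; apply/esym/comm.
have AQ : A * horner_mx A q = 0.
  by apply: (@sym_nilp _ _ _ m) => //; rewrite -comm // -exprSr exprS.
(* The sign makes c = q1(0) positive; writing q1 = r X + c gives q1(A) = c - A R with R = - r(A). *)
pose s := Num.sg q.[0]; pose q1 := s%:P * q.
have c0 : 0 < q1.[0].
  by rewrite /q1 hornerM hornerC -normrEsg normr_gt0.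
have [r er] : exists r, q1 = r * 'X + (q1.[0])%:P.
  have : root (q1 - (q1.[0])%:P) 0 by rewrite rootE hornerD hornerN hornerC subrr.
  case/factor_theorem => r; rewrite subr0 => e; exists r.
  by rewrite -e subrK.
exists q1.[0], (- horner_mx A r).
have eQ : (q1.[0])%:M - A * - horner_mx A r = horner_mx A q1.
  rewrite [in RHS]er rmorphD rmorphM /= horner_mx_X horner_mx_C mulrN opprK addrC.
  by rewrite comm.
rewrite eQ; split=> //.
  by rewrite rmorphM /= horner_mx_C [X in A * X]mul_scalar_mx -scalerAr AQ scaler0.
by move=> B AB; rewrite mulrN mulNr comm.
Qed.

(** * Highest weight vectors *)

Section Rearrangement.
Variables (n : nat).
Implicit Types (l : 'I_n -> nat) (s : 'S_n).

Lemma card_lt_perm s (i : 'I_n) : #|[set j : 'I_n | (s j < s i)%N]| = s i.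
Proof.
rewrite -(card_imset _ (@perm_inj _ s)).
have -> : s @: [set j : 'I_n | (s j < s i)%N] = [set j : 'I_n | (j < s i)%N].
  apply/setP => j; apply/imsetP/idP => [[x]|]; first by rewrite inE => h ->; rewrite inE.
  by rewrite inE => h; exists ((s^-1)%g j); rewrite ?inE permKV.
rewrite -[RHS]card_ord -[RHS]sum1_card (big_ord_widen n (fun=> 1%N)) 1?ltnW //.
by rewrite sum1_card; apply: eq_card => j; rewrite inE.
Qed.

(** Writing s i as the number of j with s j < s i turns the sum into one over pairs i < j, each
    contributing l i or l j; the identity always picks l j, the smaller one. *)
Lemma rearrange l s : (forall i j : 'I_n, (i < j)%N -> (l j <= l i)%N) ->
  \sum_i (l i * i)%:R <= \sum_i (l i * s i)%:R :> int.
Proof.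
move=> ldec.
have E (t : 'S_n) : \sum_i (l i * t i)%:R =
    \sum_(p | ltpair p)
      ((l p.1 * (t p.2 < t p.1)%N)%:R + (l p.2 * (t p.1 < t p.2)%N)%:R) :> int.
  have e i : (l i * t i)%:R = \sum_j (l i * (t j < t i)%N)%:R :> int.
    rewrite -[in LHS]card_lt_perm -sum1dep_card -natr_sum -big_distrr /=; congr (_ * _)%:R.
    rewrite big_mkcond; apply: eq_bigr => j _. by case: ifP.
  under eq_bigr do rewrite e.
  rewrite (sum_ltpair (fun i j => (l i * (t j < t i)%N)%:R)) big1 ?add0r // => i _.
  by rewrite ltnn muln0.
have -> : \sum_i (l i * i)%:R = \sum_i (l i * (1%g : 'S_n) i)%:R :> int.
  by apply: eq_bigr => i _; rewrite perm1.
rewrite !E; apply: ler_sum => -[i j] /= ij.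
rewrite !perm1 -!natrD ler_nat.
rewrite /ltpair /= in ij; have := ldec _ _ ij.
have sij : (s i != s j :> nat) by rewrite val_eqE (inj_eq perm_inj) -val_eqE /= ltn_eqF.
have ji : (j < i)%N = false by rewrite ltnNge ltnW.
rewrite ij ji muln0 muln1 add0n.
by case: ltngtP sij => //= _ _ h; rewrite ?muln0 ?muln1 ?addn0 ?add0n.
Qed.

(* The vectors [l + (delta - s delta)] with [s <> 1] are longer than [l]. *)
Lemma shift_longer l s : (forall i j : 'I_n, (i < j)%N -> (l j <= l i)%N) ->
  s != 1%g ->
  \sum_i (l i)%:R ^+ 2 < \sum_i ((l i)%:R + (s i)%:R - i%:R) ^+ 2 :> int.
Proof.
move=> ldec s1.
have -> : \sum_i ((l i)%:R + (s i)%:R - i%:R) ^+ 2 = \sum_i (l i)%:R ^+ 2 +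
    (2%:R * (\sum_i (l i * s i)%:R - \sum_i (l i * i)%:R) +
    \sum_i ((s i)%:R - i%:R) ^+ 2) :> int.
  rewrite -sumrB mulr_sumr -!big_split /=; apply: eq_bigr => i _.
  by rewrite !natrM; ring.
rewrite ltrDl ltr_wpDl //; first by rewrite mulr_ge0 // subr_ge0 rearrange.
rewrite lt_neqAle sumr_ge0 ?andbT; last by move=> i _; rewrite sqr_ge0.
rewrite eq_sym psumr_neq0; last by move=> i _; rewrite sqr_ge0.
have [i si] : exists i, s i != i.
  apply/existsP; apply: contraR s1; rewrite negb_exists => /forallP h.
  by apply/eqP/permP => i; rewrite perm1; apply/eqP; have := h i; rewrite negbK.
apply/hasP; exists i; first exact: mem_index_enum.
by rewrite /= exprn_even_gt0 //= subr_eq0 eqr_nat.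
Qed.

End Rearrangement.

Section Multiplicity.
Variables (n N : nat) (d : 'I_N -> 'X_{1..n}).
Variable E : 'I_n -> 'I_n -> 'M[int]_N.
Hypothesis E_comm : forall i j p q,
  E i j * E p q - E p q * E i j = E i q *+ (j == p) - E p j *+ (q == i).
Hypothesis E_tr : forall i j, (E i j)^T = E j i.
Hypothesis E_diag : forall i K L, E i i K L = (d K i)%:R *+ (K == L).

Local Notation scas := (scasimir E).

Definition sqwt (K : 'I_N) : int := \sum_i (d K i + (n - i.+1))%:R ^+ 2.

(** For each pair i < j, putting the raising operator E_ij on the right costs E_ii - E_jj. With the
    degree term of [scasimir], the coefficient of E_ii becomes (n-1-i) - i + (n-1) = 2 (n-1-i),
    which completes the square |mu + delta|^2. *)
Lemma scasimir_entry K L : scas K L = sqwt K *+ (K == L) +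
  (\sum_(p | ltpair p) E p.2 p.1 * E p.1 p.2) K L *+ 2.
Proof.
have -> : scas = \sum_i (E i i * E i i + E i i *+ (2 * (n - i.+1)) + ((n - i.+1) ^ 2)%:R) +
    (\sum_(p | ltpair p) E p.2 p.1 * E p.1 p.2) *+ 2.
  rewrite /scasimir /casimir (sum_ltpair (fun i j => E i j * E j i)).
  have -> : \sum_(p | ltpair p) (E p.1 p.2 * E p.2 p.1 + E p.2 p.1 * E p.1 p.2) =
     (\sum_(p | ltpair p) E p.2 p.1 * E p.1 p.2) *+ 2 +
     (\sum_(p | ltpair p) E p.1 p.1 - \sum_(p | ltpair p) E p.2 p.2).
    rewrite -sumrMnl -sumrB -big_split /=; apply: eq_bigr => p _.
    have := E_comm p.1 p.2 p.2 p.1; rewrite !eqxx !mulr1n => <-.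
    by rewrite mulr2n -[RHS]addrA [X in _ = _ + X]addrC subrK addrC.
  rewrite (sum_ltpair1 (fun i => E i i)) (sum_ltpair2 (fun i => E i i)).
  rewrite !big_split /= -natr_sum.
  have -> : (\sum_(i < n) (n - i.+1) ^ 2)%N = normdelta n.
    rewrite /normdelta (reindex_inj rev_ord_inj) /=; apply: eq_bigr => i _.
    by rewrite subnS subKn // ltnW.
  have -> : \sum_i E i i *+ (2 * (n - i.+1)) =
      \sum_i E i i *+ (n - i.+1) - \sum_i E i i *+ i + (edeg E *+ n - edeg E).
    rewrite /edeg -sumrMnl -!sumrB -big_split /=; apply: eq_bigr => i _.
    apply/eqP; rewrite eq_sym addrACA -opprD subr_eq -mulrSr -!mulrnDr; apply/eqP.
    by congr (_ *+ _); have := ltn_ord i; lia.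
  rewrite -!addrA; congr (_ + _).
  by rewrite mulr2n [LHS]addrA [LHS]addrC -!addrA.
rewrite mxE [X in _ + X](_ : _ = (\sum_(p | ltpair p) E p.2 p.1 * E p.1 p.2) K L *+ 2).
  congr (_ + _); rewrite summxE.
  rewrite /sqwt -sumrMnl; apply: eq_bigr => i _.
  rewrite mxE [X in X + _]mxE (mul_diagl E_diag) mulmxnE !E_diag.
  rewrite [X in _ + X](_ : _ = ((n - i.+1) ^ 2)%:R *+ (K == L)); last first.
    by rewrite mulmxnE mxE -mulrnA mulnC mulrnA.
  case: eqP => _; last by rewrite !mulr0n mulr0 mul0rn !addr0.
  by rewrite !mulr1n -[_ *+ (2 * _)]mulr_natr natrM natrX natrD; ring.
by rewrite mulr2n mxE -mulr2n.
Qed.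

End Multiplicity.

(** Up to sign the same denominator as [vdm]: its decreasing exponents fit partitions, whereas the
    product form of [vdm] suits the Laplacian. *)
Definition alt_delta n : {mpoly int[n]} :=
  \sum_(s : 'S_n) (-1) ^+ s *: 'X_[[multinom (n - (s i).+1)%N | i < n]].

Definition rev_perm n : 'S_n := perm (@rev_ord_inj n).

Lemma rev_permE n (i : 'I_n) : rev_perm n i = (n.-1 - i)%N :> nat.
Proof. by rewrite permE /=; lia. Qed.

Lemma vdm_alt_delta n : exists e : bool, vdm n = (-1) ^+ e *: alt_delta n.
Proof.
set r := rev_perm n; exists (odd_perm r).
rewrite vdm_sum /alt_delta (reindex_inj (mulIg r)) /= scaler_sumr.
apply: eq_bigr => s _; rewrite odd_permM signr_addb scalerA mulrC.
congr (_ *: 'X_[_]); apply/mnmP => i; rewrite !mnmE permM rev_permE.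
by have := ltn_ord (s i); lia.
Qed.

Lemma mcoeff_alt_delta_sum n N (c : 'I_N -> int) (d : 'I_N -> 'X_{1..n}) m :
  (alt_delta n * \sum_K c K *: 'X_[d K])@_m =
  \sum_(s : 'S_n) \sum_K
     (-1) ^+ s * c K * ([multinom (n - (s i).+1)%N | i < n] + d K == m)%MM%:R.
Proof.
rewrite /alt_delta mulr_suml raddf_sum /=; apply: eq_bigr => s _.
rewrite mulr_sumr raddf_sum /=; apply: eq_bigr => K _.
by rewrite -scalerAl -scalerAr scalerA mcoeffZ -mpolyXD mcoeffX.
Qed.

Section MultiplicityBound.
Variables (n N : nat) (d : 'I_N -> 'X_{1..n}).
Variable E : 'I_n -> 'I_n -> 'M[int]_N.
Hypothesis E_comm : forall i j p q,
  E i j * E p q - E p q * E i j = E i q *+ (j == p) - E p j *+ (q == i).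
Hypothesis E_tr : forall i j, (E i j)^T = E j i.
Hypothesis E_diag : forall i K L, E i i K L = (d K i)%:R *+ (K == L).
Variable lam : 'X_{1..n}.
Hypothesis lam_dec : forall i j : 'I_n, (i < j)%N -> (lam j <= lam i)%N.

Let l : 'X_{1..n} := [multinom (lam i + (n - i.+1))%N | i < n].
Let nl : int := \sum_i (l i)%:R ^+ 2.

Lemma highest_weight_bound (S : {set 'I_N}) :
  (forall K, K \in S -> d K = lam /\
     forall i j : 'I_n, (i < j)%N -> forall L, E i j L K = 0) ->
  (#|S|)%:R <= (alt_delta n * \sum_K 'X_[d K])@_l.
Proof.
move=> HS.
pose A : 'M[int]_N := scasimir E - nl%:M.
have Ecas_tr : (scasimir E)^T = scasimir E.
  rewrite /scasimir !raddfD raddfN /= !raddfMn /= (_ : 1^T = 1); last exact: trmx1.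
  have -> : (edeg E)^T = edeg E.
    by rewrite /edeg raddf_sum; apply: eq_bigr => i _; exact: E_tr.
  congr (_ + _ + _); rewrite /casimir raddf_sum /= exchange_big /=.
  rewrite exchange_big /=; apply: eq_bigr => i _; rewrite raddf_sum /=.
  by apply: eq_bigr => j _; rewrite [LHS]trmx_mul !E_tr.
have A_tr : A^T = A by rewrite /A raddfB /= tr_scalar_mx Ecas_tr.
have [c [R [c0 Api pi_tr commR]]] := sym_kernel_projection A_tr.
set pi := c%:M - A * R in Api pi_tr.
have cA : central E A.
  move=> i j; rewrite /A mulrBl mulrBr (central_scasimir E_comm).
  by congr (_ - _); rewrite [LHS]mul_scalar_mx [RHS]mul_mx_scalar.
have cR : central E R by move=> i j; apply: commR; apply: cA.
have cpi : central E pi.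
  move=> i j; rewrite /pi mulrBl mulrBr -[A * R * _]mulrA cR !mulrA cA.
  by congr (_ - _); rewrite [LHS]mul_scalar_mx [RHS]mul_mx_scalar.
have AR : A * R = R * A by apply/esym/commR.
have pipi : pi * pi = c *: pi.
  rewrite {1}/pi mulrBl AR -mulrA Api mulr0 subr0.
  exact: mul_scalar_mx.
(* Since [pi] is symmetric with pi^2 = c pi, its diagonal entries are, up to the factor c, the
   squared norms of its columns. *)
have pi_norm K : c * pi K K = \sum_L pi L K ^+ 2.
  have /matrixP/(_ K K) := pipi; rewrite [LHS]mxE [RHS]mxE => <-.
  by apply: eq_bigr => L _; rewrite -{1}pi_tr mxE expr2.
have pi_ge0 K : 0 <= pi K K.
  by rewrite -(pmulr_rge0 _ c0) pi_norm sumr_ge0 // => L _; rewrite sqr_ge0.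
have pi_wt K L : pi L K != 0 -> d L = d K.
  move=> nz; apply/mnmP => i; apply/eqP; rewrite -(eqr_nat int).
  have /matrixP/(_ L K) := cpi i i.
  rewrite (mul_diagr E_diag) (mul_diagl E_diag) mulrC => /(mulIf nz) ->.
  by [].
(* Let mu be the weight of K. The entry (pi C pi)_KK equals |lam + delta|^2 c pi_KK, and it is at
   least |mu + delta|^2 c pi_KK, since C exceeds this scalar on the weight space by a positive
   semidefinite operator. *)
have pi_lt K : nl < sqwt d K -> pi K K = 0.
  move=> lt; apply/eqP; rewrite eq_le pi_ge0 andbT -(pmulr_rle0 _ c0).
  have scpi : scasimir E * pi = nl *: pi.
    have /eqP := Api; rewrite {1}/A mulrBl subr_eq0 => /eqP ->.
    exact: mul_scalar_mx.
  have e1 : (pi * (scasimir E * pi)) K K = nl * (c * pi K K).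
    rewrite scpi [_ * _](_ : _ = nl *: (pi * pi)); last exact/esym/scalemxAr.
    by rewrite pipi !mxE.
  have e2 : sqwt d K * (c * pi K K) <= (pi * (scasimir E * pi)) K K.
    have scE L : (scasimir E * pi) L K = sqwt d K * pi L K +
       ((\sum_(p | ltpair p) E p.2 p.1 * E p.1 p.2) * pi) L K *+ 2.
      rewrite [LHS]mxE [X in _ = _ + X *+ 2]mxE -sumrMnl.
      under eq_bigr => M _ do rewrite (scasimir_entry E_comm E_diag) mulrDl.
      rewrite big_split /=; congr (_ + _); last first.
        by apply: eq_bigr => M _; rewrite mulrnAl.
      rewrite (bigD1 L) //= eqxx big1 ?addr0; last first.
        by move=> M /negPf ML; rewrite eq_sym ML mul0r.
      have [->|/pi_wt e] := eqVneq (pi L K) 0; first by rewrite !mulr0.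
      by rewrite mulr1n /sqwt e.
    rewrite [X in _ <= X]mxE.
    under [X in _ <= X]eq_bigr => L _ do rewrite scE mulrDr mulrCA.
    rewrite big_split /= -mulr_sumr pi_norm.
    rewrite (_ : \sum_L pi K L * pi L K = \sum_L pi L K ^+ 2); last first.
      by apply: eq_bigr => L _; rewrite -{1}pi_tr mxE expr2.
    rewrite lerDl.
    under eq_bigr do rewrite mulrnAr.
    rewrite sumrMnl mulrn_wge0 //.
    rewrite [X in 0 <= X](_ : _ = (pi * ((\sum_(p | ltpair p) E p.2 p.1 * E p.1 p.2) * pi)) K K); last first.
      by rewrite [RHS]mxE.
    rewrite mulr_suml mulr_sumr summxE sumr_ge0 // => p _.
    rewrite -{1}pi_tr -E_tr -[_ * _ * pi]mulrA mulrA.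
    rewrite [_^T * _](_ : _ = (E p.1 p.2 * pi)^T); last by rewrite [RHS]trmx_mul.
    by rewrite mxE sumr_ge0 // => L _; rewrite mxE -expr2 sqr_ge0.
  by rewrite e1 -subr_le0 -mulrBl pmulr_rle0 ?subr_gt0 // in e2.
(* The raising operators kill K, so K lies in the kernel of [A], on which c - R A acts as c. *)
have pi_hw K : K \in S -> pi K K = c.
  move=> KS; have [dK EK] := HS K KS.
  have AK L : A L K = 0.
    rewrite /A mxE (scasimir_entry E_comm E_diag) summxE big1 ?mul0rn ?addr0; last first.
      by move=> p hp; rewrite mxE big1 // => M _; rewrite EK ?mulr0.
    rewrite !mxE; have [->|] := eqVneq L K; last by rewrite !mulr0n subr0.
    rewrite (_ : sqwt d K = nl) ?subrr //.
    by apply: eq_bigr => i _; rewrite mnmE dK.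
  rewrite /pi AR !mxE eqxx mulr1n big1 ?subr0 // => L _.
  by rewrite AK mulr0.
(* By Freudenthal's formula this polynomial is the image of [vdm n * wtr d R] under the Laplacian
   minus |l|^2, which kills the coefficient of x^l. Hence [pi] may be replaced by c in that
   coefficient. *)
have lap0 : (vdm n * wtr d (A * R))@_l = 0.
  rewrite /A mulrBl raddfB /= mulrBr mcoeffB -(laplace_vdm_wtr E_comm E_diag cR).
  rewrite mcoeff_laplace -/nl.
  rewrite (_ : nl%:M * R = nl *: R); last by rewrite [LHS]mul_scalar_mx.
  rewrite (_ : wtr d (nl *: R) = nl *: wtr d R).
    by rewrite -scalerAr mcoeffZ subrr.
  by rewrite /wtr scaler_sumr; apply: eq_bigr => K _; rewrite mxE scalerA.
have alt0 : (alt_delta n * wtr d (A * R))@_l = 0.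
  have [e ve] := vdm_alt_delta n; move: lap0; rewrite ve -scalerAl mcoeffZ => /eqP.
  by rewrite mulf_eq0 signr_eq0 => /eqP.
rewrite -(ler_pM2l c0).
have -> : c * (alt_delta n * \sum_K 'X_[d K])@_l = (alt_delta n * wtr d pi)@_l.
  rewrite /pi raddfB /= mulrBr mcoeffB alt0 subr0 -mcoeffZ scalerAr.
  congr (_ * _)@__; rewrite /wtr scaler_sumr; apply: eq_bigr => K _.
  by rewrite mxE eqxx.
(* A term with s <> 1 comes from K of weight lam + delta - s delta, and by [shift_longer] and
   [pi_lt] its diagonal entry is 0. *)
rewrite mcoeff_alt_delta_sum (bigD1 1%g) //= [X in _ + X]big1 ?addr0; last first.
  move=> s s1; rewrite big1 // => K _.
  case: eqP => [/mnmP e|]; last by rewrite mulr0.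
  rewrite pi_lt ?mulr0 ?mul0r //.
  have ldec (i j : 'I_n) : (i < j)%N -> (l j <= l i)%N.
    by move=> ij; rewrite !mnmE leq_add ?lam_dec // leq_sub2l // ltnW.
  have := shift_longer ldec s1; rewrite -/nl /sqwt.
  rewrite [X in _ < X -> _](_ : _ = \sum_i (d K i + (n - i.+1))%:R ^+ 2) //.
  apply: eq_bigr => i _; congr (_ ^+ 2).
  rewrite -e mnmDE mnmE; have := ltn_ord i; have := ltn_ord (s i); lia.
rewrite [X in _ <= X](bigID (fun K => K \in S)) /=.
rewrite -[X in X <= _]addr0 lerD //; last first.
  apply: sumr_ge0 => K _; rewrite odd_perm1 expr0 mul1r.
  by case: eqP => _; rewrite ?mulr1 ?mulr0.
rewrite -sum1_card natr_sum mulr_sumr ler_sum // => K KS.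
rewrite pi_hw // odd_perm1 expr0 mul1r (_ : _ == _) //.
apply/eqP/mnmP => i; have [-> _] := HS K KS.
by rewrite mnmDE !mnmE perm1 addnC.
Qed.

End MultiplicityBound.

Section Families.
Variables n k : nat.

Definition fdegm (K : {set kset n k}) : 'X_{1..n} := [multinom fdeg K i | i < n].

Lemma plethysm_seriesE :
  plethysm_series k n = \sum_(K : {set kset n k}) 'X_[fdegm K].
Proof.
rewrite /plethysm_series.
rewrite (reindex_omap (val : kset n k -> _) insub) /=; last first.
  by move=> T Tk; rewrite insubT.
under eq_bigl => T do rewrite (valP T) valK eqxx.
under eq_bigr => T _ do rewrite addrC.
rewrite bigA_distr; apply: eq_bigr => K _.
rewrite -big_mkcond /=.
have e (S : kset n k) : \prod_(i in val S) 'X_i =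
    'X_[[multinom nat_of_bool (i \in val S) | i < n]] :> {mpoly int[n]}.
  rewrite mpolyXE_id big_mkcond /=; apply: eq_bigr => i _.
  by rewrite mnmE; case: (i \in _).
under eq_bigr do rewrite e.
rewrite -(big_morph _ (@mpolyXD n int) (@mpolyX0 n int)); congr 'X_[_]; apply/mnmP => i.
rewrite mnm_sumE mnmE /fdeg -sum1dep_card [RHS]big_mkcondr /=.
by apply: eq_bigr => S _; rewrite mnmE; case: (i \in _).
Qed.

(** Raising operators see single exchanges only. A shifted family admits them, because exchanging j
    for a smaller i lowers a set in the componentwise order. *)
Definition exchange_closed (K : {set kset n k}) :=
  [forall i : 'I_n, forall j : 'I_n, forall S : kset n k, forall T : kset n k,
    [&& (i < j)%N, T \in K, j \in val T, i \notin val T &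
        val S == i |: (val T :\ j)] ==> (S \in K)].

Lemma exchange_closed_bound (lam : 'X_{1..n}) :
  (forall i j : 'I_n, (i < j)%N -> (lam j <= lam i)%N) ->
  (#|[set K | exchange_closed K & fdegm K == lam]|)%:R <=
  (alt_delta n * plethysm_series k n)@_[multinom (lam i + (n - i.+1))%N | i < n].
Proof.
move=> lam_dec.
pose d (K : 'I_#|{set kset n k}|) := fdegm (enum_val K).
have := @highest_weight_bound n _ d (@gl n k) (@gl_comm n k) (@gl_tr n k) _ lam
  lam_dec (enum_val @^-1: [set K | exchange_closed K & fdegm K == lam]).
rewrite plethysm_seriesE (reindex (@enum_val {set kset n k} predT)) /=; last first.
  exact/onW_bij/enum_val_bij.
rewrite on_card_preimset; last exact/onW_bij/enum_val_bij.
apply.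
- move=> i K L; rewrite -(enum_valK K) -(enum_valK L) gl_diag !enum_valK /d mnmE.
  by rewrite (inj_eq enum_val_inj).
move=> K; rewrite !inE => /andP[Kc /eqP Kl]; split=> // i j ij L.
rewrite -(enum_valK K) -(enum_valK L); apply: gl_raise0.
  by rewrite -val_eqE /= ltn_eqF.
move=> S T TK jT iT e.
move/forallP/(_ i)/forallP/(_ j)/forallP/(_ S)/forallP/(_ T): Kc.
by rewrite ij TK jT iT e eqxx.
Qed.

End Families.

(** * Alternants and semistandard tableaux *)

Lemma sum_ord_interval (V : nmodType) M a b (F : nat -> V) : (b < M)%N ->
  \sum_(c < M | (a <= c <= b)%N) F c = \sum_(a <= c < b.+1) F c.
Proof.
move=> bM; rewrite (big_nat_widenl a 0) // (big_nat_widen 0 b.+1 M) //.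
by rewrite big_mkord; apply: eq_bigl => c; rewrite ltnS.
Qed.

Section Alternants.
Variables (R : comPzRingType) (x : nat -> R).

Definition alternant n (l : nat -> nat) : R :=
  \det (\matrix_(j < n, i < n) x i ^+ l j).

Lemma eq_alternant n l l' : (forall j, (j < n)%N -> l j = l' j) ->
  alternant n l = alternant n l'.
Proof.
by move=> e; congr (\det _); apply/matrixP => j i; rewrite !mxE e.
Qed.

Lemma telescope_powers (y z : R) a b : (a <= b)%N ->
  (y - z) * \sum_(a <= c < b.+1) y ^+ c * z ^+ (b - c) =
  y ^+ b.+1 - z ^+ (b.+1 - a) * y ^+ a.
Proof.
elim: b => [|b IH] ab.
  have -> : a = 0%N by case: a ab.
  by rewrite big_nat1 !expr0 subn0 !mulr1 !expr1.
rewrite big_nat_recr //= subnn expr0 mulr1 mulrDr.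
have [->|ab'] := eqVneq a b.+1.
  by rewrite big_geq // mulr0 add0r subSn // subnn expr1 mulrBl -exprS.
have {}ab : (a <= b)%N by rewrite -ltnS ltn_neqAle ab'.
rewrite (eq_big_nat _ _ (F2 := fun c => z * (y ^+ c * z ^+ (b - c)))); last first.
  by move=> c /andP[_ cb]; rewrite subSn // exprS mulrCA.
rewrite -mulr_sumr mulrCA IH //.
have -> : (b.+2 - a = (b.+1 - a).+1)%N by rewrite subSn // leqW.
by rewrite !exprS; ring.
Qed.

(** Subtracting x_n^(l_j - l_(j+1)) times row j + 1 from row j clears the last column above its last
    entry. The other entries become x_i - x_n times geometric sums over lam_(j+1) <= a <= lam_j, up
    to a power of x_i, and the choice of one term in each row is an interlacing [mu]. *)
Lemma alternant_branch n M (lam : nat -> nat) :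
  (forall j, (lam j.+1 <= lam j)%N) -> (lam 0 < M)%N ->
  alternant n.+1 (fun j => lam j + (n - j))%N =
  \prod_(i < n) (x i - x n) *
  \sum_(mu : {ffun 'I_n -> 'I_M} | [forall j : 'I_n, lam j.+1 <= mu j <= lam j]%N)
     x n ^+ (\sum_(j < n) (lam j - mu j) + lam n) *
     alternant n (fun j => if insub j is Some j' then mu j' + (n - j.+1) else 0)%N.
Proof.
move=> dec lamM.
have lamM' j : (lam j < M)%N.
  by elim: j => // j IH; apply: leq_ltn_trans (dec j) IH.
pose l j := (lam j + (n - j))%N.
pose U : 'M[R]_n.+1 := \matrix_(j, j')
  ((j == j')%:R - (j' == j.+1 :> nat)%:R * x n ^+ (l j - l j')).
pose A : 'M_n.+1 := \matrix_(j < n.+1, i < n.+1) x i ^+ l j.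
have detU : \det U = 1.
  rewrite -det_tr det_trig.
    rewrite big1 // => j _; rewrite !mxE eqxx (_ : _ == _ = false) ?mul0r ?subr0 //.
    by rewrite ltn_eqF.
  apply/is_trig_mxP => i j ij; rewrite !mxE -val_eqE /= gtn_eqF //.
  by rewrite ltn_eqF ?mul0r ?subr0 // ltnW.
have UA (j : 'I_n.+1) i : (U *m A) j i =
    x i ^+ l j - (if (j < n)%N then x n ^+ (l j - l j.+1) * x i ^+ l j.+1 else 0).
  rewrite mxE; under eq_bigr do rewrite !mxE mulrBl.
  rewrite sumrB; congr (_ - _).
    rewrite (bigD1 j) //= eqxx mul1r big1 ?addr0 // => k /negPf.
    by rewrite eq_sym => ->; rewrite mul0r.
  case: ifPn => jn.
    rewrite (bigD1 (Ordinal (jn : j.+1 < n.+1)%N)) //= eqxx mul1r big1 ?addr0 //.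
    by move=> k; rewrite -val_eqE /= => /negPf->; rewrite !mul0r.
  rewrite big1 // => k _; rewrite ltn_eqF ?mul0r //.
  by rewrite (leq_trans (ltn_ord k)) // ltnS leqNgt.
transitivity (\det (U *m A)); first by rewrite det_mulmx detU mul1r.
rewrite (expand_det_col _ ord_max) (bigD1 ord_max) //= big1 ?addr0; last first.
  move=> j jmax; have jn : (j < n)%N by rewrite ltn_neqAle jmax -ltnS ltn_ord.
  rewrite UA jn -exprD subnK ?subrr ?mul0r // /l leq_add // leq_sub2l //.
rewrite UA /= ltnn subr0 {1}/l subnn addn0.
rewrite /cofactor -signr_odd oddD addbb expr0 mul1r.
have minorE (j i : 'I_n) : row' ord_max (col' ord_max (U *m A)) j i =
    (x i - x n) * \sum_(a < M | (lam j.+1 <= a <= lam j)%N)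
       x i ^+ (a + (n - j.+1)) * x n ^+ (lam j - a).
  rewrite mxE mxE UA !lift_max ltn_ord.
  rewrite (sum_ord_interval _ (fun a => x i ^+ (a + (n - j.+1)) * x n ^+ (lam j - a))) //.
  under eq_bigr do rewrite exprD mulrAC.
  rewrite -mulr_suml mulrA telescope_powers // mulrBl -exprD -mulrA -exprD.
  rewrite /l.
  have := ltn_ord j => jn.
  congr (_ ^+ _ - _ ^+ _ * _); first lia.
  by move: (dec j); lia.
rewrite /(\det (row' _ _)).
have -> : \sum_(s : 'S_n) (-1) ^+ s * \prod_j row' ord_max (col' ord_max (U *m A)) j (s j) =
  \prod_(i < n) (x i - x n) * \sum_(s : 'S_n) (-1) ^+ s *
    \sum_(mu in family (fun (j : 'I_n) (a : 'I_M) => lam j.+1 <= a <= lam j)%N)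
     \prod_j (x (s j) ^+ (mu j + (n - j.+1)) * x n ^+ (lam j - mu j)).
  rewrite mulr_sumr; apply: eq_bigr => s _; rewrite mulrCA; congr (_ * _).
  under eq_bigr do rewrite minorE.
  rewrite big_split /=.
  rewrite (bigA_distr_big_dep (fun (j : 'I_n) (a : 'I_M) => lam j.+1 <= a <= lam j)%N
    (fun j a => x (s j) ^+ (a + (n - j.+1)) * x n ^+ (lam j - a))).
  congr (_ * _).
  by rewrite [RHS](reindex_inj (@perm_inj _ s)).
rewrite mulrCA; congr (_ * _).
rewrite mulr_sumr; under [LHS]eq_bigr do rewrite !mulr_sumr.
rewrite [LHS]exchange_big; apply: eq_big => mu; first by apply/familyP/forallP.
move=> _; rewrite mulr_sumr; apply: eq_bigr => s _.
rewrite big_split /= prodrXr exprD.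
set p := \prod_(i < n) x (s i) ^+ _.
rewrite [X in _ = _ * (_ * X)](_ : _ = p).
  by move: (x n ^+ lam n) (x n ^+ _) ((-1) ^+ s) p => u v w p; ring.
by apply: eq_bigr => j _; rewrite mxE valK.
Qed.

End Alternants.

(** * The branching rule for semistandard tableaux *)

Section Cells.
Variable lam : seq nat.
Hypothesis lam_sorted : sorted geq lam.

Lemma nth_sorted_geq i j : (i <= j)%N -> (nth 0 lam j <= nth 0 lam i)%N.
Proof.
move=> ij; have [js|js] := ltnP j (size lam); last by rewrite [nth _ _ j]nth_default.
have geq_trans : transitive geq by move=> a b c ab bc; apply: leq_trans bc ab.
apply: (sorted_leq_nth geq_trans leqnn 0%N lam_sorted) => //.
by rewrite inE; apply: leq_ltn_trans ij js.
Qed.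

Definition at_cell r a (c : cell lam) := (cell_row c == r) && (cell_col c == a).

Lemma cell_lt (c : cell lam) : (cell_col c < nth 0 lam (cell_row c))%N.
Proof. exact: (valP c). Qed.

Lemma cell_eq (c c' : cell lam) :
  cell_row c = cell_row c' -> cell_col c = cell_col c' -> c = c'.
Proof.
move=> er ec; apply: val_inj; case: c er ec => [[r a] /= h]; case: c' => [[r' a'] /= h'].
by rewrite /cell_row /cell_col /= => /val_inj -> /val_inj ->.
Qed.

Lemma exists_cell r a : (a < nth 0 lam r)%N -> exists c, at_cell r a c.
Proof.
move=> h; have rs : (r < size lam)%N.
  by rewrite ltnNge; apply: contraL h => h; rewrite nth_default.
have ah : (a < head 0 lam)%N by rewrite -nth0; apply: leq_trans h (nth_sorted_geq _).
by exists (exist _ (Ordinal rs, Ordinal ah) h); rewrite /at_cell !eqxx.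
Qed.

Lemma card_cells_right (m : nat -> nat) k : (size lam <= k)%N ->
  #|[pred c : cell lam | m (cell_row c) <= cell_col c]%N| =
  (\sum_(r < k) (nth 0 lam r - m r))%N.
Proof.
move=> sk; rewrite -sum1_card.
transitivity (\sum_(c : cell lam | m (val c).1 <= (val c).2) 1)%N; first by [].
rewrite -(big_sub_cond (fun c : 'I_(size lam) * 'I_(head 0 lam) => c.2 < nth 0 lam c.1)%N
   (fun c => m c.1 <= c.2)%N (fun=> 1%N)) /=.
rewrite -(pair_big_dep xpredT (fun (r : 'I_(size lam)) (a : 'I_(head 0 lam)) =>
   (a < nth 0 lam r) && (m r <= a))%N (fun _ _ => 1%N)) /=.
have e (r : nat) : (\sum_(a < head 0 lam | (a < nth 0 lam r) && (m r <= a)) 1 =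
    nth 0 lam r - m r)%N.
  have [h|h] := ltnP (m r) (nth 0 lam r); last first.
    rewrite (eqP (h : _ - _ == 0)%N) big1 // => a /andP[h1 h2].
    by have := leq_trans (leq_ltn_trans h2 h1) h; rewrite ltnn.
  case E : (nth 0 lam r) h => [//|b] h.
  rewrite (eq_bigl (fun a : 'I_(head 0 lam) => m r <= a <= b)%N); last first.
    by move=> a; rewrite /= ltnS andbC.
  rewrite (sum_ord_interval _ (fun=> 1%N)); last first.
    by rewrite -E -nth0 nth_sorted_geq.
  by rewrite sum_nat_const_nat muln1.
under eq_bigr do rewrite e.
rewrite (big_ord_widen k (fun r => nth 0 lam r - m r)%N sk) [RHS](bigID (fun r : 'I_k => r < size lam)%N) /=.
rewrite [X in (_ = _ + X)%N]big1 ?addn0 // => r.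
by rewrite -leqNgt => h; rewrite nth_default.
Qed.

Lemma semistandard_row N (T : {ffun cell lam -> 'I_N}) c :
  semistandard T -> (cell_row c <= T c)%N.
Proof.
move=> ss; move e : (cell_row c) => r; elim: r c e => // r IH c e.
have := cell_lt c; rewrite e => h.
have [c' /andP[/eqP r' /eqP a']] := exists_cell (leq_trans h (nth_sorted_geq (leqnSn r))).
apply: leq_ltn_trans (IH c' r') _.
move/forallP/(_ c')/forallP/(_ c)/andP: ss => [_ /implyP]; apply.
by rewrite a' eqxx r' e ltnSn.
Qed.

End Cells.

Lemma schur_eq0 lam n : is_partition lam -> (n < size lam)%N -> schur lam n = 0.
Proof.
case/andP => srt nz sz; rewrite /schur big1 // => T ss.
have : (0 < nth 0 lam n)%N.
  by rewrite lt0n; apply: contraNneq nz => <-; apply: mem_nth.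
case/(exists_cell srt) => c /andP[/eqP rc _].
by have := semistandard_row srt c ss; rewrite rc leqNgt ltn_ord.
Qed.

Section Tableaux.
Variables (R : comPzRingType) (x : nat -> R) (N : nat).

(** The bound n varies inside a fixed alphabet of size N, which the induction on n leaves
    unchanged. *)
Definition bounded_tableau lam n (T : {ffun cell lam -> 'I_N}) :=
  semistandard T && [forall c, T c < n]%N.

Definition tableau_sum lam n : R :=
  \sum_(T : {ffun cell lam -> 'I_N} | bounded_tableau n T) \prod_c x (T c).

Section Strip.
Variables (lam mu : seq nat) (n : nat).
Hypothesis lam_sorted : sorted geq lam.
Hypothesis size_lam : (size lam <= n.+1)%N.
Hypothesis size_mu : size mu = n.
Hypothesis nN : (n < N)%N.
Hypothesis inter : forall r, (r < n)%N -> (nth 0 lam r.+1 <= nth 0 mu r <= nth 0 lam r)%N.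

Local Notation m := (nth 0%N mu).

Lemma interlace_dec r : (m r.+1 <= m r)%N.
Proof.
have [h|h] := ltnP r.+1 n; last by rewrite [m r.+1]nth_default ?size_mu.
have /andP[_ h1] := inter h; have /andP[h2 _] := inter (ltnW h).
exact: leq_trans h1 h2.
Qed.

Lemma interlace_sorted : sorted geq mu.
Proof.
apply/(sortedP 0%N) => i _; exact: interlace_dec.
Qed.

Lemma interlace_le r : (m r <= nth 0 lam r)%N.
Proof.
have [h|h] := ltnP r n; last by rewrite nth_default ?size_mu.
by have /andP[] := inter h.
Qed.

Lemma emb_proof (c : cell mu) : exists c', at_cell (cell_row c) (cell_col c) (c' : cell lam).
Proof.
by apply: exists_cell => //; apply: leq_trans (cell_lt c) (interlace_le _).
Qed.

Definition emb (c : cell mu) : cell lam := xchoose (emb_proof c).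

Lemma emb_row c : cell_row (emb c) = cell_row c.
Proof. by have /andP[/eqP] := xchooseP (emb_proof c). Qed.

Lemma emb_col c : cell_col (emb c) = cell_col c.
Proof. by have /andP[_ /eqP] := xchooseP (emb_proof c). Qed.

Definition proj (c : cell lam) : option (cell mu) :=
  [pick c' | at_cell (cell_row c) (cell_col c) c'].

Lemma proj_emb c : proj (emb c) = Some c.
Proof.
rewrite /proj; case: pickP => [c' /andP[/eqP r /eqP a]|/(_ c)].
  by congr Some; apply: cell_eq; rewrite ?r ?a ?emb_row ?emb_col.
by rewrite /at_cell emb_row emb_col !eqxx.
Qed.

Lemma proj_in c : (cell_col c < m (cell_row c))%N -> exists2 c', proj c = Some c' & emb c' = c.
Proof.
move=> h; rewrite /proj; case: pickP => [c' /andP[/eqP r /eqP a]|no].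
  by exists c' => //; apply: cell_eq; rewrite ?emb_row ?emb_col.
have [c' hc] := exists_cell interlace_sorted h.
by have := no c'; rewrite hc.
Qed.

Lemma proj_out c : (m (cell_row c) <= cell_col c)%N -> proj c = None.
Proof.
move=> h; rewrite /proj; case: pickP => // c' /andP[/eqP r /eqP a].
by have := cell_lt c'; rewrite r a ltnNge h.
Qed.

Definition fits (T : {ffun cell lam -> 'I_N}) :=
  [forall c, (T c < n)%N == (cell_col c < m (cell_row c))%N].

Definition extend (T : {ffun cell mu -> 'I_N}) : {ffun cell lam -> 'I_N} :=
  [ffun c => if proj c is Some c' then T c' else Ordinal nN].

Definition restrict (T : {ffun cell lam -> 'I_N}) : {ffun cell mu -> 'I_N} :=
  [ffun c => T (emb c)].

Lemma extend_in T c : extend T (emb c) = T c.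
Proof. by rewrite ffunE proj_emb. Qed.

Lemma extend_out T c : (m (cell_row c) <= cell_col c)%N -> extend T c = n :> nat.
Proof. by move=> h; rewrite ffunE proj_out. Qed.

Lemma extendK T : restrict (extend T) = T.
Proof. by apply/ffunP => c; rewrite ffunE extend_in. Qed.

Lemma restrictK T : bounded_tableau n.+1 T -> fits T -> extend (restrict T) = T.
Proof.
move=> /andP[_ /forallP bT] /forallP fT; apply/ffunP => c.
have [h|h] := ltnP (cell_col c) (m (cell_row c)).
  by have [c' _ <-] := proj_in h; rewrite extend_in ffunE.
apply: val_inj; rewrite /= extend_out //.
apply/eqP; rewrite eq_sym eqn_leq -ltnS bT leqNgt.
by rewrite (eqP (fT c)) -leqNgt.
Qed.

(** As lam_(r+1) <= mu_r, a cell with another one below it in its column lies in [mu]. The cells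
    outside [mu] thus form a horizontal strip, and filling it with n keeps the columns strict. *)
Lemma extend_bounded T :
  bounded_tableau n.+1 (extend T) && fits (extend T) = bounded_tableau n T.
Proof.
apply/andP/andP => [[/andP[/forallP ss _] /forallP fT]|[/forallP ss /forallP bT]].
  split; apply/forallP => c; last first.
    by rewrite -extend_in (eqP (fT _)) emb_row emb_col cell_lt.
  apply/forallP => c'; have /forallP/(_ (emb c')) := ss (emb c).
  by rewrite !emb_row !emb_col !extend_in.
have bE c : (extend T c <= n)%N.
  have [h|h] := ltnP (cell_col c) (m (cell_row c)); last by rewrite extend_out.
  by have [c' _ <-] := proj_in h; rewrite extend_in ltnW // bT.
have lE c : (cell_col c < m (cell_row c))%N -> (extend T c < n)%N.
  by case/proj_in => c' _ <-; rewrite extend_in bT.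
split; last first.
  apply/forallP => c; apply/eqP.
  have [h|h] := ltnP (cell_col c) (m (cell_row c)); first exact: lE.
  by rewrite extend_out // ltnn.
apply/andP; split; last by apply/forallP => c; rewrite ltnS bE.
apply/forallP => c; apply/forallP => c'.
apply/andP; split; apply/implyP => /andP[/eqP e lt].
  have [h'|h'] := ltnP (cell_col c') (m (cell_row c')); last first.
    by rewrite [leqRHS]extend_out.
  have h : (cell_col c < m (cell_row c))%N by rewrite e (ltn_trans lt h').
  have [d' _ e'] := proj_in h'; have [d _ e0] := proj_in h.
  rewrite -e' -e0 !extend_in; have /forallP/(_ d')/andP[/implyP h0 _] := ss d.
  by apply: h0; rewrite -!emb_row -!emb_col e' e0 e eqxx.
have rn : (cell_row c < n)%N.
  apply: leq_trans lt _; rewrite -ltnS; apply: leq_trans size_lam.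
  exact: ltn_ord (val c').1.
have h : (cell_col c < m (cell_row c))%N.
  have /andP[h0 _] := inter rn; apply: leq_trans h0.
  by rewrite e; apply: leq_trans (cell_lt c') (nth_sorted_geq lam_sorted lt).
have [h'|h'] := ltnP (cell_col c') (m (cell_row c')); last first.
  by rewrite [ltnRHS]extend_out // lE.
have [d' _ e'] := proj_in h'; have [d _ e0] := proj_in h.
rewrite -e' -e0 !extend_in; have /forallP/(_ d')/andP[_ /implyP h0] := ss d.
by apply: h0; rewrite -!emb_row -!emb_col e' e0 e eqxx.
Qed.

Lemma extend_prod T : \prod_c x (extend T c) =
  x n ^+ (\sum_(r < n.+1) (nth 0 lam r - m r)) * \prod_c x (T c).
Proof.
rewrite (bigID (fun c : cell lam => cell_col c < m (cell_row c))%N) /= mulrC.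
congr (_ * _).
  rewrite -(card_cells_right lam_sorted m size_lam).
  rewrite -prodr_const; apply: eq_big => c; first by rewrite -leqNgt.
  by rewrite -leqNgt => h; rewrite extend_out.
rewrite (reindex_omap emb proj) /=.
  apply: eq_big => c; first by rewrite proj_emb eqxx emb_row emb_col cell_lt.
  by rewrite extend_in.
by move=> c h; have [c' -> <-] := proj_in h.
Qed.

Lemma tableau_sum_fits :
  \sum_(T : {ffun cell lam -> 'I_N} | bounded_tableau n.+1 T && fits T)
     \prod_c x (T c) =
  x n ^+ (\sum_(r < n.+1) (nth 0 lam r - m r)) * tableau_sum mu n.
Proof.
rewrite (reindex_onto extend restrict); last first.
  by move=> T /andP[]; apply: restrictK.
rewrite mulr_sumr; apply: eq_big => T; first by rewrite extend_bounded extendK eqxx andbT.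
by rewrite extend_prod.
Qed.

End Strip.
End Tableaux.

Definition ext_fun n M (mu : {ffun 'I_n -> 'I_M}) (j : nat) : nat :=
  if insub j is Some j' then mu j' else 0%N.

Definition ext_seq n M (mu : {ffun 'I_n -> 'I_M}) : seq nat :=
  mkseq (ext_fun mu) n.

Lemma nth_ext_seq n M (mu : {ffun 'I_n -> 'I_M}) j :
  nth 0%N (ext_seq mu) j = ext_fun mu j.
Proof.
have [h|h] := ltnP j n; first by rewrite nth_mkseq.
by rewrite nth_default ?size_mkseq // /ext_fun insubF // ltnNge h.
Qed.

Lemma ext_funE n M (mu : {ffun 'I_n -> 'I_M}) (j : 'I_n) : ext_fun mu j = mu j.
Proof. by rewrite /ext_fun valK. Qed.

Section Branching.
Variables (R : comPzRingType) (x : nat -> R) (N : nat).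
Variables (lam : seq nat) (n : nat).
Hypothesis lam_sorted : sorted geq lam.
Hypothesis size_lam : (size lam <= n.+1)%N.
Hypothesis nN : (n < N)%N.

Local Notation M := (head 0%N lam).+1.

(** The first column of row j with an entry at least n; if there is none, [find] returns the length
    of the row. *)
Let stop (T : {ffun cell lam -> 'I_N}) (j : 'I_n) : nat :=
  find (fun a => [exists c, at_cell j a c && (n <= T c)%N]) (iota 0 (nth 0 lam j)).

Definition subshape (T : {ffun cell lam -> 'I_N}) : {ffun 'I_n -> 'I_M} :=
  [ffun j => inord (stop T j)].

Lemma stop_le T j : (stop T j <= nth 0 lam j)%N.
Proof. by rewrite /stop -[leqRHS](size_iota 0) find_size. Qed.

Lemma subshapeE T j : subshape T j = stop T j :> nat.
Proof.
by rewrite ffunE inordK // ltnS (leq_trans (stop_le _ _)) // -nth0 nth_sorted_geq.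
Qed.

Lemma stopP T c (j : 'I_n) : semistandard T -> cell_row c = j ->
  (T c < n)%N = (cell_col c < stop T j)%N.
Proof.
move=> ss rc; have := cell_lt c; rewrite rc => clt; apply/idP/idP => [Tc|lt].
  rewrite ltnNge; apply/negP => le.
  have hs : (stop T j < nth 0 lam j)%N by apply: leq_ltn_trans le clt.
  have : has (fun a => [exists c, at_cell j a c && (n <= T c)%N]) (iota 0 (nth 0 lam j)).
    by rewrite has_find size_iota.
  move/(nth_find 0%N)/existsP => [c0]; rewrite -/(stop T j) nth_iota // add0n.
  case/andP=> /andP[/eqP r0 /eqP a0] T0.
  move: le; rewrite -a0 leq_eqVlt => /orP[/eqP e|lt].
    by move: T0; rewrite (cell_eq _ e) ?rc // leqNgt Tc.
  have /forallP/(_ c)/andP[/implyP h _] := forallP ss c0.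
  have := h _; rewrite r0 rc eqxx lt => /(_ isT) h'.
  by have := leq_ltn_trans (leq_trans T0 h') Tc; rewrite ltnn.
rewrite ltnNge; apply/negP => nT.
have := before_find 0%N lt; rewrite nth_iota // add0n => /existsP; apply.
by exists c; rewrite /at_cell rc !eqxx.
Qed.

(** A cell below an entry n would hold an entry above n; hence row j + 1 is no longer than the part
    of row j with entries below n. *)
Lemma subshape_inter T : bounded_tableau n.+1 T ->
  [forall j : 'I_n, nth 0 lam j.+1 <= subshape T j <= nth 0 lam j]%N.
Proof.
case/andP => ss /forallP bT; apply/forallP => j; rewrite subshapeE stop_le andbT.
rewrite leqNgt; apply/negP => lt.
have [c' /andP[/eqP r' /eqP a']] := exists_cell lam_sorted lt.
have lt0 := leq_trans lt (nth_sorted_geq lam_sorted (leqnSn j)).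
have [c /andP[/eqP r0 /eqP a0]] := exists_cell lam_sorted lt0.
have := stopP ss r0; rewrite a0 ltnn => /negbT; rewrite -leqNgt => nT.
have /forallP/(_ c')/andP[_ /implyP h] := forallP ss c.
have := h _; rewrite r0 r' a0 a' eqxx ltnSn => /(_ isT) h'.
by have := leq_ltn_trans nT (leq_trans h' (bT c')); rewrite ltnn.
Qed.

Lemma subshape_fits T (mu : {ffun 'I_n -> 'I_M}) : bounded_tableau n.+1 T ->
  [forall j : 'I_n, nth 0 lam j.+1 <= mu j <= nth 0 lam j]%N ->
  (subshape T == mu) = fits (ext_seq mu) n T.
Proof.
case/andP => ss /forallP bT /forallP imu; apply/eqP/forallP => [<- c|fT].
  have [h|h] := ltnP (cell_row c) n.
    rewrite nth_ext_seq (_ : cell_row c = Ordinal h) // ext_funE subshapeE.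
    by apply/eqP/stopP.
  rewrite nth_default ?size_mkseq // ltn0 ltnNge (leq_trans h) //.
  exact: semistandard_row.
apply/ffunP => j; apply: val_inj => /=; rewrite subshapeE.
have /andP[_ h] := imu j.
apply/eqP; rewrite eqn_leq; apply/andP; split; rewrite leqNgt; apply/negP => lt.
  have [c /andP[/eqP r0 /eqP a0]] := exists_cell lam_sorted (leq_trans lt (stop_le T j)).
  have := fT c; rewrite (stopP ss r0) r0 a0 nth_ext_seq ext_funE ltnn => /eqP e.
  by rewrite e in lt.
have [c /andP[/eqP r0 /eqP a0]] := exists_cell lam_sorted (leq_trans lt h).
have := fT c; rewrite (stopP ss r0) r0 a0 nth_ext_seq ext_funE ltnn => /eqP e.
by rewrite -e in lt.
Qed.

(** Tableaux are sorted by the shape that their entries below n occupy. The range of [mu] and the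
    powers of x_n are those of [alternant_branch]. *)
Lemma tableau_branch : tableau_sum x N lam n.+1 =
  \sum_(mu : {ffun 'I_n -> 'I_M} |
      [forall j : 'I_n, nth 0 lam j.+1 <= mu j <= nth 0 lam j]%N)
    x n ^+ (\sum_(j < n) (nth 0 lam j - mu j) + nth 0 lam n) *
    tableau_sum x N (ext_seq mu) n.
Proof.
rewrite /tableau_sum (partition_big subshape (fun mu : {ffun 'I_n -> 'I_M} =>
  [forall j : 'I_n, nth 0 lam j.+1 <= mu j <= nth 0 lam j]%N) subshape_inter) /=.
apply: eq_bigr => mu imu.
rewrite (eq_bigl (fun T => bounded_tableau n.+1 T && fits (ext_seq mu) n T)); last first.
  move=> T; case: (boolP (bounded_tableau _ _)) => //= bT.
  by rewrite (subshape_fits bT imu).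
rewrite tableau_sum_fits ?size_mkseq //; last first.
  by move=> r rn; rewrite nth_ext_seq -[r]/(nat_of_ord (Ordinal rn)) ext_funE; apply: (forallP imu).
congr (x n ^+ _ * _); rewrite big_ord_recr /=; congr (_ + _)%N.
  by apply: eq_bigr => j _; rewrite nth_ext_seq ext_funE.
by rewrite [X in (_ - X)%N]nth_default ?size_mkseq // subn0.
Qed.

End Branching.

Lemma alternant_delta_rec (R : comPzRingType) (x : nat -> R) n :
  alternant x n.+1 (fun j => n - j)%N =
  \prod_(i < n) (x i - x n) * alternant x n (fun j => n - j.+1)%N.
Proof.
(* Only the zero sequence interlaces the empty partition, so the bound M = 1 leaves a single
   term. *)
have := @alternant_branch _ x n 1 (fun=> 0%N) (fun=> isT) isT.
rewrite (@eq_alternant _ _ _ _ (fun j => n - j)%N) => [->|j _]; last by rewrite add0n.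
congr (_ * _).
rewrite (big_pred1 ([ffun=> ord0] : {ffun 'I_n -> 'I_1})) => [|mu]; last first.
  have -> : mu = [ffun=> ord0] by apply/ffunP => j; rewrite ffunE; apply: ord1.
  by rewrite /= eqxx; apply/forallP => j; rewrite ffunE.
rewrite big1 // addn0 expr0 mul1r; apply: eq_alternant => j jn.
by rewrite insubT ffunE.
Qed.

(** Both sides expand over the same interlacing [mu] with the same powers of x_n, and the product of
    the x_i - x_n is the ratio of the denominators for n + 1 and n variables. *)
Lemma alternant_tableau_sum (R : comPzRingType) (x : nat -> R) N lam n :
  sorted geq lam -> (size lam <= n)%N -> (n <= N)%N ->
  alternant x n (fun j => n - j.+1)%N * tableau_sum x N lam n =
  alternant x n (fun j => nth 0 lam j + (n - j.+1))%N.
Proof.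
elim: n lam => [|n IH] lam srt sz nN.
  case: lam sz srt => // _ _.
  rewrite /alternant !det_mx00 mul1r /tableau_sum.
  have e0 (c : cell [::]) : False by case: c => -[[]].
  have T0 : {ffun cell [::] -> 'I_N} by apply: finfun => c; case: (e0 c).
  rewrite (big_pred1 T0) => [|T]; first by rewrite big1 // => c; case: (e0 c).
  have -> : T = T0 by apply/ffunP => c; case: (e0 c).
  by rewrite /= eqxx; apply/andP; split; apply/forallP => c; case: (e0 c).
rewrite (@eq_alternant _ _ _ _ (fun j => n - j)%N) => [|j _]; last by rewrite subSS.
rewrite [RHS](@eq_alternant _ _ _ _ (fun j => nth 0 lam j + (n - j))%N) => [|j _]; last by rewrite subSS.
rewrite alternant_delta_rec tableau_branch //.
rewrite (@alternant_branch _ _ _ (head 0%N lam).+1) ?nth0 //; last first.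
  by move=> j; apply: nth_sorted_geq.
rewrite -mulrA mulr_sumr; congr (_ * _); apply: eq_bigr => mu imu.
rewrite mulrCA; congr (_ * _); rewrite IH ?size_mkseq // 1?ltnW //.
  apply: eq_alternant => j jn; rewrite nth_ext_seq /ext_fun.
  by rewrite insubT.
apply: (@interlace_sorted lam _ n); rewrite ?size_mkseq // => r rn.
by rewrite nth_ext_seq -[r]/(nat_of_ord (Ordinal rn)) ext_funE; apply: (forallP imu).
Qed.

(** * Schur coefficients *)

(** The value 0 beyond the n variables is what [trunc] substitutes for the last variable. *)
Definition xvar n (i : nat) : {mpoly int[n]} := if insub i is Some i' then 'X_i' else 0.

Lemma xvarE n (i : 'I_n) : xvar n i = 'X_i.
Proof. by rewrite /xvar valK. Qed.

Definition mnm_fun n (l : nat -> nat) : 'X_{1..n} := [multinom l i | i < n].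

Definition alt_poly n (l : nat -> nat) : {mpoly int[n]} :=
  \sum_(s : 'S_n) (-1) ^+ s *: 'X_[[multinom l (s i) | i < n]].

Definition shift_delta n (lam : seq nat) (j : nat) : nat := (nth 0 lam j + (n - j.+1))%N.

Lemma alternant_xvar n l : alternant (xvar n) n l = alt_poly n l.
Proof.
rewrite /alternant -det_tr; apply: eq_bigr => s _.
rewrite mpolyXE_id -mul_mpolyC rmorphXn rmorphN rmorph1; congr (_ * _).
by apply: eq_bigr => i _; rewrite !mxE mnmE xvarE.
Qed.

Lemma alt_poly_delta n : alt_poly n (fun j => n - j.+1)%N = alt_delta n.
Proof. by []. Qed.

Lemma schur_tableau_sum lam n : schur lam n = tableau_sum (xvar n) n lam n.
Proof.
apply: eq_big => [T|T _]; last by apply: eq_bigr => c _; rewrite xvarE.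
rewrite /bounded_tableau (_ : [forall c, _]) ?andbT //.
by apply/forallP => c; apply: ltn_ord.
Qed.

Lemma bialternant lam n : sorted geq lam -> (size lam <= n)%N ->
  alt_delta n * schur lam n = alt_poly n (shift_delta n lam).
Proof.
move=> srt sz; rewrite schur_tableau_sum -alt_poly_delta -!alternant_xvar.
exact: alternant_tableau_sum.
Qed.

Lemma msym_alt n (s : 'S_n) l : msym s (alt_poly n l) = (-1) ^+ s *: alt_poly n l.
Proof.
rewrite /alt_poly scaler_sumr raddf_sum /= (reindex_inj (mulgI s)) /=.
apply: eq_bigr => t _; rewrite msymZ msymX odd_permM signr_addb -scalerA.
congr (_ *: (_ *: 'X_[_])); apply/mnmP => i; rewrite !mnmE permM permKV //.
Qed.

Lemma perm_monotone n (s : 'S_n) :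
  (forall i j : 'I_n, (i < j)%N -> (s i < s j)%N) -> s = 1%g.
Proof.
move=> mono; apply/permP => i; rewrite perm1; apply: val_inj => /=.
transitivity #|[set j : 'I_n | (s j < s i)%N]|; first by rewrite card_lt_perm.
rewrite -[RHS](_ : (1%g : 'S_n) i = i :> nat); last by rewrite perm1.
rewrite -[RHS]card_lt_perm; apply: eq_card => j; rewrite !inE !perm1.
apply/idP/idP; last exact: mono.
apply: contraTT; rewrite -!leqNgt leq_eqVlt => /orP[/eqP e|/mono/ltnW //].
by rewrite (val_inj e).
Qed.

Definition strictly_decreasing n (e : 'I_n -> nat) :=
  forall i j : 'I_n, (i < j)%N -> (e j < e i)%N.

Lemma shift_delta_strict n lam : sorted geq lam ->
  strictly_decreasing (fun i : 'I_n => shift_delta n lam i).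
Proof.
move=> srt i j ij; rewrite /shift_delta.
by have := nth_sorted_geq srt (ltnW ij); have := ltn_ord j; lia.
Qed.

(** A permutation that carries one strictly decreasing sequence to another is monotone, so only the
    identity can contribute. *)
Lemma mcoeff_alt_poly n (l : nat -> nat) (e : 'X_{1..n}) :
  strictly_decreasing (fun i : 'I_n => l i) -> strictly_decreasing e ->
  (alt_poly n l)@_e = [forall i : 'I_n, e i == l i]%:R.
Proof.
move=> ldec edec; rewrite /alt_poly raddf_sum /= (bigD1 1%g) //= big1 ?addr0.
  rewrite odd_perm1 expr0 scale1r mcoeffX; congr (_%:R); congr nat_of_bool.
  apply/eqP/forallP => [<- i|h]; first by rewrite mnmE perm1.
  by apply/mnmP => i; rewrite mnmE perm1 (eqP (h i)).
move=> s s1; rewrite mcoeffZ mcoeffX; case: eqP => [e0|]; last by rewrite mulr0.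
case/eqP: s1; apply: perm_monotone => i j ij.
have := edec i j ij; rewrite -e0 !mnmE; case: (ltngtP (s i) (s j)) => // [h|h].
  by have := ldec _ _ h; case: ltngtP.
by have := val_inj h => ->; rewrite ltnn.
Qed.

Lemma mnm_sort n (m : 'X_{1..n}) : exists s : 'S_n,
  forall i j : 'I_n, (i <= j)%N -> (m (s j) <= m (s i))%N.
Proof.
have /tuple_permP [s es] : perm_eq (sort geq (multinom_val m)) (multinom_val m).
  by rewrite perm_sort.
exists s => i j ij.
have srt : sorted geq (sort geq (multinom_val m)).
  by apply: sort_sorted => a b; apply: leq_total.
have := nth_sorted_geq srt ij.
rewrite es.
have E (k : 'I_n) : nth 0%N [tuple tnth (multinom_val m) (s i) | i < n] k = m (s k).
  by rewrite -(tnth_nth 0%N) tnth_mktuple mnm_tnth.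
by rewrite !E.
Qed.

(** Permuting variables changes a coefficient by a sign, so its exponents may be taken weakly
    decreasing. If two of them are equal, the transposition makes the coefficient equal to its
    negative. *)
Lemma antisymmetric_eq0 n (g : {mpoly int[n]}) :
  (forall s : 'S_n, msym s g = (-1) ^+ s *: g) ->
  (forall e : 'X_{1..n}, strictly_decreasing e -> g@_e = 0) -> g = 0.
Proof.
move=> asym dec0; apply/mpolyP => m; rewrite mcoeff0.
have [s ms] := mnm_sort m.
pose m' : 'X_{1..n} := [multinom m (s i) | i < n].
suff : g@_m' = 0.
  rewrite -(mcoeff_sym g s) asym mcoeffZ => /eqP.
  by rewrite mulf_eq0 signr_eq0 => /eqP.
have m'dec (i j : 'I_n) : (i <= j)%N -> (m' j <= m' i)%N by rewrite !mnmE; apply: ms.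
have [/forallP h|] := boolP [forall i : 'I_n, forall j : 'I_n, (i < j)%N ==> (m' j < m' i)%N].
  by apply: dec0 => i j ij; have /forallP/(_ j)/implyP := h i; apply.
rewrite negb_forall => /existsP[i]; rewrite negb_forall => /existsP[j].
rewrite negb_imply -leqNgt => /andP[ij le].
have e : m' i = m' j by apply/eqP; rewrite eqn_leq le m'dec // ltnW.
have := mcoeff_sym g (tperm i j) m'.
rewrite (_ : [multinom _ | i < n] = m'); last first.
  by apply/mnmP => k; rewrite mnmE; case: tpermP => [->|->|].
rewrite asym odd_tperm -val_eqE /= ltn_eqF //= expr1 mcoeffZ mulN1r => h.
lia.
Qed.

Lemma alt_delta_neq0 n : alt_delta n != 0.
Proof.
apply/eqP => /(congr1 (mcoeff (mnm_fun n (fun j => n - j.+1)%N))).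
have dd : strictly_decreasing (fun i : 'I_n => n - i.+1)%N.
  by move=> i j ij; have := ltn_ord j; lia.
rewrite -alt_poly_delta mcoeff_alt_poly //.
  rewrite mcoeff0 (_ : [forall i, _]) //.
  by apply/forallP => i; rewrite mnmE.
by move=> i j ij; rewrite !mnmE dd.
Qed.

Definition deg_delta n := (\sum_(i < n) (n - i.+1))%N.

Lemma alt_delta_homog n : alt_delta n \is (deg_delta n).-homog.
Proof.
apply: rpred_sum => s _; apply: rpredZ; rewrite dhomogX /= mdegE.
rewrite /deg_delta [X in _ == X](reindex_inj (@perm_inj _ s)) /=.
by apply/eqP; apply: eq_bigr => i _; rewrite mnmE.
Qed.

Lemma mcoeff_homogM_pihomog n (p q : {mpoly int[n]}) D d e : p \is D.-homog ->
  (p * pihomog mdeg d q)@_e = if mdeg e == (D + d)%N then (p * q)@_e else 0.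
Proof.
move=> hp; elim/mpolyind: q => [|c m q _ _ IH].
  by rewrite pihomog0 mulr0 mcoeff0; case: ifP.
rewrite pihomogD linearZ /= pihomogX /= !mulrDr !mcoeffD IH -!scalerAr !mcoeffZ.
have hom : p * 'X_[m] \is (D + mdeg m).-homog by apply: dhomogM => //; rewrite dhomogX.
case: (altP (mdeg m =P d)) => [<-|md].
  case: ifPn => // he; rewrite (dhomog_nemf_coeff hom) //.
  by rewrite mulr0 add0r.
rewrite mulr0 mcoeff0 mulr0 add0r; case: ifP => // /eqP he.
rewrite (dhomog_nemf_coeff hom) ?mulr0 ?add0r //= he eqn_add2l eq_sym.
exact: md.
Qed.

Lemma nth_filter_pos s i : sorted geq s ->
  nth 0%N [seq x <- s | (0 < x)%N] i = nth 0%N s i.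
Proof.
elim: s i => //= x s IH i srt; case: (posnP x) => [x0|xp] /=; last first.
  by case: i => //= i; apply: IH; apply: path_sorted srt.
have s0 : all (fun y => y == 0%N) s.
  have geq_trans : transitive geq by move=> a b c ab bc; apply: leq_trans bc ab.
  have := order_path_min geq_trans srt; apply: sub_all => y /=.
  by rewrite x0 leqn0.
rewrite (_ : [seq x <- s | (0 < x)%N] = [::]); last first.
  by apply/eqP; rewrite -size_eq0 size_filter -leqn0 leqNgt -has_count -all_predC;
     apply: sub_all s0 => y /eqP->.
rewrite nth_nil x0; case: i => //= i.
have [h|h] := ltnP i (size s); last by rewrite nth_default.
by rewrite (eqP (all_nthP 0%N s0 i h)).
Qed.

Lemma partition_nth_inj lam mu : is_partition lam -> is_partition mu ->
  (forall i, nth 0%N lam i = nth 0%N mu i) -> lam = mu.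
Proof.
have pos l i : is_partition l -> (i < size l)%N = (0 < nth 0%N l i)%N.
  case/andP => _ l0; have [h|h] := ltnP i (size l); last by rewrite nth_default.
  by rewrite lt0n; apply/esym; apply: contraNneq l0 => <-; apply: mem_nth.
move=> pl pm e; apply: (@eq_from_nth _ 0%N) => // .
apply/eqP; rewrite eqn_leq; apply/andP; split; rewrite leqNgt; apply/negP.
  by rewrite pos // e -pos // ltnn.
by rewrite pos // -e -pos // ltnn.
Qed.

Lemma sumn_nth s n : (size s <= n)%N -> sumn s = (\sum_(i < n) nth 0 s i)%N.
Proof.
move=> sn; rewrite sumnE (big_nth 0%N) big_mkord (big_ord_widen n (nth 0%N s) sn).
rewrite [RHS](bigID (fun i : 'I_n => i < size s)%N) /= [X in (_ = _ + X)%N]big1 ?addn0 // => i.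
by rewrite -leqNgt => h; rewrite nth_default.
Qed.

Lemma size_partition lam : is_partition lam -> (size lam <= sumn lam)%N.
Proof.
case/andP => _; elim: lam => //= x s IH; rewrite inE negb_or => /andP[x0 s0].
by have := IH s0; move: x0; lia.
Qed.

Lemma exists_parts lam : is_partition lam ->
  exists2 t : (sumn lam).-bseq 'I_(sumn lam).+1, partition_of t & parts t = lam.
Proof.
move=> pl.
have sz : (size [seq inord i : 'I_(sumn lam).+1 | i <- lam] <= sumn lam)%N.
  by rewrite size_map size_partition.
have e : parts (Bseq sz) = lam.
  rewrite /parts /= -map_comp -[RHS]map_id; apply/eq_in_map => x xl /=.
  rewrite inordK // ltnS sumnE (big_rem x) //=; exact: leq_addr.
by exists (Bseq sz); rewrite /partition_of e ?pl ?eqxx.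
Qed.

Lemma parts_inj d (t u : d.-bseq 'I_d.+1) : parts t = parts u -> t = u.
Proof. by move=> e; apply/val_inj/(inj_map val_inj). Qed.

Section ExpansionCoefficients.
Variables (a : seq nat -> int) (n : nat).

Definition schur_sum d : {mpoly int[n]} :=
  \sum_(t : d.-bseq 'I_d.+1 | partition_of t) a (parts t) *: schur (parts t) n.

Lemma alt_schur_sum d : alt_delta n * schur_sum d =
  \sum_(t : d.-bseq 'I_d.+1 | partition_of t && (size (parts t) <= n)%N)
     a (parts t) *: alt_poly n (shift_delta n (parts t)).
Proof.
rewrite /schur_sum mulr_sumr (bigID (fun t => size (parts t) <= n)%N) /=.
rewrite [X in _ + X]big1 ?addr0 => [|t /andP[/andP[pt _]]]; last first.
  by rewrite -ltnNge => /(schur_eq0 pt)->; rewrite scaler0 mulr0.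
apply: eq_bigr => t /andP[/andP[/andP[srt _] _] sz].
by rewrite -scalerAr bialternant.
Qed.

Lemma mcoeff_alt_schur_sum_neq d (e : 'X_{1..n}) : strictly_decreasing e ->
  mdeg e != (deg_delta n + d)%N -> (alt_delta n * schur_sum d)@_e = 0.
Proof.
move=> edec me; rewrite alt_schur_sum raddf_sum /= big1 //.
move=> t /andP[/andP[/andP[srt nz] /eqP st] sz].
rewrite mcoeffZ mcoeff_alt_poly //; last exact: shift_delta_strict.
case: forallP => [h|]; last by rewrite mulr0.
case/eqP: me; rewrite mdegE /deg_delta -st (sumn_nth sz) addnC -big_split /=.
by apply: eq_bigr => i _; rewrite (eqP (h i)).
Qed.

Lemma mcoeff_alt_schur_sum lam : is_partition lam -> (size lam <= n)%N ->
  (alt_delta n * schur_sum (sumn lam))@_(mnm_fun n (shift_delta n lam)) = a lam.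
Proof.
move=> pl sz; have [t0 pt0 e0] := exists_parts pl.
have srt : sorted geq lam by case/andP: pl.
have dec : strictly_decreasing (mnm_fun n (shift_delta n lam)).
  by move=> i j ij; rewrite !mnmE; apply: shift_delta_strict.
rewrite alt_schur_sum raddf_sum (bigD1 t0) /=; last by rewrite pt0 e0.
rewrite big1 ?addr0 => [|t /andP[/andP[pt szt] tt0]].
  rewrite mcoeffZ mcoeff_alt_poly //; last by rewrite e0; apply: shift_delta_strict.
  rewrite e0 (_ : [forall i, _]) ?mulr1 //.
  by apply/forallP => i; rewrite mnmE.
have /andP[ppt _] := pt.
rewrite mcoeffZ mcoeff_alt_poly //; last by apply: shift_delta_strict; case/andP: ppt.
case: forallP => [h|]; last by rewrite mulr0.
case/eqP: tt0; apply: parts_inj; rewrite e0; apply: partition_nth_inj => // i.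
have [ni|ni] := leqP n i; first by rewrite !nth_default // (leq_trans _ ni).
by have := h (Ordinal ni); rewrite mnmE /shift_delta eqn_add2r => /eqP ->.
Qed.

End ExpansionCoefficients.

Definition alt_coef n (f : {mpoly int[n]}) (lam : seq nat) : int :=
  (alt_delta n * f)@_(mnm_fun n (shift_delta n lam)).

Lemma mdeg_shift_delta n lam : (size lam <= n)%N ->
  mdeg (mnm_fun n (shift_delta n lam)) = (deg_delta n + sumn lam)%N.
Proof.
move=> sz; rewrite mdegE (sumn_nth sz) addnC -big_split /=.
by apply: eq_bigr => i _; rewrite mnmE.
Qed.

Lemma schur_expansion_coef f a lam n : schur_expansion f a -> is_partition lam ->
  (size lam <= n)%N -> a lam = alt_coef (f n) lam.
Proof.
move=> fa pl sz; rewrite -(mcoeff_alt_schur_sum a pl sz) /schur_sum -fa.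
by rewrite (mcoeff_homogM_pihomog _ _ _ (alt_delta_homog n)) mdeg_shift_delta // eqxx.
Qed.

Lemma strictly_decreasing_gap n (e : 'I_n -> nat) (i j : 'I_n) :
  strictly_decreasing e -> (i <= j)%N -> (e j + (j - i) <= e i)%N.
Proof.
move=> edec ij; move ek : (j - i)%N => k.
elim: k j ij ek => [|k IH] j ij ek.
  have -> : j = i by apply: val_inj => /=; lia.
  by rewrite addn0.
have jn := ltn_ord j.
have j1 : (j.-1 < n)%N by lia.
have := IH (Ordinal j1) _ _; have := edec (Ordinal j1) j; rewrite /=; lia.
Qed.

Lemma strictly_decreasing_shift n (e : 'X_{1..n}) : strictly_decreasing e ->
  exists lam, [/\ is_partition lam, (size lam <= n)%N & e = mnm_fun n (shift_delta n lam)].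
Proof.
move=> edec.
pose s := mkseq (fun i => if insub i is Some i' then e i' - (n - (i' : 'I_n).+1) else 0)%N n.
have sE (i : 'I_n) : nth 0%N s i = (e i - (n - i.+1))%N by rewrite nth_mkseq // valK.
have srt : sorted geq s.
  apply/(sortedP 0%N) => i; rewrite size_mkseq => hi.
  have := sE (Ordinal hi); have := sE (Ordinal (ltnW hi)) => /= -> ->.
  rewrite /geq /=; have := edec (Ordinal (ltnW hi)) (Ordinal hi) (ltnSn _); lia.
exists [seq x <- s | (0 < x)%N]; split.
- apply/andP; split; last by rewrite mem_filter.
  by apply: sorted_filter srt => a b c ab bc; apply: leq_trans bc ab.
- by rewrite size_filter (leq_trans (count_size _ _)) // size_mkseq.
apply/mnmP => i; rewrite mnmE /shift_delta nth_filter_pos // sE subnK //.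
have n0 : (n.-1 < n)%N by have := ltn_ord i; lia.
have := @strictly_decreasing_gap _ _ i (Ordinal n0) edec.
by have := ltn_ord i; rewrite /=; lia.
Qed.

(** After multiplication by a_delta both sides are antisymmetric and can be compared at the
    exponents lam + delta. Stability in n lets the same coefficients serve all n. *)
Lemma schur_expansion_exists (f : forall n, {mpoly int[n]}) :
  (forall n (s : 'S_n), msym s (f n) = f n) ->
  (forall n lam, is_partition lam -> (size lam <= n)%N ->
     alt_coef (f n) lam = alt_coef (f (size lam)) lam) ->
  schur_expansion f (fun lam => alt_coef (f (size lam)) lam).
Proof.
move=> fsym fst n d.
pose a lam := alt_coef (f (size lam)) lam; apply: (mulfI (alt_delta_neq0 n)).
apply/eqP; rewrite -subr_eq0; apply/eqP.
rewrite -[X in _ - alt_delta n * X]/(schur_sum a n d).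
apply: antisymmetric_eq0 => [s|e edec].
  rewrite msymB msymM -alt_poly_delta msym_alt msym_pihomog fsym scalerBr.
  rewrite alt_poly_delta -scalerAl; congr (_ - _).
  rewrite alt_schur_sum scaler_sumr raddf_sum /=; apply: eq_bigr => t _.
  by rewrite msymZ msym_alt !scalerA mulrC.
rewrite mcoeffB (mcoeff_homogM_pihomog _ _ _ (alt_delta_homog n)).
case: ifPn => me; last by rewrite mcoeff_alt_schur_sum_neq ?subrr.
have [lam [pl sz ee]] := strictly_decreasing_shift edec.
have de : d = sumn lam.
  by apply/eqP; rewrite -(eqn_add2l (deg_delta n)) -(eqP me) ee mdeg_shift_delta.
by rewrite de {1}ee -/(alt_coef _ _) fst // ee mcoeff_alt_schur_sum // subrr.
Qed.

Lemma schur_coefE f a lam n : schur_expansion f a -> is_partition lam ->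
  (size lam <= n)%N -> schur_coef f lam = alt_coef (f n) lam.
Proof.
(* [xget] returns some expansion, and all expansions agree at partitions. *)
move=> fa pl sz; apply: schur_expansion_coef => //; rewrite /schur_coef.
match goal with |- context [@classical_sets.xget ?T ?x ?P] =>
  exact: (@classical_sets.xgetI T x P a fa) end.
Qed.

(** * The plethysm series *)

Lemma plethysm_series_sym k n (s : 'S_n) :
  msym s (plethysm_series k n) = plethysm_series k n.
Proof.
have imK : cancel (fun S : {set 'I_n} => s @: S) (fun S => (s^-1)%g @: S).
  by move=> S; rewrite -imset_comp -[RHS]imset_id; apply: eq_imset => i /=; rewrite permK.
rewrite /plethysm_series rmorph_prod /= [RHS](reindex_inj (can_inj imK)) /=.
apply: eq_big => [S|S _]; first by rewrite card_imset //; apply: perm_inj.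
rewrite rmorphD rmorph1 rmorph_prod /=; congr (_ + _).
rewrite big_imset /=; last by move=> i j _ _; apply: perm_inj.
apply: eq_bigr => i _; rewrite msymX; congr 'X_[_].
apply/mnmP => j; rewrite mnmE !mnm1E; congr nat_of_bool.
by apply/eqP/eqP => [->|<-]; rewrite ?permKV ?permK.
Qed.

(** * Setting the last variable to 0 *)

Section Truncation.
Variable n : nat.

Definition trunc : {mpoly int[n.+1]} -> {mpoly int[n]} :=
  comp_mpoly [tuple xvar n i | i < n.+1].
HB.instance Definition _ := GRing.RMorphism.copy trunc
  (comp_mpoly [tuple xvar n i | i < n.+1]).

Lemma truncU (i : 'I_n.+1) : trunc 'X_i = xvar n i.
Proof. by rewrite /trunc comp_mpolyXU -tnth_nth tnth_mktuple. Qed.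

Lemma truncZ c p : trunc (c *: p) = c *: trunc p.
Proof. exact: comp_mpolyZ. Qed.

Lemma mcoeff_trunc p (e : nat -> nat) : e n = 0%N ->
  (trunc p)@_(mnm_fun n e) = p@_(mnm_fun n.+1 e).
Proof.
move=> en; elim/mpolyind: p => [|c m p _ _ IH]; first by rewrite raddf0 !mcoeff0.
rewrite raddfD /= truncZ !mcoeffD !mcoeffZ IH; congr (_ * _ + _).
rewrite /trunc comp_mpolyX big_ord_recr /= tnth_mktuple /=.
rewrite mcoeffX; have [mn|mn] := posnP (m ord_max); last first.
  rewrite {2}/xvar insubF ?ltnn // expr0n eqn0Ngt mn mulr0 mcoeff0.
  case: eqP => // /mnmP/(_ ord_max); rewrite mnmE /= en => e0.
  by rewrite e0 in mn.
rewrite mn expr0 mulr1.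
rewrite [X in X@__](_ : _ = 'X_[[multinom m (widen_ord (leqnSn n) i) | i < n]]).
  rewrite mcoeffX; congr (nat_of_bool _)%:R; apply/eqP/eqP => /mnmP e0; apply/mnmP => i.
    have [h|h] := ltnP i n.
      have := e0 (Ordinal h); rewrite !mnmE /= => <-; congr (m _); exact: val_inj.
    have -> : i = ord_max by apply: val_inj => /=; have := ltn_ord i; lia.
    by rewrite mn mnmE.
  by have := e0 (widen_ord (leqnSn n) i); rewrite !mnmE.
rewrite mpolyXE_id; apply: eq_bigr => i _.
by rewrite tnth_mktuple mnmE /= xvarE.
Qed.

Lemma trunc_alt_delta : trunc (alt_delta n.+1) = (\prod_(i < n) 'X_i) * alt_delta n.
Proof.
rewrite -alt_poly_delta -alternant_xvar /alternant -det_map_mx.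
transitivity (alternant (xvar n) n.+1 (fun j => n - j)%N).
  congr (\det _); apply/matrixP => j i; rewrite !mxE rmorphXn /= xvarE truncU.
  by rewrite subSS.
rewrite alternant_delta_rec alternant_xvar alt_poly_delta; congr (_ * _).
by apply: eq_bigr => i _; rewrite xvarE {1}/xvar insubF ?ltnn // subr0.
Qed.

Lemma trunc_plethysm k : trunc (plethysm_series k n.+1) = plethysm_series k n.
Proof.
rewrite /plethysm_series rmorph_prod /=.
pose w := widen_ord (leqnSn n).
have w_inj : injective w by move=> i j /(congr1 val) /= /val_inj.
rewrite (bigID (fun S : {set 'I_n.+1} => ord_max \in S)) /= [X in X * _]big1 ?mul1r.
  have bij_in (S : {set 'I_n.+1}) : ord_max \notin S -> w @: (w @^-1: S) = S.
    move=> nS; apply/setP => i; apply/imsetP/idP => [[j]|iS]; first by rewrite inE => jS ->.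
    have h : (i < n)%N.
      rewrite ltn_neqAle -ltnS ltn_ord andbT; apply: contraNneq nS => e.
      by rewrite -(_ : i = ord_max) //; apply: val_inj.
    by exists (Ordinal h); rewrite ?inE; [rewrite (_ : w _ = i) //|]; apply: val_inj.
  rewrite (reindex_onto (fun S : {set 'I_n} => w @: S) (fun S => w @^-1: S)) /=; last first.
    by move=> S /andP[_]; apply: bij_in.
  apply: eq_big => [S|S _].
    rewrite card_imset // (_ : w @^-1: _ = S) ?eqxx ?andbT.
      rewrite andbC (_ : _ \notin _) //; apply/imsetP => -[i _ /(congr1 val) /= e].
      by have := ltn_ord i; rewrite -e ltnn.
    by apply/setP => i; rewrite inE mem_imset.
  rewrite rmorphD rmorph1 rmorph_prod big_imset /=; last by move=> i j _ _; apply: w_inj.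
  by congr (_ + _); apply: eq_bigr => i _; rewrite truncU xvarE.
move=> S /andP[_ nS]; rewrite rmorphD rmorph1 rmorph_prod (bigD1 ord_max) //= truncU.
by rewrite /xvar insubF ?ltnn // mul0r addr0.
Qed.

(** Setting x_n = 0 in a_delta leaves the denominator for n variables times the product of these
    variables, which accounts for the shift of delta by 1 between n and n + 1. *)
Lemma alt_coef_trunc (f : {mpoly int[n.+1]}) lam : (size lam <= n)%N ->
  alt_coef f lam = alt_coef (trunc f) lam.
Proof.
move=> sz; rewrite /alt_coef -mcoeff_trunc; last first.
  by rewrite /shift_delta nth_default // subnn.
rewrite rmorphM /= trunc_alt_delta -mulrA.
rewrite (_ : \prod_(i < n) 'X_i = 'X_[[multinom 1%N | i < n]]); last first.
  by rewrite mpolyXE_id; apply: eq_bigr => i _; rewrite mnmE expr1.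
rewrite mulrC (_ : mnm_fun n _ = ([multinom 1%N | i < n] + mnm_fun n (shift_delta n lam))%MM).
  exact: mcoeffMX.
apply/mnmP => i; rewrite mnmDE !mnmE /shift_delta; have := ltn_ord i; lia.
Qed.

End Truncation.

Lemma plethysm_coefE k lam n : is_partition lam -> (size lam <= n)%N ->
  plethysm_coef k lam = alt_coef (plethysm_series k n) lam.
Proof.
apply: schur_coefE; apply: schur_expansion_exists; first exact: plethysm_series_sym.
move=> {}n {}lam _; elim: n => [|n IH] sz; first by have /eqP -> : size lam == 0%N by rewrite -leqn0.
move: sz; rewrite leq_eqVlt => /orP[/eqP -> //|sz].
by rewrite alt_coef_trunc // trunc_plethysm IH.
Qed.

(** * Shifted families of natural numbers *)

(** Counting the entries below each bound expresses the componentwise order without sorting, in a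
    form suited to exchanges and complements. *)
Lemma all2_leq_count (s t : seq nat) : sorted leq s -> sorted leq t ->
  all2 leq s t <-> size s = size t /\
    forall m, (count (ltn^~ m) t <= count (ltn^~ m) s)%N.
Proof.
elim: s t => [|x s IH] [|y t] //= ss st; try by split=> // -[].
have {}IH := IH t (path_sorted ss) (path_sorted st).
split=> [/andP[xy /IH[-> h]]|[[sz] h]].
  split=> // m; apply: leq_add; last exact: h.
  by case: (ltnP y m) => // ym; rewrite (leq_ltn_trans xy ym).
have sx := order_path_min leq_trans ss; have ty := order_path_min leq_trans st.
(* Otherwise, at m = y + 1, the right side has an entry below m, whereas all entries on the left are
   at least x > y. *)
have xy : (x <= y)%N.
  rewrite leqNgt; apply/negP => yx.
  have xy1 : (x < y.+1)%N = false by apply/negbTE; rewrite -leqNgt.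
  have sy1 : count (ltn^~ y.+1) s = 0%N.
    apply/eqP; rewrite -leqn0 leqNgt -has_count; apply/hasPn => z zs /=.
    by rewrite -leqNgt (leq_trans yx) // (allP sx).
  by have := h y.+1; rewrite xy1 sy1 ltnSn.
rewrite xy; apply/IH; split=> // m.
have [ym|ym] := ltnP y m.
  by have := h m; rewrite ym (leq_ltn_trans xy ym) leq_add2l.
rewrite [X in (X <= _)%N](_ : _ = 0%N) //.
apply/eqP; rewrite -leqn0 leqNgt -has_count; apply/hasPn => z zt /=.
by rewrite -leqNgt (leq_trans ym) // (allP ty).
Qed.

Lemma componentwise_leP (S T : {fset nat}) : componentwise_le S T <->
  #|` S|%fset = #|` T|%fset /\
  forall m, (count (ltn^~ m) T <= count (ltn^~ m) S)%N.
Proof.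
rewrite /componentwise_le.
have srt (A : seq nat) : sorted leq (sort leq A) by apply: sort_sorted leq_total _.
have cnt p (A : seq nat) : count p (sort leq A) = count p A.
  by apply/seq.permP; rewrite perm_sort.
have := all2_leq_count (srt S) (srt T); rewrite !size_sort => ->.
by split=> -[h1 h2]; split=> // m; have := h2 m; rewrite !cnt.
Qed.

Section Embedding.
Variable n : nat.
Implicit Types s t : {set 'I_n}.

Definition fset_of s : {fset nat} := [fset i in [seq val i | i <- enum s]]%fset.
Definition set_of (S : {fset nat}) : {set 'I_n} := [set i : 'I_n | val i \in S].

Lemma in_fset_of s (i : 'I_n) : (val i \in fset_of s) = (i \in s).
Proof. by rewrite !inE /= (mem_map val_inj) mem_enum. Qed.

Lemma fset_of_lt s x : x \in fset_of s -> (x < n)%N.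
Proof. by rewrite !inE => /mapP[i _ ->]; apply: ltn_ord. Qed.

Lemma fset_ofK : cancel fset_of set_of.
Proof. by move=> s; apply/setP => i; rewrite inE in_fset_of. Qed.

Lemma set_ofK S : (forall x, x \in S -> (x < n)%N) -> fset_of (set_of S) = S.
Proof.
move=> Sn; apply/fsetP => x; apply/idP/idP => [xS|xS].
  by have := xS; rewrite -[x]/(val (Ordinal (fset_of_lt xS))) in_fset_of inE.
by rewrite -[x]/(val (Ordinal (Sn x xS))) in_fset_of inE.
Qed.

Lemma count_fset_of p s : count p (fset_of s) = #|[set i in s | p (val i)]|.
Proof.
transitivity (count p [seq val i | i <- enum s]).
  apply/seq.permP/uniq_perm; first exact: fset_uniq.
    by rewrite map_inj_uniq ?enum_uniq //; apply: val_inj.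
  by move=> x; rewrite !inE.
rewrite count_map -size_filter cardE; apply/perm_size/uniq_perm.
- by rewrite filter_uniq ?enum_uniq.
- exact: enum_uniq.
by move=> i; rewrite mem_filter !mem_enum [RHS]inE andbC.
Qed.

Lemma card_fset_of s : #|` fset_of s|%fset = #|s|.
Proof.
rewrite -(count_predT (fset_of s)) count_fset_of.
by apply: eq_card => i; rewrite inE andbT.
Qed.

Definition dominates s t :=
  forall m, (#|[set i in t | (i < m)%N]| <= #|[set i in s | (i < m)%N]|)%N.

Lemma dominates_fset_of s t : #|s| = #|t| -> dominates s t ->
  componentwise_le (fset_of s) (fset_of t).
Proof.
move=> st dom; apply/componentwise_leP; rewrite !card_fset_of; split=> // m.
by rewrite !count_fset_of; apply: dom.
Qed.

Lemma dominates_exchange s t (i j : 'I_n) : (i < j)%N -> j \in t -> i \notin t ->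
  s = i |: (t :\ j) -> dominates s t.
Proof.
move=> ij jt it -> m.
set A := [set x in t | _].
have iA : i \notin A :\ j by rewrite !inE (negPf it) !andbF.
have -> : [set x in i |: t :\ j | (x < m)%N] = if (i < m)%N then i |: (A :\ j) else A :\ j.
  case: ifPn => im; apply/setP => x; rewrite !inE; case: (altP (x =P i)) => [->|] //=.
  - by rewrite andbA.
  - by rewrite (negPf im) (negPf it) !andbF.
  - by rewrite andbA.
rewrite (cardsD1 j A) inE jt /=.
case: (ltnP j m) => [jm|_]; first by rewrite (ltn_trans ij jm) cardsU1 iA.
by case: ifP => _; rewrite ?cardsU1 ?iA ?leq_addl.
Qed.

End Embedding.

Section Translation.
Variables (n k : nat).
Implicit Types (K : {set kset n k}).

Definition dominance_closed (K : {set kset n k}) :=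
  forall S T : kset n k, T \in K -> dominates (val S) (val T) -> S \in K.

Definition kfset (S : kset n k) : {fset nat} := fset_of (val S).

Lemma kfset_inj : injective kfset.
Proof. by move=> S T /(can_inj (@fset_ofK n)) /val_inj. Qed.

Lemma card_kfset (S : kset n k) : #|` kfset S|%fset = k.
Proof. by rewrite card_fset_of; apply/eqP/(valP S). Qed.

Lemma kfset_surj (S : {fset nat}) : (forall x, x \in S -> (x < n)%N) ->
  #|` S|%fset = k -> exists T, kfset T = S.
Proof.
move=> Sn Sk; have c : #|set_of n S| == k by rewrite -card_fset_of set_ofK // Sk.
by exists (exist (fun s : {set 'I_n} => #|s| == k) _ c); rewrite /kfset /= set_ofK.
Qed.

Definition families_of (K : {fset {fset nat}}) : {set kset n k} := [set T | kfset T \in K].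

Definition ffamily (K : {set kset n k}) : {fset {fset nat}} :=
  [fset A in [seq kfset T | T <- enum K]]%fset.

Lemma in_ffamily K S : (kfset S \in ffamily K) = (S \in K).
Proof. by rewrite !inE /= (mem_map kfset_inj) mem_enum. Qed.

Lemma ffamilyP K A : reflect (exists2 S, S \in K & A = kfset S) (A \in ffamily K).
Proof.
rewrite !inE; apply: (iffP mapP) => -[S SK ->]; exists S => //.
  by rewrite mem_enum in SK.
by rewrite mem_enum.
Qed.

Lemma card_ffamily K : #|` ffamily K|%fset = #|K|.
Proof.
rewrite cardE -(size_map kfset); apply: perm_size; apply: uniq_perm.
- exact: fset_uniq.
- by rewrite map_inj_uniq ?enum_uniq //; apply: kfset_inj.
by move=> A; rewrite !inE.
Qed.

Lemma families_ofK (K : {fset {fset nat}}) :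
  (forall A, A \in K -> #|` A|%fset = k /\ forall x, x \in A -> (x < n)%N) ->
  ffamily (families_of K) = K.
Proof.
move=> hK; apply/fsetP => A; apply/ffamilyP/idP => [[S]|AK].
  by rewrite inE => SK ->.
have [Ak An] := hK A AK; have [S eS] := kfset_surj An Ak.
by exists S; rewrite ?inE eS.
Qed.

Lemma degree_ffamily K (i : 'I_n) : degree (ffamily K) i = fdeg K i.
Proof.
rewrite /degree /fdeg -card_ffamily; congr (size (enum_fset _)).
apply/fsetP => A; rewrite !inE /=; apply/andP/mapP => [[/mapP[S SK ->]]|[S]].
  rewrite -[i in i \in _]/(val i) in_fset_of => iS.
  by exists S; rewrite // mem_enum inE -mem_enum SK.
rewrite mem_enum inE => /andP[SK iS] ->; split; last by rewrite in_fset_of.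
by apply/mapP; exists S; rewrite ?mem_enum.
Qed.

Lemma degree_ffamily_ge K (i : nat) : (n <= i)%N -> degree (ffamily K) i = 0%N.
Proof.
move=> ni; apply/eqP; rewrite cardfs_eq0; apply/eqP/fsetP => A; rewrite !inE.
apply/negbTE/negP => /andP[/mapP[S _ ->] iS].
by have := fset_of_lt iS; rewrite ltnNge ni.
Qed.

Lemma num_shifted_le lam : (size lam <= n)%N ->
  (num_shifted k lam <=
   #|[set K : {set kset n k} | exchange_closed K & fdegm K == mnm_fun n (nth 0%N lam)]|)%N.
Proof.
move=> sz.
have bnd (K : {fset {fset nat}}) : K \in shifted_families k lam ->
    forall A, A \in K -> #|` A|%fset = k /\ forall x, x \in A -> (x < n)%N.
  move=> KS A AK; have [[Kk _] _] := iffLR (in_shifted_families k lam K) KS.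
  split; first exact: Kk.
  move: KS; rewrite !inE => /andP[]; rewrite fpowersetE => /fsubsetP/(_ A AK).
  rewrite fpowersetE => /fsubsetP sub _ x /sub; rewrite !inE mem_iota add0n => h.
  exact: leq_trans h sz.
rewrite /num_shifted -(size_map families_of) -[leqRHS]/(#|_|) cardE.
apply: uniq_leq_size.
  rewrite map_inj_in_uniq ?fset_uniq // => K L KS LS e.
  by rewrite -(families_ofK (bnd K KS)) e families_ofK //; apply: bnd.
move=> _ /mapP[K KS ->]; rewrite mem_enum inE.
have eK := families_ofK (bnd K KS).
have [[Kk Kc] Kd] := iffLR (in_shifted_families k lam K) KS.
apply/andP; split.
  apply/forallP => i; apply/forallP => j; apply/forallP => S; apply/forallP => T.
  apply/implyP => /and5P[ij]; rewrite !inE => TK jT iT /eqP e.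
  apply: (Kc _ _ TK); first exact: card_kfset.
  apply: dominates_fset_of; last exact: dominates_exchange e.
  by rewrite (eqP (valP S)) (eqP (valP T)).
apply/eqP/mnmP => i; rewrite !mnmE -degree_ffamily eK.
exact: Kd.
Qed.

(** Where equality is claimed with k > 0 the coefficient is at most 1, so that one family is
    enough. *)
Lemma num_shifted_gt0 lam (K : {set kset n k}) : (size lam <= n)%N ->
  dominance_closed K -> (forall i : 'I_n, fdeg K i = nth 0%N lam i) ->
  (0 < num_shifted k lam)%N.
Proof.
move=> sz Kc Kd; rewrite cardfs_gt0; apply/fset0Pn; exists (ffamily K).
apply/in_shifted_families; split; first split.
- by move=> A /ffamilyP[S _ ->]; apply: card_kfset.
- move=> A B /ffamilyP[T TK ->] Ak /componentwise_leP[_ le].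
  (* All k elements of T are below n, and the comparison at m = n carries this over to A. *)
  have An x : x \in A -> (x < n)%N.
    move=> xA; have := le n.
    have -> : count (ltn^~ n) (kfset T) = k.
      rewrite -[RHS](card_kfset T) -(count_predT (kfset T)).
      by apply: eq_in_count => y yT; rewrite /= (fset_of_lt yT).
    rewrite -Ak -(count_predT A) => le'.
    have /allP : all (ltn^~ n) A.
      by rewrite all_count -(count_predT A) eqn_leq le' andbT count_predT count_size.
    by apply.
  have [S eS] := kfset_surj An Ak.
  rewrite -eS in_ffamily; apply: Kc TK _ => m.
  by have := le m; rewrite -eS !count_fset_of.
move=> i; have [h|h] := ltnP i n.
  by rewrite -[i]/(val (Ordinal h)) degree_ffamily Kd.
by rewrite degree_ffamily_ge // nth_default // (leq_trans sz).
Qed.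

End Translation.

Theorem num_shifted_le_plethysm k lam : is_partition lam ->
  (num_shifted k lam)%:Z <= plethysm_coef k lam.
Proof.
move=> pl; rewrite (plethysm_coefE k pl (leqnn _)).
pose n := size lam; pose l := mnm_fun n (nth 0%N lam).
have ldec (i j : 'I_n) : (i < j)%N -> (l j <= l i)%N.
  by move=> ij; rewrite !mnmE; apply: nth_sorted_geq (ltnW ij); case/andP: pl.
have := exchange_closed_bound k ldec.
rewrite (_ : [multinom _ | i < n] = mnm_fun n (shift_delta n lam)); last first.
  by apply/mnmP => i; rewrite !mnmE.
apply: le_trans; rewrite natz lez_nat.
exact: num_shifted_le.
Qed.

(** * Equality for pairs *)

Section LucasPolynomials.
Variable K : fieldType.

(* The monic polynomials [lucas m], [m > 0], with
   [lucas m (x - 1/x) = x^m + (-1/x)^m]. *)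
Fixpoint lucas_pair m : {poly K} * {poly K} :=
  if m is m'.+1 then
    let: (p, q) := lucas_pair m' in (q, 'X * q + p)
  else ((2%:R)%:P, 'X).

Definition lucas m : {poly K} := (lucas_pair m).1.

Lemma lucasS m : lucas m.+1 = (lucas_pair m).2.
Proof. by rewrite /lucas /=; case: (lucas_pair m). Qed.

Lemma lucasSS m : lucas m.+2 = 'X * lucas m.+1 + lucas m.
Proof. by rewrite !lucasS /lucas /=; case: (lucas_pair m). Qed.

Lemma lucas_sub_inv m (x : K) : x != 0 ->
  (lucas m).[x - x^-1] = x ^+ m + (- x^-1) ^+ m.
Proof.
move=> x0.
suff : (lucas m).[x - x^-1] = x ^+ m + (- x^-1) ^+ m /\
       (lucas m.+1).[x - x^-1] = x ^+ m.+1 + (- x^-1) ^+ m.+1 by case.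
elim: m => [|m [IH1 IH2]].
  by rewrite /lucas /= !expr0 !expr1 hornerX hornerC.
split=> //; rewrite lucasSS hornerD hornerM hornerX IH1 IH2 !exprS.
have -> : - x^-1 * (- x^-1 * (- x^-1) ^+ m) = x^-1 * x^-1 * (- x^-1) ^+ m by ring.
move: (x ^+ m) ((- x^-1) ^+ m) => u v; field.
exact: x0.
Qed.

Lemma lucas_monic m : size (lucas m.+1) = m.+2 /\ lucas m.+1 \is monic.
Proof.
suff : [/\ (size (lucas m) <= m.+1)%N, size (lucas m.+1) = m.+2 &
           lucas m.+1 \is monic] by case.
elim: m => [|m [IH0 IH1 IH2]].
  by rewrite /lucas /= size_polyX monicX size_polyC; case: (_ != 0).
have sX : size ('X * lucas m.+1) = m.+3 by rewrite mulrC size_mulX ?monic_neq0 ?IH1.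
have lt : (size (lucas m) < size ('X * lucas m.+1)%R)%N by rewrite sX ltnS leqW.
rewrite lucasSS size_polyDl // IH1 sX monicE lead_coefDl // -monicE.
by rewrite mulrC monicMl ?monicX.
Qed.

(** The matrix of the coefficients of the polynomials is unitriangular. *)
Lemma det_monic n (r : nat -> {poly K}) (z : 'I_n -> K) :
  (forall m, size (r m) = m.+1 /\ r m \is monic) ->
  \det (\matrix_(j < n, i < n) (r j).[z i]) = \det (Vandermonde n (\row_i z i)).
Proof.
move=> hr.
have -> : \matrix_(j < n, i < n) (r j).[z i] =
    (\matrix_(j < n, s < n) (r j)`_s) *m Vandermonde n (\row_i z i).
  apply/matrixP => j i; rewrite !mxE.
  rewrite (horner_coef_wide (n := n)); last by rewrite (hr j).1.
  by apply: eq_bigr => s _; rewrite !mxE.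
rewrite det_mulmx det_trig.
  rewrite big1 ?mul1r // => j _; rewrite mxE.
  by have [sz /monicP] := hr j; rewrite lead_coefE sz.
by apply/is_trig_mxP => j s js; rewrite mxE nth_default // (hr j).1.
Qed.

(** [lucas 0] is 2; the constant 1 takes its place to be monic of degree 0. *)
Definition lucas1 m : {poly K} := if m is 0 then 1 else lucas m.

Lemma lucas1_monic m : size (lucas1 m) = m.+1 /\ lucas1 m \is monic.
Proof. by case: m => [|m]; rewrite /lucas1 ?size_poly1 ?monic1 //; apply: lucas_monic. Qed.

(** This is x^(n-1) times [lucas1 m] at x - 1/x, free of denominators; its two exponents are mirror
    images in n - 1. *)
Definition reflection_poly (R : pzRingType) n m (x : R) : R :=
  if m is 0 then x ^+ n.-1 else x ^+ (n.-1 + m) + (-1) ^+ m * x ^+ (n.-1 - m).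

Lemma reflection_polyE n m (x : K) : x != 0 -> (m < n)%N ->
  x ^+ n.-1 * (lucas1 m).[x - x^-1] = reflection_poly n m x.
Proof.
case: m => [|m] x0 mn; first by rewrite /= hornerC mulr1.
rewrite /lucas1 lucas_sub_inv // /reflection_poly mulrDr -exprD; congr (_ + _).
rewrite [(- x^-1) ^+ _]exprNn mulrCA; congr (_ * _).
by rewrite exprVn -expfB_cond // (negPf x0) /=; lia.
Qed.

Lemma prod_ltpair_mul n (x : 'I_n -> K) : (forall i, x i != 0) ->
  \prod_(p | @ltpair n p) (x p.1 * x p.2) = \prod_i x i ^+ n.-1.
Proof.
move=> x0; have px0 : \prod_i x i != 0 by apply/prodf_neq0.
apply: (mulfI px0).
rewrite -[LHS](big_ltpair _ (fun i _ => x i)) -big_split /=; apply: eq_bigr => i _.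
by rewrite prodr_const card_ord -exprS prednK // (leq_ltn_trans _ (ltn_ord i)).
Qed.

(** With z = x - 1/x, (x_j - x_i) (1 + x_i x_j) = x_i x_j (z_j - z_i). The product of the x_i x_j
    over all pairs puts a factor x_i^(n-1) into each column. *)
Lemma reflection_det n (x : 'I_n -> K) : (forall i, x i != 0) ->
  \prod_(p | @ltpair n p) ((x p.2 - x p.1) * (1 + x p.1 * x p.2)) =
  \det (\matrix_(j < n, i < n) reflection_poly n j (x i)).
Proof.
move=> x0; pose z i := x i - (x i)^-1.
have -> : \matrix_(j < n, i < n) reflection_poly n j (x i) =
    (\matrix_(j < n, i < n) (lucas1 j).[z i]) *m diag_mx (\row_i x i ^+ n.-1).
  apply/matrixP => j i; rewrite mul_mx_diag !mxE -reflection_polyE //.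
  by rewrite mulrC.
rewrite det_mulmx det_diag (det_monic z lucas1_monic) det_Vandermonde.
have -> : \prod_i (\row_i0 x i0 ^+ n.-1) 0 i = \prod_i x i ^+ n.-1.
  by apply: eq_bigr => i _; rewrite mxE.
rewrite -prod_ltpair_mul //.
rewrite (pair_big_dep xpredT (fun i j : 'I_n => i < j)%N
  (fun i j => (\row_i z i) 0 j - (\row_i z i) 0 i)) /=.
rewrite -big_split /=; apply: eq_bigr => p _; rewrite !mxE /z.
by field; rewrite !x0.
Qed.

End LucasPolynomials.

Lemma plethysm2_prod n :
  plethysm_series 2 n = \prod_(p | @ltpair n p) (1 + 'X_p.1 * 'X_p.2).
Proof.
pose h (p : 'I_n * 'I_n) : {set 'I_n} := [set p.1; p.2].
have h_inj : {in [pred p | @ltpair n p] &, injective h}.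
  move=> [i j] [i' j']; rewrite !inE /ltpair /= => ij ij' /setP e.
  have := e i; have := e j; have := e i'; have := e j'.
  rewrite !inE !eqxx ?orbT /= => /orP e1 /orP e2 /esym/orP e3 /esym/orP e4.
  have ne (a b : 'I_n) : a = b -> (a < b)%N -> False by move=> ->; rewrite ltnn.
  case: e4 => /eqP e4; case: e3 => /eqP e3; subst => //.
  - by case: (ne _ _ erefl ij).
  - by have := ltn_trans ij ij'; rewrite ltnn.
  - by case: (ne _ _ erefl ij).
rewrite /plethysm_series.
transitivity (\prod_(S in h @: [set p | @ltpair n p]) (1 + \prod_(i in S) 'X_i) : {mpoly int[n]}).
  apply: eq_bigl => S; apply/idP/imsetP => [/cards2P[i [j [ij ->]]]|[[i j]]].
    have [lt|lt] : (i < j)%N \/ (j < i)%N.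
      by move: ij; rewrite -val_eqE /=; case: ltngtP => //; [left|right].
      by exists (i, j); rewrite ?inE.
    by exists (j, i); rewrite ?inE // /h /= setUC.
  rewrite inE /ltpair /= => ij ->; rewrite cards2 eqSS -val_eqE /=.
  by rewrite (ltn_eqF ij).
rewrite big_imset /=; last by move=> p q; rewrite !inE => hp hq; apply: h_inj; rewrite !inE.
apply: eq_big => p; first by rewrite inE.
rewrite inE => hp; rewrite big_setU1 ?big_set1 // inE -val_eqE /=.
by rewrite ltn_eqF.
Qed.

Lemma vdm_plethysm2 n : vdm n * plethysm_series 2 n =
  \det (\matrix_(j < n, i < n) reflection_poly n j ('X_i : {mpoly int[n]})).
Proof.
rewrite plethysm2_prod /vdm -big_split /=.
(* The substitution x - 1/x takes place in the fraction field. *)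
apply/eqP; rewrite -tofrac_eq rmorph_prod -det_map_mx; apply/eqP.
under eq_bigr do rewrite rmorphM rmorphB rmorphD rmorph1 rmorphM /=.
rewrite (reflection_det (x := fun i : 'I_n => tofrac ('X_i : {mpoly int[n]}))); last first.
  move=> i; rewrite tofrac_eq0; apply/eqP => /(congr1 (mcoeff U_(i))).
  by rewrite mcoeff0 mcoeffX eqxx.
congr (\det _); apply/matrixP => j i; rewrite !mxE /reflection_poly.
case: (nat_of_ord j) => [|m]; first by rewrite rmorphXn.
by rewrite rmorphD rmorphM !rmorphXn rmorphN rmorph1.
Qed.

Section ReflectionCoefficients.
Variable n : nat.

Definition reflection_coef (m k : nat) : int :=
  if m is 0 then (k == n.-1)%:R
  else (k == n.-1 + m)%N%:R + (-1) ^+ m * (k == n.-1 - m)%N%:R.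

Lemma reflection_coef_neq0 m k : reflection_coef m k != 0 -> (m < n)%N ->
  (k = n.-1 + m \/ k + m = n.-1)%N /\ `|reflection_coef m k| = 1.
Proof.
rewrite /reflection_coef; case: m => [|m].
  by case: (altP (k =P n.-1)) => [-> _ _|]; rewrite ?eqxx // addn0 normr1; split; [left|].
case: (altP (k =P (n.-1 + m.+1)%N)) => [-> _ mn|kn].
  rewrite (_ : (_ == _ - _)%N = false); last by apply/eqP; lia.
  by rewrite mulr0 addr0 normr1; split; [left|].
case: (altP (k =P (n.-1 - m.+1)%N)) => [-> _ mn|]; last by rewrite mulr0 addr0 eqxx.
by rewrite mulr1 add0r normrX normrN1 expr1n; split=> //; right; lia.
Qed.

Lemma reflection_poly_sum m N (i : 'I_n) : (n.-1 + m < N)%N ->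
  reflection_poly n m ('X_i : {mpoly int[n]}) =
  \sum_(k < N) reflection_coef m k *: 'X_i ^+ k.
Proof.
move=> mN.
have delta (a : nat) : (a < N)%N ->
    \sum_(k < N) ((nat_of_ord k == a)%:R : int) *: ('X_i : {mpoly int[n]}) ^+ k = 'X_i ^+ a.
  move=> aN; rewrite (bigD1 (Ordinal aN)) //= eqxx scale1r big1 ?addr0 // => k.
  by rewrite -val_eqE /= => /negPf->; rewrite scale0r.
case: m mN => [|m] mN; rewrite /reflection_poly /reflection_coef.
  by rewrite delta // -[n.-1]addn0.
under eq_bigr do rewrite scalerDl -scalerA.
rewrite big_split /= -scaler_sumr !delta //; last by lia.
by congr (_ + _); rewrite -mul_mpolyC rmorphXn rmorphN rmorph1.
Qed.

Lemma mcoeff_prod_univariate N (c : 'I_n -> nat -> int) (e : 'X_{1..n}) :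
  (forall i, (e i < N)%N) ->
  (\prod_i \sum_(k < N) c i k *: 'X_i ^+ k)@_e = \prod_i c i (e i).
Proof.
move=> eN; rewrite bigA_distr_bigA raddf_sum /=.
have mono (f : {ffun 'I_n -> 'I_N}) : \prod_i (c i (f i) *: 'X_i ^+ f i) =
    (\prod_i c i (f i)) *: 'X_[[multinom nat_of_ord (f i) | i < n]] :> {mpoly int[n]}.
  rewrite mpolyXE_id -mul_mpolyC rmorph_prod -big_split /=.
  by apply: eq_bigr => i _; rewrite mul_mpolyC mnmE.
under eq_bigr do rewrite mono mcoeffZ mcoeffX.
rewrite (bigD1 [ffun i => Ordinal (eN i)]) //= [X in _ + X]big1 ?addr0.
  rewrite (_ : _ == e) ?mulr1; last by apply/eqP/mnmP => i; rewrite mnmE ffunE.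
  by apply: eq_bigr => i _; rewrite ffunE.
move=> f fe; case: eqP => [/mnmP e0|]; last by rewrite mulr0.
by case/eqP: fe; apply/ffunP => i; apply: val_inj; rewrite ffunE /= -e0 mnmE.
Qed.

(** An exponent e_i in column i can only come from row |e_i - (n - 1)|, so the exponents determine
    the permutation and at most one term of the determinant survives. *)
Lemma mcoeff_vdm_plethysm2 (e : 'X_{1..n}) :
  (vdm n * plethysm_series 2 n)@_e != 0 ->
  `|(vdm n * plethysm_series 2 n)@_e| = 1 /\
  exists s : 'S_n, forall i, (e i = n.-1 + s i \/ e i + s i = n.-1)%N.
Proof.
pose N := (n + n + mdeg e).+1.
have eN i : (e i < N)%N.
  by rewrite ltnS mdegE (bigD1 i) //=; lia.
have cE : (vdm n * plethysm_series 2 n)@_e =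
    \sum_(s : 'S_n) (-1) ^+ s * \prod_i reflection_coef (s i) (e i).
  rewrite vdm_plethysm2 -det_tr /(\det _) raddf_sum /=; apply: eq_bigr => s _.
  rewrite -signr_odd -[X in (X * _)@__](rmorph_sign (@mpolyC n int)) mcoeffCM signr_odd.
  congr (_ * _).
  rewrite -(mcoeff_prod_univariate (fun i k => reflection_coef (s i) k) eN).
  congr (_@__); apply: eq_bigr => i _; rewrite !mxE.
  by rewrite -(@reflection_poly_sum _ N) //; have := ltn_ord (s i); rewrite /N; lia.
have [s hs|no] := pickP (fun s : 'S_n => \prod_i reflection_coef (s i) (e i) != 0); last first.
  by rewrite cE big1 ?eqxx // => s _; have /negbFE/eqP -> := no s; rewrite mulr0.
have es i : (e i = n.-1 + s i \/ e i + s i = n.-1)%N.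
  by have /prodf_neq0/(_ i isT) h := hs; have [] := reflection_coef_neq0 h (ltn_ord _).
rewrite cE (bigD1 s) //= [X in _ + X]big1 ?addr0 => [_|t ts].
  split; last by exists s.
  rewrite normrM normr_sign mul1r normr_prod big1 // => i _.
  by have /prodf_neq0/(_ i isT) h := hs; have [] := reflection_coef_neq0 h (ltn_ord _).
have [->|ht] := eqVneq (\prod_i reflection_coef (t i) (e i)) 0; first by rewrite mulr0.
case/eqP: ts; apply/permP => i; apply: val_inj => /=.
have /prodf_neq0/(_ i isT) h := ht; have [et _] := reflection_coef_neq0 h (ltn_ord _).
by have := es i; have := ltn_ord (s i); have := ltn_ord (t i); lia.
Qed.

End ReflectionCoefficients.

Lemma card_ord_lt n m : (m <= n)%N -> #|[set i : 'I_n | (i < m)%N]| = m.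
Proof.
move=> mn; rewrite -[RHS]card_ord -[RHS]sum1_card (big_ord_widen n (fun=> 1%N) mn).
by rewrite sum1_card; apply: eq_card => i; rewrite inE.
Qed.

Lemma card_ord_gt n m : #|[set i : 'I_n | (m < i)%N]| = (n - m.+1)%N.
Proof.
have [mn|mn] := ltnP m n; last first.
  rewrite (eqP (leqW mn : n - m.+1 == 0)%N); apply: eq_card0 => i; rewrite inE.
  by apply/negbTE; rewrite -leqNgt ltnW // (leq_trans (ltn_ord i)).
have := cardsC [set i : 'I_n | (i < m.+1)%N]; rewrite card_ord_lt // card_ord => e.
rewrite -[in RHS]e addKn; apply: eq_card => i; rewrite !inE.
by rewrite ltnS -ltnNge.
Qed.

Lemma initial_segment n (J : {set 'I_n}) :
  (forall i j : 'I_n, j \in J -> (i < j)%N -> i \in J) ->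
  forall i : 'I_n, (i \in J) = (i < #|J|)%N.
Proof.
move=> Jd i; apply/idP/idP => [iJ|].
  rewrite -(card_ord_lt (ltn_ord i)); apply/subset_leq_card/subsetP => j.
  rewrite inE ltnS leq_eqVlt => /orP[/eqP/val_inj -> //|]; exact: Jd.
apply: contraTT => iJ; rewrite -leqNgt -(card_ord_lt (ltnW (ltn_ord i))).
apply/subset_leq_card/subsetP => j jJ; rewrite inE ltnNge leq_eqVlt negb_or.
apply/andP; split; first by apply: contraNneq iJ => /val_inj ->.
by apply: contra iJ; apply: Jd.
Qed.

(** * Threshold graphs with prescribed degrees *)

Section Threshold.
Variables (n : nat) (lam : nat -> nat) (s : 'S_n).
Hypothesis lam_dec : forall i j, (i <= j)%N -> (lam j <= lam i)%N.
Hypothesis lam_perm : forall i : 'I_n, (lam i = i + s i \/ lam i + s i = i)%N.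

Definition adjacent (i j : 'I_n) : bool :=
  (j != i) && (if (i < j)%N then (j <= lam i)%N else (i <= lam j)%N).

Definition threshold : {set kset n 2} :=
  [set T : kset n 2 | [exists i : 'I_n, exists j : 'I_n,
     adjacent i j && (val T == [set i; j])]].

Lemma adjacentC i j : adjacent i j = adjacent j i.
Proof.
by rewrite /adjacent eq_sym -val_eqE /=; case: ltngtP.
Qed.

Lemma in_threshold T i j : val T = [set i; j] -> (T \in threshold) = adjacent i j.
Proof.
move=> e; rewrite inE; apply/existsP/idP => [[i']|a]; last first.
  by exists i; apply/existsP; exists j; rewrite a e eqxx.
case/existsP => j' /andP[a /eqP]; rewrite e => /setP e'.
have := e' i; have := e' j; have := e' i'; have := e' j'.
rewrite !inE !eqxx ?orbT /= => /orP e1 /orP e2 /esym/orP e3 /esym/orP e4.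
have ne := a; rewrite /adjacent in ne; case/andP: ne => ne _.
case: e4 => /eqP e4; case: e3 => /eqP e3; subst => //.
- by case: e1 => /eqP e1; case/eqP: ne.
- by rewrite adjacentC.
- by case: e2 => /eqP e2; case/eqP: ne.
Qed.

Lemma fdeg_threshold i : fdeg threshold i = #|[set j | adjacent i j]|.
Proof.
rewrite /fdeg -(card_imset _ val_inj).
rewrite -[RHS](card_in_imset (f := fun j => [set i; j])); last first.
  move=> j j'; rewrite !inE => /andP[ji _] /andP[j'i _] /setP/(_ j).
  by rewrite !inE eqxx orbT (negPf ji) /= => /esym/eqP.
apply: eq_card => S; apply/imsetP/imsetP => [[T]|[j]].
  rewrite inE => /andP[Tt iT] ->.
  have /cards2P[a [b [ab e]]] : #|val T| == 2 by apply: (valP T).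
  move: iT; rewrite e !inE => /orP[]/eqP->.
    by exists b => //; rewrite inE -(in_threshold e).
  by exists a; rewrite 1?setUC // inE -(@in_threshold T) // e setUC.
rewrite inE => a ->.
have c : #|[set i; j]| == 2 by rewrite cards2; case/andP: a; rewrite eq_sym => ->.
exists (exist (fun S : {set 'I_n} => #|S| == 2) _ c) => //.
by rewrite inE (in_threshold (i := i) (j := j)) // a !inE eqxx.
Qed.

Lemma threshold_closed : dominance_closed threshold.
Proof.
move=> S T; have /cards2P[a [b [ab eS]]] : #|val S| == 2 by apply: (valP S).
wlog lt : a b ab eS / (a < b)%N.
  move=> h; move: (ab); rewrite -val_eqE /=; case: ltngtP => // lt _.
    exact: (h a b).
  by apply: (h b a) => //; rewrite 1?eq_sym // setUC.
rewrite [T \in _]inE => /existsP[i /existsP[j]].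
wlog ij : i j / (i < j)%N.
  move=> h /andP[aij /eqP eT]; have := aij => /andP[]; rewrite -val_eqE /=.
  case: ltngtP => // ij _ _; first by apply: (h i j) => //; rewrite aij eT /=.
  by apply: (h j i) => //; rewrite adjacentC aij eT setUC /=.
case/andP => aij /eqP eT dom.
rewrite (in_threshold eS) /adjacent eq_sym ab lt /=.
move: aij; rewrite /adjacent ij => /andP[_ jl].
have cnt (x y : 'I_n) (U : {set 'I_n}) m : x != y -> U = [set x; y] ->
    #|[set z in U | (z < m)%N]| = ((x < m) + (y < m))%N.
  move=> xy ->; rewrite (_ : [set z in _ | _] =
    (if (x < m)%N then [set x] else set0) :|: (if (y < m)%N then [set y] else set0)).
    by case: ifP => _; case: ifP => _; rewrite ?setU0 ?set0U ?cards2 ?xy ?cards1 ?cards0.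
  apply/setP => z; rewrite !inE.
  case: (altP (z =P x)) => [->|zx] /=.
    by case: (x < m)%N; case: (y < m)%N; rewrite ?inE ?eqxx ?(negPf xy).
  case: (altP (z =P y)) => [->|zy] /=.
    by rewrite orbC; case: (x < m)%N; case: (y < m)%N; rewrite ?inE ?eqxx // eq_sym ?(negPf xy).
  by case: (x < m)%N; case: (y < m)%N; rewrite ?inE ?(negPf zx) ?(negPf zy).
have ij' : i != j by rewrite -val_eqE /= ltn_eqF.
(* The counts at i + 1 and j + 1 give a <= i and b <= j, and then b <= j <= lam i <= lam a. *)
have d1 := dom i.+1; have d2 := dom j.+1.
rewrite !(cnt _ _ _ _ ab eS) !(cnt _ _ _ _ ij' eT) in d1 d2.
have ai : (a <= i)%N by lia.
have bj : (b <= j)%N by lia.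
exact: leq_trans (leq_trans bj jl) (lam_dec ai).
Qed.

Lemma lam_lt (i : 'I_n) : (lam i < n)%N.
Proof.
have n0 : (0 < n)%N by apply: leq_ltn_trans (ltn_ord i).
apply: leq_ltn_trans (lam_dec (leq0n i)) _.
by have := lam_perm (Ordinal n0); have := ltn_ord (s (Ordinal n0)); rewrite /=; lia.
Qed.

(** The neighbours of i are all j <= lam i other than i, those before i because lam j >= lam i >=
    i. *)
Lemma card_adjacent_ge (i : 'I_n) : lam i = (i + s i)%N ->
  #|[set j | adjacent i j]| = lam i.
Proof.
move=> li.
have -> : [set j | adjacent i j] = [set j : 'I_n | (j < (lam i).+1)%N] :\ i.
  apply/setP => j; rewrite !inE /adjacent ltnS; congr (_ && _).
  case: ltnP => // ji; apply/idP/idP => _; last first.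
    by apply: leq_trans (lam_dec ji); rewrite li leq_addr.
  by rewrite li; lia.
have := cardsD1 i [set j : 'I_n | (j < (lam i).+1)%N].
by rewrite card_ord_lt ?lam_lt // inE ltnS li leq_addr => -[].
Qed.

(* The [n - 1 - s i] indices [j] with [s j > s i] comprise the [n - 1 - i]
   indices above [i]; the others form an initial segment, of size [lam i]. *)
Lemma card_adjacent_lt (i : 'I_n) : (lam i + s i = i)%N -> (0 < s i)%N ->
  #|[set j | adjacent i j]| = lam i.
Proof.
move=> li si.
pose J := [set j : 'I_n | (s i < s j)%N && (j < i)%N].
have above (j : 'I_n) : (i < j)%N -> (s i < s j)%N.
  move=> ij; have := lam_dec (ltnW ij); have := lam_perm j; lia.
have JE : #|J| = lam i.
  have := cardsID [set j : 'I_n | (i < j)%N] [set j | (s i < s j)%N].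
  rewrite -[in X in _ = X -> _](card_imset _ (@perm_inj _ s)).
  have -> : s @: [set j | (s i < s j)%N] = [set y : 'I_n | (s i < y)%N].
    apply/setP => y; rewrite inE; apply/imsetP/idP => [[j]|h]; first by rewrite inE => h ->.
    by exists ((s^-1)%g y); rewrite ?inE permKV.
  have -> : [set j | (s i < s j)%N] :&: [set j : 'I_n | (i < j)%N] = [set j : 'I_n | (i < j)%N].
    by apply/setP => j; rewrite !inE andbC; case: ltnP => //= /above ->.
  have -> : [set j | (s i < s j)%N] :\: [set j : 'I_n | (i < j)%N] = J.
    apply/setP => j; rewrite !inE andbC; case: ltnP => //= h.
    rewrite -leqNgt leq_eqVlt; case: eqP => //= /val_inj e.
    by rewrite e ltnn in h.
  rewrite !card_ord_gt; have := ltn_ord i; have := ltn_ord (s i).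
  by move: #|J| => c; lia.
have Jlam (j : 'I_n) : j \in J -> (j + s i < lam j)%N.
  rewrite inE => /andP[sij ji]; have := lam_dec (ltnW ji); have := lam_perm j; lia.
have lamJ (j : 'I_n) : (j < i)%N -> (j + s i < lam j)%N -> j \in J.
  move=> ji lj; rewrite inE ji andbT; have := lam_perm j; lia.
have Jd (a j : 'I_n) : j \in J -> (a < j)%N -> a \in J.
  move=> jJ aj; have := Jlam j jJ; move: jJ; rewrite inE => /andP[_ ji] h.
  apply: lamJ; first exact: ltn_trans aj ji.
  by have := lam_dec (ltnW aj); lia.
have seg := initial_segment Jd; rewrite JE in seg.
rewrite -JE; apply: eq_card => j; rewrite !inE /adjacent -val_eqE /=.
have sij (a : 'I_n) : (a < i)%N -> s a != s i :> nat.
  by move=> ai; rewrite (inj_eq val_inj) (inj_eq perm_inj) -val_eqE /= ltn_eqF.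
have [ji|ij|->] := ltngtP j i; rewrite ?andbF //=.
- have jJ : (j \in J) = (s i < s j)%N by rewrite inE ji andbT.
  rewrite andbT -jJ seg; apply/idP/idP => h.
    (* The index lam i is the first outside [J], so s (lam i) < s i and lam (lam i) < lam i + s i =
       i, contrary to i <= lam j <= lam (lam i). *)
    rewrite ltnNge; apply/negP => lj.
    have li' : (lam i < n)%N := lam_lt i.
    have l0 : (lam i < i)%N by lia.
    have := seg (Ordinal li'); rewrite /= ltnn => /negbT l0J.
    have h0 : (i <= lam (lam i))%N by apply: leq_trans h (lam_dec lj).
    by have := lamJ (Ordinal li') l0; have := sij (Ordinal li') l0;
       have := lam_perm (Ordinal li'); move: l0J; rewrite inE /= l0 andbT; lia.
  (* The last element of [J] is lam i - 1, where [Jlam] yields i <= lam (lam i - 1) <= lam j. *)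
  have l1 : ((lam i).-1 < n)%N by have := lam_lt i; lia.
  have := seg (Ordinal l1); rewrite /= (_ : (_.-1 < _)%N); last lia.
  move/Jlam => /= h1; have : (lam (lam i).-1 <= lam j)%N by apply: lam_dec; lia.
  lia.
- by apply/negbTE; rewrite -ltnNge; lia.
Qed.

Lemma card_adjacent i : #|[set j | adjacent i j]| = lam i.
Proof.
have [li|li] := lam_perm i; first exact: card_adjacent_ge.
have [s0|si] := posnP (s i); last exact: card_adjacent_lt.
by apply: card_adjacent_ge; lia.
Qed.

End Threshold.

(** * Equality for k + 2 variables *)

Lemma alt_coefE k n lam : alt_coef (plethysm_series k n) lam =
  \sum_(s : 'S_n) \sum_(K : {set kset n k}) (-1) ^+ s *
    ([multinom (n - (s i).+1)%N | i < n] + fdegm K == mnm_fun n (shift_delta n lam))%MM%:R.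
Proof.
rewrite /alt_coef plethysm_seriesE mulr_suml raddf_sum /=; apply: eq_bigr => s _.
rewrite mulr_sumr raddf_sum /=; apply: eq_bigr => K _.
by rewrite -scalerAl mcoeffZ -mpolyXD mcoeffX.
Qed.

Lemma mcoeff_vdm_plethysm k n e : (vdm n * plethysm_series k n)@_e =
  \sum_(s : 'S_n) \sum_(K : {set kset n k}) (-1) ^+ s *
    ([multinom nat_of_ord (s i) | i < n] + fdegm K == e)%MM%:R.
Proof.
rewrite vdm_sum plethysm_seriesE mulr_suml raddf_sum /=; apply: eq_bigr => s _.
rewrite mulr_sumr raddf_sum /=; apply: eq_bigr => K _.
by rewrite -scalerAl mcoeffZ -mpolyXD mcoeffX.
Qed.

Lemma sum_fdeg n k (K : {set kset n k}) : (\sum_i fdeg K i = k * #|K|)%N.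
Proof.
transitivity (\sum_i \sum_(T in K) (i \in val T))%N.
  apply: eq_bigr => i _; rewrite /fdeg -sum1dep_card [LHS]big_mkcondr /=.
  by apply: eq_bigr => T _; case: (i \in _).
rewrite exchange_big /= mulnC -sum_nat_const; apply: eq_bigr => T _.
transitivity #|val T|; last exact/eqP/(valP T).
rewrite -sum1_card [RHS]big_mkcond /=.
by apply: eq_bigr => i _; case: (i \in _).
Qed.

Lemma mdeg_fdegm n k (K : {set kset n k}) : mdeg (fdegm K) = (k * #|K|)%N.
Proof. by rewrite mdegE -sum_fdeg; apply: eq_bigr => i _; rewrite mnmE. Qed.

Lemma fdeg_le n k (K : {set kset n k}) i : (fdeg K i <= #|K|)%N.
Proof. by apply/subset_leq_card/subsetP => T; rewrite inE => /andP[]. Qed.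

Section Complement.
Variables (n k k' : nat).
Hypothesis kk' : (k + k' = n)%N.

Lemma card_complement (T : kset n k) : #|~: val T| == k'.
Proof. by have := cardsC (val T); rewrite card_ord (eqP (valP T)) => e; apply/eqP; lia. Qed.

Definition kcompl (T : kset n k) : kset n k' :=
  exist (fun U : {set 'I_n} => #|U| == k') (~: val T) (card_complement T).

Lemma kcompl_inj : injective kcompl.
Proof. by move=> T U /(congr1 val) /= /setC_inj /val_inj. Qed.

Lemma fdeg_kcompl (K : {set kset n k}) i :
  (fdeg (kcompl @: K) i + fdeg K i = #|K|)%N.
Proof.
rewrite addnC -(cardsID [set T : kset n k | i \in val T] K); congr (_ + _)%N.
  by apply: eq_card => T; rewrite !inE andbC.
rewrite /fdeg -(card_imset _ kcompl_inj); apply: eq_card => U; rewrite inE.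
apply/andP/imsetP => [[/imsetP[T TK ->]]|[T]].
  by rewrite inE => iT; exists T; rewrite // !inE TK andbT.
rewrite !inE => /andP[iT TK] ->; split; first exact: imset_f.
by rewrite inE.
Qed.

End Complement.

Lemma kcomplK n k k' (e : (k + k' = n)%N) (e' : (k' + k = n)%N) (K : {set kset n k}) :
  kcompl e' @: (kcompl e @: K) = K.
Proof.
rewrite -imset_comp -[RHS]imset_id; apply: eq_imset => T /=.
by apply: val_inj; rewrite /= setCK.
Qed.

Lemma complement_exponent (n s i l m a b c : nat) : (s < n)%N -> (i < n)%N ->
  (l <= m)%N -> (a + b = c)%N -> c = m ->
  (n - s.+1 + b = l + (n - i.+1))%N <-> (s + a = m + i - l)%N.
Proof. by lia. Qed.

Lemma complement_card (n k a b x : nat) : (k + 2 = n)%N ->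
  (x + 2 * a + k * b = n * b + x)%N -> a = b.
Proof. by move=> <-; rewrite mulnDl; lia. Qed.

Section ComplementCoefficient.
Variables (k n : nat) (lam : seq nat).
Hypothesis k_gt0 : (0 < k)%N.
Hypothesis kn : (k + 2 = n)%N.
Hypothesis lam_sorted : sorted geq lam.
Hypothesis size_lam : (size lam <= n)%N.

Local Notation l := (nth 0%N lam).

(** A contributing family has m members, where k m is the sum of [lam], and k > 0 makes m unique.
    Complementing its members turns degrees d_i into m - d_i, so that the exponents n - 1 - s i of
    a_delta become the exponents s i of [vdm]. *)
Lemma alt_coef_complement : alt_coef (plethysm_series k n) lam != 0 ->
  exists m, [/\ (k * m = sumn lam)%N, forall i, (l i <= m)%N &
    alt_coef (plethysm_series k n) lam =
    (vdm n * plethysm_series 2 n)@_[multinom (m + i - l i)%N | i < n]].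
Proof.
have perm_sum (s : 'S_n) (F : nat -> nat) : (\sum_i F (s i) = \sum_(i < n) F i)%N.
  by rewrite [RHS](reindex_inj (@perm_inj _ s)).
have msum (s : 'S_n) (K : {set kset n k}) :
    ([multinom (n - (s i).+1)%N | i < n] + fdegm K)%MM = mnm_fun n (shift_delta n lam) ->
    (k * #|K| = sumn lam)%N.
  move/(congr1 mdeg); rewrite mdeg_shift_delta // mdegD mdeg_fdegm mdegE.
  rewrite (eq_bigr (fun i => n - (s i).+1)%N) => [|i _]; last by rewrite mnmE.
  by rewrite (perm_sum s (fun j => n - j.+1)%N) => /addnI.
move=> nz.
have [[s0 K0] /= /eqP e0|no] := pickP (fun p : 'S_n * {set kset n k} =>
    [multinom (n - (p.1 i).+1)%N | i < n] + fdegm p.2 ==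
      mnm_fun n (shift_delta n lam))%MM; last first.
  case/eqP: nz; rewrite alt_coefE big1 // => s _; rewrite big1 // => K _.
  by have := no (s, K) => /= ->; rewrite mulr0.
have m0 := msum _ _ e0.
have lm i : (l i <= #|K0|)%N.
  apply: leq_trans (nth_sorted_geq lam_sorted (leq0n i)) _.
  have n0 : (0 < n)%N by lia.
  have := fdeg_le K0 (Ordinal n0); move/mnmP/(_ (Ordinal n0)): e0.
  by rewrite mnmDE !mnmE /shift_delta /=; lia.
exists #|K0|; split=> //.
have nk : (2 + k = n)%N by lia.
rewrite alt_coefE mcoeff_vdm_plethysm; apply: eq_bigr => s _.
rewrite [RHS](reindex (fun K : {set kset n k} => kcompl kn @: K)) /=; last first.
  by exists (fun K : {set kset n 2} => kcompl nk @: K) => K _; apply: kcomplK.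
apply: eq_bigr => K _; congr (_ * (nat_of_bool _)%:R).
apply/eqP/eqP => e.
  have KK0 : #|K| = #|K0|.
    by apply/eqP; rewrite -(eqn_pmul2l k_gt0) m0 (msum _ _ e).
  apply/mnmP => i; move/mnmP/(_ i): e; rewrite !mnmDE !mnmE.
  by move/(complement_exponent (ltn_ord _) (ltn_ord i) (lm i) (fdeg_kcompl kn K i) KK0).
(* Comparing total degrees gives 2 |K| + k m = n m with m = |K0|, and n = k + 2. *)
have KK0 : #|K| = #|K0|.
  move: e => /(congr1 mdeg).
  rewrite mdegD mdeg_fdegm card_imset ?mdegE; last exact: kcompl_inj.
  rewrite (eq_bigr (fun i => s i : nat)) => [|i _]; last by rewrite mnmE.
  rewrite (perm_sum s id).
  move=> e.
  have : (\sum_(i < n) [multinom (#|K0| + i - l i)%N | i < n]%MM i + \sum_(i < n) l i =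
          \sum_(i < n) #|K0| + \sum_(i < n) i)%N.
    rewrite -!big_split /=; apply: eq_bigr => i _; rewrite mnmE.
    by rewrite subnK // (leq_trans (lm i)) // leq_addr.
  rewrite -e -(sumn_nth size_lam) -m0 sum_nat_const card_ord.
  exact: complement_card.
apply/mnmP => i; move/mnmP/(_ i): e; rewrite !mnmDE !mnmE.
by move/(complement_exponent (ltn_ord _) (ltn_ord i) (lm i) (fdeg_kcompl kn K i) KK0).
Qed.

End ComplementCoefficient.

Lemma plethysm2_coef_unit lam : is_partition lam -> plethysm_coef 2 lam != 0 ->
  `|plethysm_coef 2 lam| = 1 /\ (0 < num_shifted 2 lam)%N.
Proof.
move=> pl; rewrite (plethysm_coefE 2 pl (leqnn _)) => nz.
set n := size lam in nz *.
have srt : sorted geq lam by case/andP: pl.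
have [b vb] := vdm_alt_delta n.
pose e := mnm_fun n (shift_delta n lam).
have cE : (vdm n * plethysm_series 2 n)@_e = (-1) ^+ b * alt_coef (plethysm_series 2 n) lam.
  by rewrite vb -scalerAl mcoeffZ.
have [|c1 [s hs]] := @mcoeff_vdm_plethysm2 n e.
  by rewrite cE mulf_eq0 signr_eq0.
split; first by move: c1; rewrite cE normrM normr_sign mul1r.
have lp (i : 'I_n) : (nth 0 lam i = i + s i \/ nth 0 lam i + s i = i)%N.
  by have := hs i; rewrite mnmE /shift_delta; have := ltn_ord i; lia.
have ldec i j : (i <= j)%N -> (nth 0 lam j <= nth 0 lam i)%N by apply: nth_sorted_geq.
apply: (@num_shifted_gt0 n 2 lam (threshold n (nth 0%N lam))) => //.
  exact: threshold_closed.
by move=> i; rewrite fdeg_threshold; apply: card_adjacent lp i.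
Qed.

(** * Complement and reversal of shifted families *)

Section ReverseComplement.
Variables (n k : nat).
Hypothesis kn : (k + 2 = n)%N.

Local Notation r := (rev_perm n).

Lemma card_revcompl (T : kset n k) : #|r @: ~: val T| == 2.
Proof. by rewrite card_imset ?(card_complement kn) //; apply: perm_inj. Qed.

(** Complementation reverses the componentwise order; reversing the ground set as well restores it,
    so that closed families stay closed. *)
Definition revcompl (T : kset n k) : kset n 2 :=
  exist (fun U : {set 'I_n} => #|U| == 2) (r @: ~: val T) (card_revcompl T).

Lemma in_revcompl (T : kset n k) i : (r i \in val (revcompl T)) = (i \notin val T).
Proof. by rewrite /= mem_imset ?inE //; apply: perm_inj. Qed.

Lemma revcompl_inj : injective revcompl.
Proof.
move=> T U e; apply: val_inj; apply/setP => i; apply: negb_inj.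
by rewrite -!in_revcompl e.
Qed.

Lemma revcompl_surj (U : kset n 2) : exists T, revcompl T = U.
Proof.
have imK : r @: (r @^-1: val U) = val U.
  apply/setP => x; rewrite -(permKV r x) mem_imset ?inE //; exact: perm_inj.
have c2 : #|r @^-1: val U| = 2.
  by rewrite -(card_imset _ (@perm_inj _ r)) imK; apply/eqP/(valP U).
have c : #|~: (r @^-1: val U)| == k.
  by have := cardsC (r @^-1: val U); rewrite c2 card_ord => ec; apply/eqP; lia.
exists (exist (fun S : {set 'I_n} => #|S| == k) _ c).
by apply: val_inj; rewrite /= setCK.
Qed.

Lemma fdeg_revcompl (K : {set kset n 2}) i :
  (fdeg (revcompl @^-1: K) i + fdeg K (r i) = #|K|)%N.
Proof.
rewrite addnC -(cardsID [set U : kset n 2 | r i \in val U] K); congr (_ + _)%N.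
  by apply: eq_card => U; rewrite !inE andbC.
rewrite /fdeg -(card_imset _ revcompl_inj); apply: eq_card => U; rewrite !inE.
apply/imsetP/andP => [[T]|[iU UK]].
  by rewrite !inE => /andP[TK iT] ->; rewrite in_revcompl iT.
have [T eT] := revcompl_surj U; exists T => //.
by rewrite !inE eT UK; move: iU; rewrite -eT in_revcompl negbK.
Qed.

Lemma card_revcompl_lt (T : kset n k) m :
  (#|[set x in val (revcompl T) | (x < m)%N]| + k =
   #|[set y : 'I_n | (n - m <= y)%N]| + #|[set y in val T | (y < n - m)%N]|)%N.
Proof.
have -> : [set x in val (revcompl T) | (x < m)%N] =
    r @: ([set y : 'I_n | (n - m <= y)%N] :\: val T).
  apply/setP => x; rewrite -(permKV r x); move: (r^-1 x)%g => y.
  rewrite mem_imset ?inE; last exact: perm_inj.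
  rewrite in_revcompl rev_permE; congr (_ && _); have := ltn_ord y; lia.
rewrite card_imset; last exact: perm_inj.
rewrite -(cardsID (val T) [set y : 'I_n | (n - m <= y)%N]).
have := cardsID [set y : 'I_n | (y < n - m)%N] (val T); rewrite (eqP (valP T)).
have -> : val T :\: [set y : 'I_n | (y < n - m)%N] = [set y : 'I_n | (n - m <= y)%N] :&: val T.
  by apply/setP => y; rewrite !inE -leqNgt.
have -> : val T :&: [set y : 'I_n | (y < n - m)%N] = [set y in val T | (y < n - m)%N].
  by apply/setP => y; rewrite !inE.
move=> e; rewrite -[X in (_ + X = _)%N]e.
by rewrite addnCA addnA [RHS]addnC [X in _ = (_ + X)%N]addnC addnA addnC addnA.
Qed.

Lemma revcompl_closed (K : {set kset n 2}) :
  dominance_closed K -> dominance_closed (revcompl @^-1: K).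
Proof.
move=> Kc S T; rewrite !inE => TK dom; apply: Kc TK _ => m.
rewrite -(leq_add2r k) !card_revcompl_lt leq_add2l; exact: dom.
Qed.

End ReverseComplement.

Lemma plethysm_short_coef_unit k lam : is_partition lam -> (0 < k)%N ->
  (size lam <= k + 2)%N -> plethysm_coef k lam != 0 ->
  `|plethysm_coef k lam| = 1 /\ (0 < num_shifted k lam)%N.
Proof.
move=> pl k0 sz; rewrite (plethysm_coefE k pl sz).
move e : (k + 2)%N => n in sz * => nz.
have srt : sorted geq lam by case/andP: pl.
have [m [km lm cE]] := alt_coef_complement k0 e srt sz nz.
rewrite cE in nz *; have [c1 [s hs]] := mcoeff_vdm_plethysm2 nz.
split=> //.
pose r := rev_perm n.
have rE (i : 'I_n) : r i = (n.-1 - i)%N :> nat := rev_permE i.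
(* The degrees of the complementary family of pairs, reversed so as to decrease; by [hs] the |mu_i -
   i| form a permutation. *)
pose mu (j : nat) : nat := (m - nth 0 lam (n.-1 - j))%N.
have mu_r (i : 'I_n) : mu (r i) = (m - nth 0 lam i)%N.
  by rewrite /mu rE subKn //; have := ltn_ord i; lia.
have mu_dec i j : (i <= j)%N -> (mu j <= mu i)%N.
  by move=> ij; rewrite leq_sub2l //; apply: nth_sorted_geq => //; rewrite leq_sub2l.
have mu_perm (i : 'I_n) : (mu i = i + (r * s)%g i \/ mu i + (r * s)%g i = i)%N.
  have := hs (r i); rewrite mnmE permM rE /mu.
  by have := lm (n.-1 - i)%N; have := ltn_ord i; lia.
pose K2 := threshold n mu.
have K2deg i : fdeg K2 i = mu i by rewrite fdeg_threshold; apply: card_adjacent mu_perm i.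
(* Complementing back gives the degrees |K2| - mu, which are those of [lam] once |K2| = m; the total
   degree of [K2] ensures this. *)
have K2card : #|K2| = m.
  apply: (complement_card (x := 0%N) e); rewrite addn0 add0n.
  rewrite -(sum_fdeg K2) km (sumn_nth sz).
  rewrite [X in (X + _)%N](reindex_inj (@perm_inj _ r)) -big_split /=.
  rewrite (eq_bigr (fun=> m)) => [|i _]; last by rewrite K2deg mu_r subnK.
  by rewrite sum_nat_const card_ord.
apply: (@num_shifted_gt0 n k lam (revcompl e @^-1: K2)) => //.
  by apply: revcompl_closed; apply: threshold_closed.
move=> i; have := fdeg_revcompl e K2 i; rewrite K2card K2deg mu_r.
by have := lm i; lia.
Qed.

Lemma plethysm_series0 n : plethysm_series 0 n = 2%:R.
Proof.
rewrite /plethysm_series (big_pred1 set0) => [|S]; last by rewrite /= cards_eq0.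
by rewrite big_set0.
Qed.

Lemma plethysm0_coef lam : is_partition lam ->
  plethysm_coef 0 lam = (lam == [::])%:R *+ 2.
Proof.
move=> pl; rewrite (plethysm_coefE 0 pl (leqnn _)) /alt_coef plethysm_series0.
have srt : sorted geq lam by case/andP: pl.
rewrite mulr_natr mcoeffMn -alt_poly_delta mcoeff_alt_poly.
- congr ((nat_of_bool _)%:R *+ 2); apply/forallP/eqP => [h|-> [] //].
  case E : lam pl => [//|a l] /andP[_]; rewrite -E => /negP[].
  have n0 : (0 < size lam)%N by rewrite E.
  have := h (Ordinal n0); rewrite mnmE /shift_delta /= -[X in _ == X]add0n eqn_add2r.
  by move/eqP => <-; apply: mem_nth.
- by move=> i j ij; have := ltn_ord j; lia.
- by move=> i j ij; rewrite !mnmE; apply: shift_delta_strict.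
Qed.

(** The one equality case with a coefficient above 1: the empty family and the family of the empty
    set both have all degrees 0. *)
Lemma num_shifted0_nil : (2 <= num_shifted 0 [::])%N.
Proof.
have h K : K = fset0 \/ K = [fset fset0]%fset -> K \in shifted_families 0 [::].
  move=> hK; have K0 A : A \in K -> A = fset0.
    by case: hK => ->; rewrite !inE // => /eqP.
  apply/in_shifted_families; split; first split.
  - by move=> A /K0 ->; rewrite cardfs0.
  - move=> A B BK /eqP; rewrite cardfs_eq0 => /eqP -> _.
    by rewrite -(K0 B BK).
  move=> i; rewrite nth_nil; apply/eqP; rewrite cardfs_eq0; apply/eqP/fsetP => A.
  by rewrite !inE; apply/negP => /andP[/K0 ->]; rewrite inE.
rewrite /num_shifted.
have := @uniq_leq_size _ [:: fset0; [fset fset0]%fset] (shifted_families 0 [::]).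
apply=> [|K]; last first.
  rewrite !in_cons in_nil orbF => /orP[]/eqP->.
    exact: h (or_introl erefl).
  exact: h (or_intror erefl).
rewrite /= inE andbT; apply/eqP => /fsetP/(_ fset0); by rewrite !inE eqxx.
Qed.

Theorem theorem5p9 (k : nat) (lam : seq nat) (lam_part : is_partition lam) :
  (num_shifted k lam)%:Z <= plethysm_coef k lam /\
  (k = 2%N \/ (size lam <= k + 2)%N ->
   plethysm_coef k lam = (num_shifted k lam)%:Z).
Proof.
have le := num_shifted_le_plethysm k lam_part; split=> // hk.
suff : plethysm_coef k lam <= (num_shifted k lam)%:Z.
  by move=> ge; apply/eqP; rewrite eq_le ge le.
have [c0|nz] := eqVneq (plethysm_coef k lam) 0; first by rewrite c0.
case: (posnP k) => [k0|k0].
  move: nz; rewrite k0 plethysm0_coef //.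
  have [->|] := eqVneq lam [::]; last by rewrite mul0rn eqxx.
  by move=> _; apply: (@le_trans _ _ 2%:Z) => //; rewrite lez_nat num_shifted0_nil.
have [c1 n0] : `|plethysm_coef k lam| = 1 /\ (0 < num_shifted k lam)%N.
  case: hk => [k2|sz]; last exact: plethysm_short_coef_unit.
  by subst k; apply: plethysm2_coef_unit.
by have := ler_norm (plethysm_coef k lam); rewrite c1; lia.
Qed.
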